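(* Let $P_{12}$ be the simplicial complex on the vertex set $\{1,\dots,12\}$ whose tetrahedra are the orbits of $(1\,2\,3\,5)$, $(1\,2\,5\,10)$ and $(1\,2\,10\,11)$ under the group $G$ generated by the permutations $T=(1\,3\,5\,7\,9\,11)(2\,4\,6\,8\,10\,12)$, $R=(1\,10)(2\,5)(3\,12)(4\,7)(6\,9)(8\,11)$, and $S=(1\,11)(2\,10)(3\,9)(4\,8)(5\,7)$. Then $P_{12}$ admits a tight polyhedral embedding into the $3$-skeleton of the boundary complex of the $6$-dimensional cross polytope $\beta^6$. Under this embedding, the six missing edges of $P_{12}$, namely $(1\,7),(2\,8),(3\,9),(4\,10),(5\,11),(6\,12)$, correspond to the six diagonals of $\beta^6$.
   Context: $G$ has order $24$. $P_{12}$ is a triangulation of $\mathbb{R}P^3$ with $f$-vector $(12,60,96,48)$. The cross polytope $\beta^6$ is the convex hull of $\pm e_1,\dots,\pm e_6$ in $\mathbb{R}^6$. Its diagonals are the segments joining antipodal vertices $e_i$ and $-e_i$. A polyhedral embedding of $P_{12}$ into the boundary complex of $\beta^6$ maps the vertices of $P_{12}$ bijectively onto the vertices of $\beta^6$ and extends linearly on each simplex, so that every simplex of $P_{12}$ is mapped onto a face of $\beta^6$. An embedding $f\colon M\to\mathbb{R}^d$ of a compact manifold is tight if, for every open or closed half-space $E_+\subset\mathbb{R}^d$, the induced homomorphism $H_*(f^{-1}(E_+);\mathbb{F})\to H_*(M;\mathbb{F})$ in singular homology is injective for some field $\mathbb{F}$. For $\mathbb{R}P^3$ the field is $\mathbb{F}=\mathbb{Z}_2$.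 *)

(* Defs.v *)
From HB Require Import structures.
From mathcomp Require Import all_boot all_order all_algebra all_fingroup finmap.
From mathcomp Require Import all_classical all_reals all_analysis.
(* The notations of monalg clash with those of mathcomp-analysis. *)
From mathcomp Require Import -(notations) monalg.

Set Implicit Arguments.
Unset Strict Implicit.
Unset Printing Implicit Defensive.

Import Order.TTheory GRing.Theory Num.Theory.
Import numFieldNormedType.Exports.

Local Open Scope classical_set_scope.
Local Open Scope ring_scope.

(* The standard simplex with n vertices; its dimension is n - 1. *)
Definition simplex (R : realType) (n : nat) : set 'rV[R]_n :=
  [set x | (forall i, 0 <= x 0 i) /\ \sum_i x 0 i = 1].
Arguments simplex : clear implicits.

Section Coface.
Variables (R : realType) (n : nat) (i : 'I_n.+1).

Definition coface_row (x : 'rV[R]_n) : 'rV[R]_n.+1 :=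
  \row_j (if unlift i j is Some j' then x 0 j' else 0).

Lemma coface_subproof (x : simplex R n) :
  coface_row (set_val x) \in simplex R n.+1.
Proof.
have [x0 x1] := set_mem (valP x).
apply/mem_set; split=> [j|]; first by rewrite mxE; case: (unlift i j).
rewrite (bigD1_ord i) //= mxE unlift_none add0r -[RHS]x1.
by apply: eq_bigr => j _; rewrite mxE liftK.
Qed.

(* The inclusion of the face opposite to vertex i. *)
Definition coface (x : simplex R n) : simplex R n.+1 :=
  exist _ (coface_row (set_val x)) (coface_subproof x).

Lemma coface_row_continuous : continuous coface_row.
Proof.
move=> x U [P xP PU]; exists (fun p j => P p (lift i j)) => [p j|y yP].
  by have := xP p (lift i j); rewrite mxE liftK ord1.
apply: PU => p j; rewrite mxE; case: (unliftP i j) => [j' ->|->].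
  by rewrite -(ord1 p); exact: yP.
by have /nbhs_singleton := xP p i; rewrite mxE unlift_none.
Qed.

Lemma coface_continuous : continuous coface.
Proof.
apply: (@continuous_comp_initial _ _ _ (@set_val _ (simplex R n.+1))).
move=> x; apply: (@continuous_comp _ _ _ set_val coface_row).
  exact: initial_continuous.
exact: coface_row_continuous.
Qed.

HB.instance Definition _ := isContinuous.Build _ _ coface coface_continuous.

End Coface.

Section SubspaceInclusion.
Variables (X : topologicalType) (A : set X).

Definition inclusion (x : A) : X := set_val x.

Lemma incl_continuous : continuous inclusion.
Proof. exact: initial_continuous. Qed.

HB.instance Definition _ := isContinuous.Build _ _ inclusion incl_continuous.

End SubspaceInclusion.

Section SingularHomology.
Variables (R : realType) (F : fieldType).

Definition singular_simplex (k : nat) (X : topologicalType) :=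
  continuousType (simplex R k.+1) X.

(* Finitely supported functions from singular k-simplices to F. *)
Definition chain (k : nat) (X : topologicalType) :=
  malg (singular_simplex k X) F.

Definition boundary (k : nat) (X : topologicalType) (c : chain k.+1 X) :
    chain k X :=
  \sum_(s <- msupp c) \sum_(i < k.+2)
    mkmalgU (s \o coface i : singular_simplex k X) ((-1) ^+ i * mcoeff s c).

Definition chain_map (k : nat) (X Y : topologicalType)
    (g : continuousType X Y) (c : chain k X) : chain k Y :=
  \sum_(s <- msupp c) mkmalgU (g \o s : singular_simplex k Y) (mcoeff s c).

Definition cycles (k : nat) (X : topologicalType) : set (chain k X) :=
  match k return set (chain k X) with
  | 0 => setT
  | k'.+1 => [set c | boundary c = 0]
  end.

(* The coset z + im boundary; H_k(X) is the set of the cosets of cycles. *)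
Definition hclass (k : nat) (X : topologicalType) (z : chain k X) :
    set (chain k X) :=
  [set z' | exists w : chain k.+1 X, z' - z = boundary w].

Definition homology (k : nat) (X : topologicalType) : set (set (chain k X)) :=
  (@hclass k X) @` @cycles k X.

(* It sends hclass z to hclass (chain_map g z). *)
Definition induced_map (k : nat) (X Y : topologicalType) (g : continuousType X Y)
    (C : set (chain k X)) : set (chain k Y) :=
  \bigcup_(z in C) hclass (chain_map g z).

End SingularHomology.

Section Euclidean.
Variables (R : realType) (d : nat).
Implicit Types (c x : 'rV[R]_d) (A E P : set 'rV[R]_d).

Definition dot c x : R := \sum_i c 0 i * x 0 i.

Definition half_space E : Prop :=
  exists c, exists2 b : R, c != 0 &
    E = [set x | b < dot c x] \/ E = [set x | b <= dot c x].

Definition embedding (X : topologicalType) (f : X -> 'rV[R]_d) : Prop :=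
  injective f /\
  forall U : set X, open U <-> exists2 V : set 'rV[R]_d, open V & f @^-1` V = U.

Definition tight (F : fieldType) (X : topologicalType) (f : X -> 'rV[R]_d) :
    Prop :=
  embedding f /\
  forall E, half_space E -> forall k : nat,
    set_inj (@homology R F k (f @^-1` E)) (induced_map (@inclusion X (f @^-1` E))).

Definition convex_hull A : set 'rV[R]_d := smallest (@convex_set R 'rV[R]_d) A.

(* The faces of the boundary complex are the proper ones: P itself and the
   empty set are excluded. *)
Definition boundary_complex P : set (set 'rV[R]_d) :=
  [set Q | [/\ Q !=set0, Q <> P & exists c, exists2 b : R,
     (forall x, P x -> dot c x <= b) & Q = P `&` [set x | dot c x = b]]].

Definition dim_le A (k : nat) : Prop :=
  exists p, exists2 U : 'M[R]_d, (\rank U <= k)%N &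
    forall x, A x -> (x - p <= U)%MS.

Definition skeleton (k : nat) (C : set (set 'rV[R]_d)) : set (set 'rV[R]_d) :=
  [set Q | C Q /\ dim_le Q k].

Definition unit_vec (j : 'I_d) : 'rV[R]_d := delta_mx 0 j.

Definition cross_vertices : set 'rV[R]_d :=
  [set x | exists j, x = unit_vec j \/ x = - unit_vec j].

Definition cross_polytope : set 'rV[R]_d := convex_hull cross_vertices.

Definition cross_diagonals : set (set 'rV[R]_d) :=
  range (fun j => convex_hull [set unit_vec j; - unit_vec j]).

End Euclidean.
Arguments cross_vertices : clear implicits.
Arguments cross_polytope : clear implicits.
Arguments cross_diagonals : clear implicits.

(* A simplicial complex on the vertex set 'I_n is given by the set of its
   nonempty simplices. *)
Section Complexes.
Variables (R : realType) (n : nat) (K : {set {set 'I_n}}).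

Definition supp (x : 'rV[R]_n) : {set 'I_n} := [set i | x 0 i != 0]%SET.

Definition realization : set 'rV[R]_n :=
  [set x | simplex R n x /\ supp x \in K].

Definition cell (s : {set 'I_n}) : set realization :=
  [set x | supp (set_val x) \subset s].

Definition linear_extension (d : nat) (phi : 'I_n -> 'rV[R]_d)
    (x : realization) : 'rV[R]_d :=
  \sum_i set_val x 0 i *: phi i.

Definition missing_edges : set {set 'I_n} :=
  [set e : {set 'I_n} | #|e| = 2%N /\ e \notin K].

(* C is the complex of faces of a polytope and V is the set of its vertices. *)
Definition polyhedral_embedding (d : nat) (V : set 'rV[R]_d)
    (C : set (set 'rV[R]_d)) (phi : 'I_n -> 'rV[R]_d) : Prop :=
  [/\ set_bij setT V phi, embedding (linear_extension phi) &
      forall s, s \in K -> C (linear_extension phi @` cell s)].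

End Complexes.

(* The vertex labelled k in {1, ..., 12} is the ordinal k - 1. *)
Definition vtx (k : nat) : 'I_12 := inZp k.-1.

(* The cycle (k1 k2 ... km); products in {perm _} compose from left to right. *)
Definition cyc (c : seq nat) : {perm 'I_12} :=
  (\prod_(k <- behead c) tperm (vtx (head 0%N c)) (vtx k))%g.

Definition permT : {perm 'I_12} :=
  (cyc [:: 1; 3; 5; 7; 9; 11]%N * cyc [:: 2; 4; 6; 8; 10; 12]%N)%g.

Definition permR : {perm 'I_12} :=
  (cyc [:: 1; 10]%N * cyc [:: 2; 5]%N * cyc [:: 3; 12]%N * cyc [:: 4; 7]%N *
   cyc [:: 6; 9]%N * cyc [:: 8; 11]%N)%g.

Definition permS : {perm 'I_12} :=
  (cyc [:: 1; 11]%N * cyc [:: 2; 10]%N * cyc [:: 3; 9]%N * cyc [:: 4; 8]%N *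
   cyc [:: 5; 7]%N)%g.

Definition G12 : {group {perm 'I_12}} := <<[set permT; permR; permS]%SET>>%G.

Definition vset (s : seq nat) : {set 'I_12} := [set:: map vtx s]%SET.

Definition tetrahedra : {set {set 'I_12}} :=
  (orbit 'P^* G12 (vset [:: 1; 2; 3; 5]%N) :|:
   orbit 'P^* G12 (vset [:: 1; 2; 5; 10]%N) :|:
   orbit 'P^* G12 (vset [:: 1; 2; 10; 11]%N))%SET.

Definition P12 : {set {set 'I_12}} :=
  [set s | (s != finset.set0) && [exists t in tetrahedra, s \subset t]]%SET.

(* Main.v *)
(** The six antipodal pairs of vertices are sent to the pairs [e_j], [- e_j]. The faces of the
    cross polytope are spanned by the sets of vertices that contain no antipodal pair, and the
    antipodal pairs are exactly the edges missing from the triangulation.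

    A linear function takes opposite values at antipodal vertices. Hence the set [W] of the
    vertices in a closed half-space contains at most one vertex of every antipodal pair, or at
    least one of every pair. The subcomplex induced by such a [W] injects in homology modulo 2:
    it is nonevasive, or else adding and deleting vertices with nonevasive links connects it to
    the triangle on 1, 2, 4, which a 1-cocycle shows to be essential, or to the complement of the
    vertex 12, which misses only the top class. A singular cycle of the half-space that
    bounds in the whole complex is subdivided, together with its filling, until every simplex
    lies in an open star. Choosing for every point a vertex with a large coordinate, in [W] over
    the half-space, gives a simplicial approximation; the cones over these vertices join the
    cycle to its approximation within the half-space, and the approximation bounds in the
    subcomplex induced by [W]. *)

Require Import Defs.
From HB Require Import structures.
From mathcomp Require Import all_boot all_order all_algebra all_fingroup.

Set Implicit Arguments.
Unset Strict Implicit.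
Unset Printing Implicit Defensive.

Import GRing.Theory.
Local Open Scope ring_scope.

(** * Simplicial chains modulo 2 *)

(** The obstacle is that tightness concerns arbitrary singular cycles of the preimage of a
    half-space, which is not a subcomplex, while the combinatorial input concerns induced
    subcomplexes. Singular simplices are therefore handled through barycentric coordinates in a
    space of dimension 12. There a cone from a vertex is an explicit formula: supports control
    whether it stays in the complex, and convexity of the half-space keeps it in the preimage as
    soon as the apex lies there. Coefficients modulo 2 remove orientations: a simplex is a bare set
    of vertices, and cancellation is a pairing of equal terms. On the combinatorial side no homology
    group is computed. Only the property [boundary_reflecting] is propagated; it passes in both
    directions across a vertex with acyclic link, so that one starting set settles each family of
    vertex sets. Simplicial chains include the empty simplex. This makes the cone formula uniform
    and turns a point into an acyclic complex; the price is that the empty vertex set has to be set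
    apart. *)

Lemma addF2 (V : lmodType 'F_2) (x : V) : x + x = 0.
Proof. by rewrite -[x]scale1r -scalerDl (_ : 1 + 1 = 0) ?scale0r //; apply/eqP. Qed.

Lemma addKF2 (V : lmodType 'F_2) (x y : V) : x + y + y = x.
Proof. by rewrite -addrA addF2 addr0. Qed.

Lemma oppF2 (V : lmodType 'F_2) (x : V) : - x = x.
Proof. by apply/eqP; rewrite eq_sym -addr_eq0 addF2. Qed.

(** The terms at (i, j) and (j, i) cancel modulo 2. This one pairing shows that the boundary squares
    to zero, both for sets of vertices and for singular simplices. *)
Lemma sum_symmetric (V : lmodType 'F_2) (T : finType) (P : rel T) (G : T -> T -> V) :
  symmetric P -> irreflexive P -> (forall i j, P i j -> G i j = G j i) ->
  \sum_i \sum_(j | P i j) G i j = 0.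
Proof.
move=> Psym Pirr Gsym; rewrite pair_big_dep /=.
pose r (p : T * T) := (p.2, p.1).
have rK : involutive r by case.
pose lt (p : T * T) := (enum_rank p.1 < enum_rank p.2)%N.
rewrite (bigID lt) /= [X in _ + X](reindex_inj (inv_inj rK)) /=.
rewrite [X in _ + X](eq_big (fun p => P p.1 p.2 && lt p) (fun p => G p.1 p.2)).
- exact: addF2.
- move=> [i j]; rewrite /lt /= -leqNgt [P j i]Psym; case: (boolP (P i j)) => //= Pij.
  rewrite ltn_neqAle; case: eqVneq => // /val_inj/enum_rank_inj e.
  by rewrite e Pirr in Pij.
by move=> [i j] /andP[/= Pji _]; rewrite Gsym.
Qed.

Section SimplicialChains.
Variable T : finType.
Implicit Types (s t W : {set T}) (v : T) (F : seq {set T}).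

(* Chains are augmented and not graded: the empty set is a simplex of dimension -1. *)
Definition fchain := {ffun {set T} -> ('F_2)^o}.
Implicit Types (z w a b c : fchain).

Definition fbd z : fchain := [ffun t : {set T} => \sum_(i | i \notin t) z (i |: t)].

Definition fcone v z : fchain := [ffun s : {set T} => if v \in s then z (s :\ v) else 0].

Definition cx F W : pred {set T} :=
  fun s => (s \subset W) && has (fun f : {set T} => s \subset f) F.

Definition insupp (P : pred {set T}) z := forall s, z s != 0 -> P s.

Lemma insuppD P z w : insupp P z -> insupp P w -> insupp P (z + w).
Proof.
move=> hz hw s; rewrite ffunE; have [z0|/hz//] := eqVneq (z s) 0.
by rewrite z0 add0r => /hw.
Qed.

Lemma insupp_sub (P Q : pred {set T}) z : subpred P Q -> insupp P z -> insupp Q z.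
Proof. by move=> PQ hz s /hz /PQ. Qed.

Lemma fbdD z w : fbd (z + w) = fbd z + fbd w.
Proof.
apply/ffunP => t; rewrite !ffunE -big_split /=.
by apply: eq_bigr => i _; rewrite ffunE.
Qed.

Lemma fbd_bd z : fbd (fbd z) = 0.
Proof.
apply/ffunP => t; rewrite !ffunE.
under eq_bigr => i _ do rewrite ffunE.
rewrite big_mkcond -[RHS](@sum_symmetric _ T
  (fun i j => [&& i \notin t, j \notin t & i != j]) (fun i j => z (j |: (i |: t)))).
- apply: eq_bigr => i _; case: ifP => it; last by rewrite big_pred0.
  by apply: eq_bigl => j; rewrite !inE negb_or andbC [i == j]eq_sym.
- by move=> i j; rewrite [i == j]eq_sym andbCA.
- by move=> i; rewrite eqxx !andbF.
by move=> i j _; rewrite setUCA.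
Qed.

Definition avoids v z := forall s, v \in s -> z s = 0.

Lemma insupp_avoids F W v z : insupp (cx F (W :\ v)) z -> avoids v z.
Proof.
move=> hz s vs; apply/eqP; apply: contraLR vs => /hz /andP[/subsetP sW _].
by apply/negP => /sW; rewrite !inE eqxx.
Qed.

(** Since the empty set counts as a simplex, the formula needs no correction term for 0-chains. *)
Lemma fbd_cone v c : avoids v c -> fbd (fcone v c) = c + fcone v (fbd c).
Proof.
move=> vc; apply/ffunP => t; rewrite !ffunE.
have [vt|vt] := boolP (v \in t).
  rewrite (vc _ vt) add0r [RHS](bigD1 v) /= ?setD11 // setD1K // (vc _ vt) add0r.
  apply: eq_big => [i|i it].
    by rewrite !inE; case: (eqVneq i v) => [->|]; rewrite ?vt //= andbT.
  by rewrite ffunE !inE vt orbT; congr (c _); apply/setP => j; rewrite !inE;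
     case: (eqVneq j v) => [->|//]; case: eqVneq it => //= <-; rewrite vt.
rewrite addr0 (bigD1 v) //= ffunE setU11 setU1K // big1 ?addr0 // => i /andP[_ iv].
by rewrite ffunE !inE (negPf vt) eq_sym (negPf iv).
Qed.

(** The facets through v, restricted to [W :\ v], generate the link of v: a set s without v lies in
    one of them exactly when [v |: s] lies in a facet. Hence the part of z at v is a cone over a
    chain b of the link. *)
Lemma cx_split F W v z : v \in W -> insupp (cx F W) z -> exists a b,
  [/\ z = a + fcone v b, insupp (cx F (W :\ v)) a
    & insupp (cx [seq f <- F | v \in (f : {set T})] (W :\ v)) b].
Proof.
move=> vW hz; exists [ffun s : {set T} => if v \in s then 0 else z s].
exists [ffun t : {set T} => if v \in t then 0 else z (v |: t)]; split.
- apply/ffunP => s; rewrite !ffunE; case: ifP => vs; last by rewrite addr0.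
  by rewrite add0r setD11 setD1K.
- move=> s; rewrite ffunE; case: ifP => [|vs /hz /andP[sW sF]]; first by rewrite eqxx.
  by rewrite /cx sF subsetD1 sW vs.
- move=> s; rewrite ffunE; case: ifP => [|vs /hz /andP[]]; first by rewrite eqxx.
  rewrite subUset => /andP[_ sW] /hasP[f fF]; rewrite subUset sub1set => /andP[vf sf].
  rewrite /cx subsetD1 sW vs /=; apply/hasP; exists f => //.
  by rewrite mem_filter vf.
Qed.

Lemma cx_cone F W v c : v \in W ->
  insupp (cx [seq f <- F | v \in (f : {set T})] (W :\ v)) c ->
  insupp (cx F W) (fcone v c) /\ insupp (cx F (W :\ v)) c.
Proof.
move=> vW hc; split=> s.
  rewrite ffunE; case: ifP => [vs /hc|]; last by rewrite eqxx.
  move=> /andP[/subsetP sW /hasP[f]]; rewrite mem_filter => /andP[vf fF] sf.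
  apply/andP; split.
    apply/subsetP => i si; case: (eqVneq i v) => [->//|iv].
    by have := sW i; rewrite !inE iv si => /(_ isT).
  apply/hasP; exists f => //; apply/subsetP => i si.
  case: (eqVneq i v) => [->//|iv].
  by apply: (subsetP sf); rewrite !inE iv.
move=> /hc /andP[sW /hasP[f]]; rewrite mem_filter => /andP[_ fF] sf.
by rewrite /cx sW; apply/hasP; exists f.
Qed.

Lemma fbd_avoids v c : avoids v c -> avoids v (fbd c).
Proof.
by move=> vc s vs; rewrite ffunE big1 // => i _; rewrite vc // !inE vs orbT.
Qed.

Definition acyclic F W := forall z, insupp (cx F W) z -> fbd z = 0 ->
  exists2 u, insupp (cx F W) u & fbd u = z.

(* The inclusion of cx F W into cx F [set: T] is injective in homology. *)
Definition boundary_reflecting F W := forall w, insupp (cx F W) (fbd w) ->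
  insupp (cx F [set: T]) w -> exists2 u, insupp (cx F W) u & fbd u = fbd w.

Lemma fcone0 v : fcone v 0 = 0.
Proof. by apply/ffunP => s; rewrite !ffunE; case: ifP; rewrite ?ffunE. Qed.

(* Subtracting the boundary of a cone over a filling of its link part pushes a
   cycle off the vertex v. *)
Lemma push_off F W v z : v \in W ->
  acyclic [seq f <- F | v \in (f : {set T})] (W :\ v) ->
  insupp (cx F W) z -> avoids v (fbd z) ->
  exists a c, [/\ insupp (cx F (W :\ v)) a, insupp (cx F W) c & z = a + fbd c].
Proof.
move=> vW ac /(cx_split vW)[a [b [-> ha hb]]].
have va := insupp_avoids ha; have vb := insupp_avoids hb.
rewrite fbdD fbd_cone // => vab.
(* At a set [v |: s] the boundary of z only sees [fbd b s], because a and b avoid v. *)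
have b0 : fbd b = 0.
  have vb' := fbd_avoids vb; apply/ffunP => s; have [/vb' -> |vs] := boolP (v \in s).
    by rewrite ffunE.
  have := vab (v |: s) (setU11 _ _); rewrite !(ffunE, setU11, setU1K) //.
  rewrite [b _]vb ?setU11 // add0r big1 ?add0r // => i _.
  by rewrite va // !inE eqxx orbT.
have [c hc cb] := ac b hb b0; have [hvc hc'] := cx_cone vW hc.
exists (a + c), (fcone v c); split => //; first exact: insuppD.
by rewrite fbd_cone ?cb; [rewrite addrA -(addrA a) addF2 addr0 | exact: insupp_avoids hc].
Qed.

Lemma cx_widen F W v : subpred (cx F (W :\ v)) (cx F W).
Proof. by move=> s /andP[sW sF]; rewrite /cx sF (subset_trans sW) ?subD1set. Qed.

Lemma avoids0 v : avoids v 0.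
Proof. by move=> s _; rewrite ffunE. Qed.

Lemma acyclic_add F W v : v \in W ->
  acyclic [seq f <- F | v \in (f : {set T})] (W :\ v) ->
  acyclic F (W :\ v) -> acyclic F W.
Proof.
move=> vW aL aD z hz z0.
have [|a [c [ha hc ez]]] := push_off vW aL hz; first by rewrite z0; exact: avoids0.
have [|u hu eu] := aD a ha.
  by move: z0; rewrite ez fbdD fbd_bd addr0.
exists (u + c); last by rewrite fbdD eu -ez.
by apply: insuppD hc; exact: insupp_sub (@cx_widen _ _ _) hu.
Qed.

Lemma acyclic1 F (a : T) W : cx F W [set a] -> (forall s, cx F W s -> s \subset [set a]) ->
  acyclic F W.
Proof.
move=> Fa Fs z hz z0; exists (fcone a z).
  move=> s; rewrite ffunE; case: ifP => [ias /hz /Fs|]; last by rewrite eqxx.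
  move=> /subset_trans/(_ (subxx _)) sa; suff -> : s = [set a] by [].
  apply/eqP; rewrite eqEsubset sub1set ias andbT; apply/subsetP => i si.
  have [->|ia] := eqVneq i a; first by rewrite inE.
  by apply: (subsetP sa); rewrite !inE ia.
(* The coefficient of [fbd z] at the empty set is the augmentation, and a is the only vertex. *)
have za : z [set a] = 0.
  move/ffunP/(_ set0): z0; rewrite !ffunE (bigD1 a) ?inE //= setU0 big1 ?addr0 //.
  move=> i /andP[_ ia]; apply/eqP; apply: contraNT ia; rewrite setU0.
  by move=> /hz /Fs; rewrite sub1set inE.
rewrite fbd_cone ?z0 ?fcone0 ?addr0 // => s ias; apply/eqP; apply: contraTT isT => zs.
suff e : s = [set a] by rewrite e za eqxx in zs.
by apply/eqP; rewrite eqEsubset (Fs _ (hz _ zs)) sub1set.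
Qed.

Lemma boundary_reflecting_acyclic F W : acyclic F W -> boundary_reflecting F W.
Proof. by move=> aF w hw _; apply: aF => //; exact: fbd_bd. Qed.

(** The cycle [fbd w] is pushed off v by the boundary of a chain c of W. As c also belongs to the
    whole complex, the new cycle still bounds there, namely [w + c]. *)
Lemma boundary_reflecting_add F W v : v \in W ->
  acyclic [seq f <- F | v \in (f : {set T})] (W :\ v) ->
  boundary_reflecting F (W :\ v) -> boundary_reflecting F W.
Proof.
move=> vW aL aD w hz hw.
have [|a [c [ha hc ez]]] := push_off vW aL hz; first by rewrite fbd_bd; exact: avoids0.
have ea : a = fbd (w + c) by rewrite fbdD ez -addrA addF2 addr0.
have [||u hu eu] := aD (w + c); rewrite -?ea //.
  apply: insuppD => //; apply: insupp_sub hc => s /andP[_ sF].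
  by rewrite /cx subsetT.
exists (u + c); last by rewrite fbdD eu -ea ez.
by apply: insuppD hc; exact: insupp_sub (@cx_widen _ _ _) hu.
Qed.

(** Here the filling found in W is itself pushed off v, which is possible because its boundary
    avoids v. *)
Lemma boundary_reflecting_del F W v : v \in W ->
  acyclic [seq f <- F | v \in (f : {set T})] (W :\ v) ->
  boundary_reflecting F W -> boundary_reflecting F (W :\ v).
Proof.
move=> vW aL aD w hz hw.
have [|u hu eu] := aD w _ hw; first exact: insupp_sub (@cx_widen _ _ _) hz.
have [|a [c [ha hc ez]]] := push_off vW aL hu; first by rewrite eu; exact: insupp_avoids hz.
by exists a => //; rewrite -eu ez fbdD fbd_bd addr0.
Qed.

Lemma boundary_reflectingT F : boundary_reflecting F [set: T].
Proof. by move=> w _ hw; exists w. Qed.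

(* The one-vertex case where the link is a sphere: its fundamental class is the
   link part of a cycle m of the whole complex. *)
Lemma boundary_reflecting_sphere F v f0 m F' :
  insupp (cx F [set: T]) m -> fbd m = 0 -> m (v |: f0) = 1 -> v \notin f0 ->
  (forall s, cx [seq f <- F | v \in (f : {set T})] ([set: T] :\ v) s -> s != f0 ->
     cx F' ([set: T] :\ v) s) ->
  subpred (cx F' ([set: T] :\ v)) (cx [seq f <- F | v \in (f : {set T})] ([set: T] :\ v)) ->
  acyclic F' ([set: T] :\ v) ->
  boundary_reflecting F ([set: T] :\ v).
Proof.
move=> hm m0 mf vf FF' F'F aF'.
suff H w : insupp (cx F ([set: T] :\ v)) (fbd w) -> insupp (cx F [set: T]) w ->
    w (v |: f0) = 0 -> exists2 u, insupp (cx F ([set: T] :\ v)) u & fbd u = fbd w.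
  move=> w hz hw; have [/H|w1] := eqVneq (w (v |: f0)) 0; first exact.
  (* Adding the cycle m keeps the boundary and clears the coefficient at [v |: f0], so that the link
     part of the filling misses f0. *)
  have [|||u hu eu] := H (w + m).
  - by rewrite fbdD m0 addr0.
  - exact: insuppD.
  - by rewrite ffunE mf; move: (w _) w1 => [[|[|]]] // i _; apply/val_inj.
  - by exists u => //; rewrite eu fbdD m0 addr0.
move=> hz hw w0; have [a [b [ew ha hb]]] := cx_split (in_setT v) hw.
have va := insupp_avoids ha; have vb := insupp_avoids hb.
have b0 : fbd b = 0.
  have := insupp_avoids hz; rewrite ew fbdD fbd_cone // => vab.
  have vb' := fbd_avoids vb; apply/ffunP => s; have [/vb' -> |vs] := boolP (v \in s).
    by rewrite ffunE.
  have := vab (v |: s) (setU11 _ _); rewrite !(ffunE, setU11, setU1K) //.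
  rewrite [b _]vb ?setU11 // add0r big1 ?add0r // => i _.
  by rewrite va // !inE eqxx orbT.
have bf : b f0 = 0.
  by move: w0; rewrite ew !ffunE setU11 setU1K // va ?setU11 // add0r.
have [c hc cb] : exists2 u, insupp (cx F' ([set: T] :\ v)) u & fbd u = b.
  apply: aF' b0 => s bs; apply: FF'; first exact: hb.
  by apply: contraNneq bs => ->; rewrite bf.
have hc' := insupp_sub F'F hc; have [_ hc''] := cx_cone (in_setT v) hc'.
exists (a + c); first exact: insuppD.
(* The boundary of the cone over c is [c + fcone v b]; hence c and [fcone v b] have the same
   boundary, and c avoids v. *)
have := fbd_bd (fcone v c); rewrite fbd_cone; last exact: insupp_avoids hc.
rewrite cb fbdD => e; rewrite ew !fbdD; congr (_ + _).
by apply/eqP; rewrite -[X in _ == X]oppF2 -addr_eq0 e.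
Qed.

(** Boundary and coboundary are adjoint. Values in an arbitrary V serve both the pairing with a
    cocycle and the realization of simplices as singular chains. *)
Lemma fbd_adjoint (V : lmodType 'F_2) w (phi : {set T} -> V) :
  \sum_t fbd w t *: phi t = \sum_s w s *: \sum_(i in s) phi (s :\ i).
Proof.
under eq_bigr => t _ do rewrite ffunE scaler_suml.
rewrite pair_big_dep /=.
rewrite (reindex_onto (fun p : {set T} * T => (p.1 :\ p.2, p.2))
                      (fun p => (p.2 |: p.1, p.2))) /=; last first.
  by move=> [t i] /= it; rewrite setU1K.
rewrite (eq_bigl (fun p : {set T} * T => xpredT p.1 && (p.2 \in p.1))); last first.
  move=> [s i] /=; rewrite setD11 /=; case: (boolP (i \in s)) => [si|si].
    by rewrite setD1K // eqxx.
  by apply/negbTE; apply: contraNneq si => -[<-]; rewrite setU11.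
rewrite -(pair_big_dep xpredT (fun s i => i \in s)
                       (fun s i => w (i |: s :\ i) *: phi (s :\ i))) /=.
apply: eq_bigr => s _; rewrite scaler_sumr.
by apply: eq_bigr => i si; rewrite setD1K.
Qed.

(* A cycle missing the face f0 of the circle bounds, and the others are
   detected by the cocycle phi. *)
Lemma boundary_reflecting_cocycle F F' W (phi : {set T} -> ('F_2)^o) (s0 f0 : {set T}) :
  (forall s, cx F [set: T] s -> \sum_(i in s) phi (s :\ i) = 0) ->
  \sum_(i in s0) phi (s0 :\ i) = 1 ->
  (forall i, i \in s0 -> cx F W (s0 :\ i)) ->
  (exists2 i, i \in s0 & f0 = s0 :\ i) ->
  (forall s, cx F W s -> s != f0 -> cx F' W s) -> subpred (cx F' W) (cx F W) ->
  acyclic F' W -> boundary_reflecting F W.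
Proof.
move=> cphi phi1 hs0 [i0 i0s ef0] FF' F'F aF'.
(* The pairing with the cocycle vanishes on boundaries of the whole complex, but is 1 on the circle
   [fbd d]; so s0 is not a simplex. *)
pose ev (z : fchain) := \sum_s z s * phi s.
have evD z w : ev (z + w) = ev z + ev w.
  by rewrite /ev -big_split; apply: eq_bigr => s _; rewrite ffunE mulrDl.
have ev0 w : insupp (cx F [set: T]) w -> ev (fbd w) = 0.
  move=> hw; rewrite [ev _]fbd_adjoint big1 // => s _.
  by have [->|/hw/cphi ->] := eqVneq (w s) 0; rewrite ?scale0r ?scaler0.
pose d : fchain := [ffun s => if s == s0 then 1 else 0].
have hm : insupp (cx F W) (fbd d).
  move=> t; apply: contraR => ht; rewrite ffunE big1 // => i it; rewrite ffunE.
  case: eqP => // e; case/negP: ht; rewrite -(setU1K it) e; apply: hs0.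
  by rewrite -e setU11.
have mf : fbd d f0 = 1.
  rewrite ffunE ef0 (bigD1 i0) /=; last by rewrite !inE eqxx.
  rewrite ffunE setD1K // eqxx big1 ?addr0 // => i /andP[iN ii0]; rewrite ffunE.
  case: eqP => // /setP/(_ i0); rewrite i0s !inE eqxx orbF.
  by rewrite eq_sym (negPf ii0).
have evm : ev (fbd d) = 1.
  rewrite [ev _]fbd_adjoint (bigD1 s0) //= ffunE eqxx scale1r phi1.
  by rewrite big1 ?addr0 // => s ss0; rewrite ffunE (negPf ss0) scale0r.
move=> w hz hw.
have H z : insupp (cx F W) z -> fbd z = 0 -> z f0 = 0 ->
    exists2 u, insupp (cx F W) u & fbd u = z.
  move=> h1 h2 h3; have [|//|u hu eu] := aF' z.
    by move=> s zs; apply: FF'; [exact: h1|apply: contraNneq zs => ->; rewrite h3].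
  by exists u => //; exact: insupp_sub hu.
have [e|w1] := eqVneq (fbd w f0) 0; first by apply: H => //; exact: fbd_bd.
(* If [fbd w] contained f0, adding the circle would give a cycle that bounds in W. The circle would
   then bound in the whole complex, against its pairing with phi. *)
have [|||u hu eu] := H (fbd w + fbd d).
- exact: insuppD.
- by rewrite fbdD !fbd_bd addr0.
- by rewrite ffunE mf; move: (fbd w f0) w1 => [[|[|]]] // i _; apply/val_inj.
have : ev (fbd d) = 0.
  rewrite -[fbd d]add0r -(addF2 (fbd w)) -addrA -eu evD !ev0 ?addr0 //.
  by apply: insupp_sub hu => s /andP[_ sF]; rewrite /cx subsetT.
by rewrite evm => /eqP.
Qed.

End SimplicialChains.

(** * Complexes encoded by bit vectors *)

Section BitVectors.
Variable n : nat.
Implicit Types (b f W : bitseq) (F : seq bitseq) (S : {set 'I_n}).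

Definition dec b : {set 'I_n} := [set i : 'I_n | nth false b i].
Definition enc S : bitseq := [seq i \in S | i <- enum 'I_n].
Definition clear u b := set_nth false b u false.
Definition subbits b f := all (fun i => nth false b i ==> nth false f i) (iota 0 n).

Lemma size_enc S : size (enc S) = n.
Proof. by rewrite size_map size_enum_ord. Qed.

Lemma nth_enc S (i : 'I_n) : nth false (enc S) i = (i \in S).
Proof. by rewrite (nth_map i) ?size_enum_ord // nth_ord_enum. Qed.

Lemma encK S : dec (enc S) = S.
Proof. by apply/setP => i; rewrite inE nth_enc. Qed.

Lemma decK b : size b = n -> enc (dec b) = b.
Proof.
move=> bn; apply: (@eq_from_nth _ false); rewrite size_enc // => i lin.
by rewrite (nth_enc _ (Ordinal lin)) inE.
Qed.

Lemma dec_clear (u : 'I_n) b : dec (clear u b) = dec b :\ u.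
Proof.
apply/setP => i; rewrite !inE nth_set_nth /=.
by rewrite -[val i == u]/(i == u); case: eqP.
Qed.

Lemma subbitsP b f : (dec b \subset dec f) = subbits b f.
Proof.
apply/subsetP/allP => [h i|h i].
  rewrite mem_iota => lin; apply/implyP => bi.
  by have := h (Ordinal lin); rewrite !inE; apply.
rewrite !inE; apply/implyP; apply: (h i).
by rewrite mem_iota ltn_ord.
Qed.

Lemma filter_dec (u : 'I_n) F :
  [seq f <- map dec F | u \in (f : {set 'I_n})] = map dec [seq f <- F | nth false f u].
Proof. by rewrite filter_map; congr map; apply: eq_filter => f /=; rewrite inE. Qed.

(* Nonevasiveness of the complex cx (map dec F) (dec W), tested greedily: delete
   the first vertex whose link is nonevasive. *)
Fixpoint nonevasive fuel F W :=
  if fuel isn't k.+1 then false else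
  let A := [seq u <- iota 0 n | nth false W u && has (nth false ^~ u) F] in
  match A with
  | [::] => false
  | [:: _] => true
  | _ => let i := find (fun u => nonevasive k [seq f <- F | nth false f u] (clear u W)) A in
         if (i < size A)%N then nonevasive k F (clear (nth 0%N A i) W) else false
  end.

Lemma nonevasive_acyclic k F W : nonevasive k F W -> acyclic (map dec F) (dec W).
Proof.
elim: k F W => //= k IH F W.
set A := filter _ _.
have hA u : u \in A -> exists2 i : 'I_n, u = i & i \in dec W /\ has (nth false ^~ u) F.
  rewrite mem_filter mem_iota => /andP[/andP[Wu Fu] lun].
  by exists (Ordinal lun); rewrite ?inE.
have Ah (i : 'I_n) : i \in dec W -> has (nth false ^~ i) F -> val i \in A.
  by rewrite mem_filter mem_iota inE => -> ->; rewrite ltn_ord.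
case eA: A => [//|a [|a' A']].
  have [|i ai [iW iF]] := hA a; first by rewrite eA inE.
  move=> _; apply: (@acyclic1 _ _ i).
    rewrite /cx sub1set iW; move/hasP: iF => [f fF fi].
    by apply/hasP; exists (dec f); [exact: map_f|rewrite sub1set inE -ai].
  move=> s /andP[/subsetP sW /hasP[_ /mapP[f fF ->] /subsetP sf]].
  apply/subsetP => j js; rewrite inE; apply/eqP/val_inj; rewrite /= -ai; apply/eqP.
  have := Ah j (sW _ js); rewrite eA inE; apply.
  by apply/hasP; exists f => //; have := sf _ js; rewrite inE.
rewrite -eA; case: ifP => // iA /IH h2.
have /IH := nth_find 0%N (etrans (has_find _ _) iA) => h1.
have [i ei [iW _]] := hA _ (mem_nth 0%N iA); rewrite ei in h1 h2.
by apply: (@acyclic_add _ _ _ i) => //; rewrite ?filter_dec -dec_clear.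
Qed.

(* Toggling a vertex whose link is nonevasive, along the word l, as long as the
   links allow it; every vertex set met on the way is listed. *)
Fixpoint walk F W (l : seq nat) : seq bitseq :=
  if l isn't v :: l' then [:: W] else
  if nonevasive n [seq f <- F | nth false f v] (clear v W) && (v < n)%N
  then W :: walk F (set_nth false W v (~~ nth false W v)) l' else [:: W].

Lemma walk_reflecting F W l b : b \in walk F W l ->
  boundary_reflecting (map dec F) (dec W) -> boundary_reflecting (map dec F) (dec b).
Proof.
elim: l W => [|v l IH] W /=; first by rewrite inE => /eqP->.
case: ifP => [/andP[/nonevasive_acyclic ac lvn]|_]; last by rewrite inE => /eqP->.
pose i := Ordinal lvn; have ac' := ac.
rewrite inE => /predU1P[->//|/IH {}IH] hW; apply: IH.
move: ac; rewrite -[v]/(val i) -filter_dec dec_clear => ac.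
case Wv: (nth false W v).
  rewrite -/(clear i W) dec_clear; apply: boundary_reflecting_del => //.
  by rewrite inE.
set W' := set_nth _ _ _ _.
have e : dec W = dec W' :\ i.
  apply/setP => j; rewrite !inE nth_set_nth /= -[val j == i]/(j == i).
  by case: eqP => //= ->; rewrite Wv.
rewrite e setDDl setUid in ac; rewrite e in hW.
by apply: boundary_reflecting_add ac hW; rewrite inE nth_set_nth /= eqxx.
Qed.

(** The list l is split by first bits as in a binary trie, so that no vector is searched for in the
    whole of l. The two defaults of [head] put an empty vector in neither half. *)
Fixpoint all_but m (l : seq bitseq) (P : bitseq -> bool) :=
  if m isn't k.+1 then (if l is [::] then P [::] else true) else
  all_but k [seq behead b | b <- l & head false b] (fun b => P (true :: b)) &&
  all_but k [seq behead b | b <- l & ~~ head true b] (fun b => P (false :: b)).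

Lemma all_butP m l P : all_but m l P -> all (fun b => size b == m) l ->
  forall b, size b = m -> b \notin l -> P b.
Proof.
elim: m l P => [|m IH] l P /=.
  move=> hP hl b /size0nil ->; case: l hP hl => [//|x l] _ /= /andP[/nilP -> _].
  by rewrite inE eqxx.
move=> /andP[h1 h2] /allP hl [|c b] //= [bm] bl.
have hs (p : pred bitseq) : all (fun b => size b == m) [seq behead b | b <- l & p b].
  apply/allP => y /mapP[x]; rewrite mem_filter => /andP[_ /hl xs] ->.
  by rewrite size_behead (eqP xs).
case: c bl => bl.
  apply: (IH _ _ h1) => //; apply: contra bl => /mapP[[|c x]]; rewrite mem_filter => /andP[] //=.
  by case: c => // _ xl ->.
apply: (IH _ _ h2) => //; apply: contra bl => /mapP[[|c x]]; rewrite mem_filter => /andP[] //=.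
by case: c => // _ xl ->.
Qed.

Fixpoint subvectors f : seq bitseq :=
  if f isn't c :: f' then [:: [::]] else
  (if c then map (cons true) (subvectors f') else [::]) ++ map (cons false) (subvectors f').

Lemma subvectorsP f b : size b = size f ->
  (forall i, nth false b i -> nth false f i) -> b \in subvectors f.
Proof.
elim: f b => [|c f IH] [|d b] //= [bf] h; rewrite mem_cat.
have bfm : b \in subvectors f by apply: IH => // i; exact: (h i.+1).
case: d h => h; last by rewrite orbC map_f.
have c1 : c := h 0%N isT.
by rewrite c1 map_f.
Qed.

Definition meet f W : bitseq := [seq x.1 && x.2 | x <- zip f W].

Lemma nth_meet f W i : size f = size W ->
  nth false (meet f W) i = nth false f i && nth false W i.
Proof.
move=> fW; have [li|le] := ltnP i (size f).
  by rewrite (nth_map (false, false)) ?size_zip -?fW ?minnn // nth_zip.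
by rewrite !nth_default // ?size_map ?size_zip -?fW ?minnn.
Qed.

Lemma cx_dec F W b : cx (map dec F) (dec W) (dec b) = subbits b W && has (subbits b) F.
Proof.
by rewrite /cx subbitsP has_map; congr (_ && _); apply: eq_has => f /=; rewrite subbitsP.
Qed.

(** Within W, passing from F to F' loses at most the simplex f0. This opens a circle to an arc, and
    a sphere to a disc. *)
Definition removes_facet F W f0 F' :=
  all (fun f => (size f == n) && all (fun b => (b != f0) ==> has (subbits b) F')
                                     (subvectors (meet f W))) F &&
  all (fun f' => has (subbits f') F) F'.

Lemma removes_facetP F W f0 F' : size W = n -> size f0 = n -> removes_facet F W f0 F' ->
  (forall s, cx (map dec F) (dec W) s -> s != dec f0 -> cx (map dec F') (dec W) s) /\
  subpred (cx (map dec F') (dec W)) (cx (map dec F) (dec W)).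
Proof.
move=> sW sf0 /andP[/allP h1 /allP h2]; split=> s; rewrite -(encK s) !cx_dec.
  move=> /andP[bW /hasP[f fF bf]] sf; rewrite bW /=.
  have /andP[/eqP sf' /allP h] := h1 f fF.
  have := h (enc s); have -> : enc s != f0.
    by apply: contraNneq sf => ->.
  apply; apply: subvectorsP.
    by rewrite size_enc size_map size_zip sf' sW minnn.
  move=> i bi; rewrite nth_meet ?sf' ?sW //.
  have lin : (i < n)%N.
    by rewrite -(size_enc s) ltnNge; apply: contraL bi => le; rewrite nth_default.
  by rewrite (implyP (allP bf i _) bi) ?(implyP (allP bW i _) bi) ?mem_iota.
move=> /andP[-> /hasP[f' fF bf]]; have /hasP[f fF' ff] := h2 _ fF.
apply/hasP; exists f => //; rewrite -subbitsP; apply: subset_trans (_ : dec f' \subset _).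
  by rewrite subbitsP.
by rewrite subbitsP.
Qed.

Lemma enc_clear (S : {set 'I_n}) (i : 'I_n) : enc (S :\ i) = clear i (enc S).
Proof.
rewrite -{1}(encK S) -dec_clear decK // size_set_nth size_enc.
by apply/maxn_idPr.
Qed.

Lemma sum_bits (S : {set 'I_n}) (p : pred nat) :
  \sum_(i in S) ((p i)%:R : ('F_2)^o) =
  (odd (count (fun i => nth false (enc S) i && p i) (iota 0 n)))%:R.
Proof.
have natF2 k : (k%:R : ('F_2)^o) = (odd k)%:R.
  elim: k => [//|k IH]; rewrite mulrS IH /=.
  by case: (odd k); [exact: (addF2 (1 : ('F_2)^o))|rewrite addr0].
rewrite -sum1_count -val_enum_ord big_map big_enum_cond /= -natF2 natr_sum.
rewrite [RHS](eq_bigl (fun i : 'I_n => (i \in S) && p i)) => [|i]; last by rewrite nth_enc.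
by rewrite [RHS]big_mkcondr; apply: eq_bigr => i _; case: (p i).
Qed.

End BitVectors.

(** * Induced subcomplexes of the triangulation *)

Definition bits (l : seq nat) : bitseq := [seq i \in l | i <- iota 0 12].

(* The tetrahedra of P12, the vertex k being written k - 1. *)
Definition facet_lists : seq (seq nat) :=
  [::
   [:: 0; 1; 2; 4]; [:: 0; 1; 2; 10]; [:: 0; 1; 4; 9]; [:: 0; 1; 9; 10]; [:: 0; 2; 3; 4];
   [:: 0; 2; 3; 11]; [:: 0; 2; 10; 11]; [:: 0; 3; 4; 7]; [:: 0; 3; 5; 7];
   [:: 0; 3; 5; 8]; [:: 0; 3; 8; 11]; [:: 0; 4; 7; 9]; [:: 0; 5; 7; 9]; [:: 0; 5; 8; 9];
   [:: 0; 8; 9; 10]; [:: 0; 8; 10; 11]; [:: 1; 2; 4; 5]; [:: 1; 2; 5; 10];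
   [:: 1; 3; 5; 8]; [:: 1; 3; 5; 10]; [:: 1; 3; 6; 10]; [:: 1; 3; 6; 11];
   [:: 1; 3; 8; 11]; [:: 1; 4; 5; 8]; [:: 1; 4; 8; 11]; [:: 1; 4; 9; 11];
   [:: 1; 6; 9; 10]; [:: 1; 6; 9; 11]; [:: 2; 3; 4; 6]; [:: 2; 3; 6; 11];
   [:: 2; 4; 5; 6]; [:: 2; 5; 6; 9]; [:: 2; 5; 7; 9]; [:: 2; 5; 7; 10]; [:: 2; 6; 9; 11];
   [:: 2; 7; 9; 11]; [:: 2; 7; 10; 11]; [:: 3; 4; 6; 7]; [:: 3; 5; 7; 10];
   [:: 3; 6; 7; 10]; [:: 4; 5; 6; 8]; [:: 4; 6; 7; 8]; [:: 4; 7; 8; 11];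
   [:: 4; 7; 9; 11]; [:: 5; 6; 8; 9]; [:: 6; 7; 8; 10]; [:: 6; 8; 9; 10];
   [:: 7; 8; 10; 11]]%N.

(* A 1-cocycle that is not a coboundary. *)
Definition cocycle_lists : seq (seq nat) :=
  [::
   [:: 0; 1]; [:: 1; 2]; [:: 1; 4]; [:: 1; 9]; [:: 1; 10]; [:: 2; 5]; [:: 2; 7];
   [:: 2; 9]; [:: 3; 10]; [:: 4; 5]; [:: 4; 8]; [:: 4; 11]; [:: 5; 6]; [:: 5; 10];
   [:: 6; 8]; [:: 6; 9]; [:: 6; 10]; [:: 7; 8]; [:: 7; 10]; [:: 7; 11]; [:: 9; 11]]%N.

(* Found by computer search: a walk from {1,2,4} through all vertex sets inducing a
   homotopy circle. *)
Definition circle_walk : seq nat :=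
  [::
   10; 1; 5; 7; 5; 3; 5; 7; 9; 7; 5; 0; 5; 2; 5; 11; 2; 8; 11; 6; 8; 2; 7; 6; 11; 2; 8;
   0; 8; 7; 9; 2; 11; 9; 7; 11; 10; 11; 7; 9; 11; 9; 2; 7; 8; 0; 7; 0; 11; 0; 6; 8; 2; 5;
   2; 10; 7; 6; 2; 6; 9; 2; 7; 2; 10; 2; 3; 10; 7; 10; 1; 10; 3; 2; 10; 2; 8; 3; 1; 4; 8;
   2; 4; 1; 6; 1; 4; 2; 8; 1; 8; 2; 5; 4; 0; 4; 2; 0; 8; 1; 6; 7; 6; 0; 7; 1; 4; 11; 8;
   2; 0; 6; 11; 3; 11; 9; 11; 10; 9; 1; 7; 10; 3; 5; 6; 5; 0; 4; 0; 6; 3; 5; 2; 3; 6; 2;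
   3; 2; 9; 6; 5; 2; 6; 9; 0; 9; 7; 1; 4; 10; 0; 10; 11; 9; 0; 9; 2; 9; 8; 11; 4; 1; 7;
   4; 3; 5; 3; 9; 0; 6; 9; 6; 3; 4; 3; 6; 3; 4; 5; 6; 10; 6; 7; 10; 1; 4; 8; 5; 3; 8; 5;
   4; 9; 5; 8; 10; 6; 2; 10; 6; 10; 0; 8; 0; 7; 0; 8; 0; 11; 7; 0; 7; 1; 11; 8; 11; 6;
   11; 1; 2; 6; 0; 3; 0; 6; 2; 1; 11; 5; 2; 5; 11; 6; 3; 11; 6; 11; 5; 9; 5; 7; 9; 0; 7;
   9; 6; 7; 6; 3; 6; 7; 6; 0; 5; 7; 5; 1; 7; 2; 1; 11; 1; 2; 1; 6; 11; 1; 7; 9; 6; 2; 9;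
   11; 2; 9; 3; 4; 3; 11; 9; 11; 2; 11; 9; 8; 4; 7; 1; 11; 5; 4; 5; 11; 1; 10; 7; 8; 7;
   9; 1; 9; 3; 1; 7; 10; 4; 2; 4; 6; 4; 11; 3; 9; 7; 5; 6; 2; 6; 8; 6; 5; 11; 4; 10; 6;
   10; 4; 11; 7; 11; 4; 6; 11; 4; 11; 2; 3; 9; 10; 0; 8; 0; 9; 3; 8; 3; 4; 3; 1; 8; 3; 1;
   3; 9; 7; 9; 6; 7; 0; 7; 10; 4; 11; 1; 4; 1; 10; 1; 0; 10; 6; 11; 6; 0; 9; 4; 3; 7; 1;
   6; 9; 0; 5; 3; 0; 1; 11; 0; 8; 0; 7; 0; 10; 3; 8; 10; 9; 6; 2; 6; 8; 6; 1; 8; 6; 2; 6;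
   0; 2; 8; 3; 5; 7; 11; 7; 8; 7; 2; 11; 3; 4; 0; 5; 7; 0; 7; 3; 5; 9; 4; 11; 6; 5; 3; 6;
   5; 5; 3; 11; 4; 7; 4; 2; 7; 0; 2; 9; 3; 2; 0; 3; 2; 7; 2; 1; 2; 4; 1; 10; 1; 2; 10; 9;
   2; 0; 4; 2; 0; 2; 6; 0; 2; 4; 2; 9; 2; 3; 8; 5; 4; 1; 5; 4; 5; 11; 1; 4; 1; 7; 9; 10;
   3; 1; 4; 1; 3; 1; 2; 7; 3; 8; 3; 9; 8; 7; 8; 5; 7; 0; 5; 7; 5; 11; 7; 0; 8; 9; 8; 7;
   9; 8; 9; 1; 8; 3; 1; 8; 1; 0; 8; 1; 8; 2; 1; 3; 0; 1; 3; 1; 5; 8; 11; 6; 8; 11; 10; 0;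
   4; 7; 5; 7; 0; 4; 0; 9; 4; 0; 8; 6; 9; 4; 8; 9; 6; 3; 4; 0; 4; 5; 3; 11; 3; 8; 2; 3;
   9; 2; 9; 10; 2; 11; 5; 2; 7; 3; 7; 5; 3; 8; 11; 9; 8; 11; 8; 5; 11; 3; 5; 9; 11; 7;
   11; 0; 6; 11; 6; 7; 10; 11; 8; 10; 8; 6; 4; 1; 10; 9; 10; 7; 9; 4; 9; 3; 4; 10; 3; 7;
   3; 0; 7; 5; 0; 7; 1; 0; 5; 6; 5; 1; 6; 11; 0; 1; 9; 3; 5; 4; 11; 10; 2; 0; 1; 6; 1; 5;
   9; 11; 2; 1; 6; 7; 0; 9; 8; 3; 2; 5; 10; 11; 10; 6; 9; 2; 1; 0; 8; 10; 7; 4; 1; 7; 5;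
   11; 6; 10; 0; 10; 6; 5; 6; 4; 11; 6; 4; 0; 1; 8; 7; 4; 7; 1; 4; 9; 8; 3; 8; 11; 2; 4;
   11; 2; 3; 8; 9; 10; 8; 9; 2; 3; 5; 7; 5; 1; 2; 7; 0; 1; 3; 8; 9; 11; 10; 0; 4; 9; 3;
   4; 11; 10; 0; 11; 6; 3; 11; 9; 11; 5; 10; 6; 8; 10; 6; 1; 8; 6; 1; 9; 5; 0; 11; 9; 11;
   5; 6; 2; 0; 8; 4; 0; 8; 6; 2; 3; 4; 2; 3; 7; 2; 3; 2; 9; 11; 2; 5; 6; 7; 7; 5; 1; 5;
   5; 6; 11; 2; 8; 11; 6; 5; 0; 5; 4; 10; 0; 10; 11; 4; 0; 4; 10; 2; 4; 8; 10; 2; 4; 10;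
   9; 2; 0; 3; 2; 0; 8; 4; 9; 4; 9; 3; 0; 3; 8; 3; 9; 2; 10; 4; 1; 0; 11; 5; 1; 11; 5; 3;
   6; 0; 7; 9; 8; 1; 2; 6; 7; 6; 3; 9; 4; 1; 9; 4; 3; 8; 2; 0; 8; 0; 2; 4; 1; 7; 3; 7;
   10; 3; 8; 1; 3; 8; 9; 11; 6; 11; 8; 6; 1; 8; 7; 9; 8; 3; 10; 3; 9; 8; 4; 9; 8; 9; 2;
   7; 6; 7; 0; 1; 3; 1; 3; 6; 1; 0; 7; 0; 6; 8; 7; 10; 2; 7; 10; 3; 5; 9; 6; 0; 5; 0; 7;
   1; 6; 1; 9; 2; 7; 10; 10; 9; 5; 6; 5; 7; 8; 9; 1; 0; 10; 5; 10; 3; 8; 11; 2; 0; 10; 3;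
   6; 3; 11; 5; 6; 0; 2; 10; 8; 4; 10; 2; 9; 7; 2; 9; 9; 1; 1; 3; 3; 7; 3; 4; 4; 9; 3; 4;
   4; 8; 4; 5; 10; 2; 0; 10; 10; 6; 1; 11; 6; 7; 11; 6; 5; 6; 7; 1; 6; 1; 3; 5; 9; 1; 1;
   6; 5; 0; 9; 3; 5; 7; 11; 7; 0; 11; 0; 2]%N.

(* The same for a homotopy projective plane, starting from the complement of 12. *)
Definition plane_walk : seq nat :=
  [::
   4; 7; 9; 7; 1; 9; 8; 1; 7; 4; 10; 7; 0; 11; 9; 10; 5; 8; 7; 0; 2; 7; 6; 2; 8; 6; 8; 9;
   6; 8; 4; 8; 2; 4; 6; 7; 10; 7; 1; 10; 4; 1; 2; 8; 1; 8; 4; 8; 3; 8; 10; 3; 1; 7; 10;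
   0; 3; 0; 10; 7; 10; 0; 3; 8; 3; 0; 3; 5; 0; 11; 0; 1; 11; 4; 1; 6; 7; 6; 4; 10; 6; 10;
   7; 10; 6; 9; 6; 10; 6; 8; 11; 7; 2; 7; 11; 7; 2; 0; 4; 0; 7; 0; 4; 10; 1; 10; 4; 0; 9;
   0; 2; 0; 4; 10; 0; 10; 2; 10; 1; 2; 11; 2; 10; 2; 3; 2; 8; 11; 0; 11; 1; 11; 8; 11; 1;
   2; 6; 2; 1; 11; 10; 6; 3; 6; 9; 6; 1; 6; 9; 7; 3; 7; 6; 7; 3; 7; 11; 7; 10; 2; 10; 7;
   11; 7; 10; 2; 6; 3; 4; 3; 6; 3; 4; 0; 3; 4; 3; 7; 2; 3; 2; 4; 2; 3; 2; 0; 4; 3; 2; 3;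
   4; 3; 11; 6; 9; 11; 9; 4; 2; 3; 2; 4; 2; 3; 9; 11; 9; 1; 11; 9; 11; 6; 9; 11; 9]%N.

Definition facets : seq bitseq := Eval compute in map bits facet_lists.
Definition cocycle : seq bitseq := Eval compute in map bits cocycle_lists.
Definition triangle : bitseq := Eval compute in bits [:: 0; 1; 3]%N.
Definition punctured : bitseq := Eval compute in bits (iota 0 11).

Definition K12 : seq {set 'I_12} := map (dec 12) facets.

Definition partial_transversal (b : bitseq) :=
  all (fun i => ~~ (nth false b i && nth false b (i + 6))) (iota 0 6).
Definition covering (b : bitseq) :=
  all (fun i => nth false b i || nth false b (i + 6)) (iota 0 6).

Definition reflecting_check b :=
  [|| ~~ (partial_transversal b || covering b), b == nseq 12 false, b == nseq 12 true
    | nonevasive 12 12 facets b].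

(** This is the decisive computation. Of the 4096 vertex sets, one that lies on neither walk
    contains some antipodal pair and misses another, or is empty or full, or is nonevasive. *)
Lemma walks_cover :
  all_but 12 (walk 12 facets triangle circle_walk ++ walk 12 facets punctured plane_walk)
    reflecting_check.
Proof. by vm_compute. Qed.

Lemma walks_size : all (fun b => size b == 12%N)
  (walk 12 facets triangle circle_walk ++ walk 12 facets punctured plane_walk).
Proof. by vm_compute. Qed.

Definition phi12 (s : {set 'I_12}) : ('F_2)^o := (enc s \in cocycle)%:R.

Definition coboundary_odd b :=
  odd (count (fun i => nth false b i && (clear i b \in cocycle)) (iota 0 12)).

Lemma sum_phi12 (s : {set 'I_12}) :
  \sum_(i in s) phi12 (s :\ i) = (coboundary_odd (enc s))%:R.
Proof.
rewrite /phi12; under eq_bigr => i _ do rewrite enc_clear.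
exact: (sum_bits s (fun i => clear i (enc s) \in cocycle)).
Qed.

(** All faces of the facets are tested, although the count can be nonzero only at triangles. *)
Lemma cocycle_check :
  all (fun f => (size f == 12) && all (fun b => ~~ coboundary_odd b) (subvectors f)) facets.
Proof. by vm_compute. Qed.

Lemma triangle_reflecting : boundary_reflecting K12 (dec 12 triangle).
Proof.
(* Without the edge joining 2 and 4, the circle on 1, 2, 4 becomes an arc. Of its three edges only
   the one joining 1 and 2 belongs to [cocycle], so the pairing is 1. *)
pose F' : seq bitseq := [:: bits [:: 0; 1]; bits [:: 0; 3]]%N.
have [||//|h1 h2] := @removes_facetP 12 facets triangle (bits [:: 1; 3]%N) F'; try by [].
apply: (@boundary_reflecting_cocycle _ _ (map (dec 12) F') _ phi12
          (dec 12 triangle) (dec 12 (bits [:: 1; 3]%N))) => //.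
- move=> s; rewrite sum_phi12 -{1}(encK s) => /andP[_ /hasP[_ /mapP[f fF ->]]].
  have /allP/(_ f fF)/andP[/eqP sf /allP h] := cocycle_check.
  rewrite subbitsP => bf; rewrite (negPf (h (enc s) _)) //.
  apply: subvectorsP => [|i bi]; first by rewrite size_enc sf.
  have li : (i < 12)%N.
    by rewrite -(size_enc s) ltnNge; apply: contraL bi => le; rewrite nth_default.
  by apply: (implyP (allP bf i _) bi); rewrite mem_iota.
- by rewrite sum_phi12 decK.
- move=> i; rewrite inE -dec_clear cx_dec => it.
  have /allP/(_ (val i)) : all (fun i => nth false triangle i ==>
      subbits 12 (clear i triangle) triangle && has (subbits 12 (clear i triangle)) facets)
      (iota 0 12) by [].
  by rewrite mem_iota ltn_ord it; apply.
- by exists (inord 0); rewrite -?dec_clear ?inE ?inordK.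
by apply: (@nonevasive_acyclic 12 12).
Qed.

(** Each triangle lies in an even number of tetrahedra. Only triangles inside a facet are tested,
    since at any other set the boundary of [fundamental] has no term. *)
Definition ridge_check :=
  all (fun f => (size f == 12) && all (fun i => nth false f i ==>
    ~~ odd (count (fun j => ~~ nth false (clear i f) j
                  && (set_nth false (clear i f) j true \in facets)) (iota 0 12)))
    (iota 0 12)) facets.

Lemma ridge_checkP : ridge_check.
Proof. by vm_compute. Qed.

Definition fundamental : fchain 'I_12 := [ffun s : {set 'I_12} => (enc s \in facets)%:R].

Lemma enc_setU1 (s : {set 'I_12}) i : enc (i |: s) = set_nth false (enc s) i true.
Proof.
have -> : i |: s = dec 12 (set_nth false (enc s) i true).
  apply/setP => j; rewrite !inE nth_set_nth /= -[val j == i]/(j == i) nth_enc.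
  by case: eqP.
by rewrite decK // size_set_nth size_enc; apply/maxn_idPr.
Qed.

Lemma fundamental_cycle : fbd fundamental = 0.
Proof.
apply/ffunP => t; rewrite !ffunE.
have [/existsP[i /andP[it iF]]|] := boolP [exists i, (i \notin t) && (enc (i |: t) \in facets)];
    last first.
  rewrite negb_exists => /forallP h; rewrite big1 // => i it; rewrite ffunE.
  by have := h i; rewrite it /= => /negPf ->.
have et : t = (i |: t) :\ i by rewrite setU1K.
have e : enc t = clear i (enc (i |: t)) by rewrite {1}et enc_clear.
pose p j := set_nth false (enc t) j true \in facets.
transitivity (\sum_(j in ~: t) ((p j)%:R : ('F_2)^o)).
  by apply: eq_big => [j|j _]; rewrite ?inE // ffunE enc_setU1.
rewrite sum_bits (@eq_in_count _ _ (fun j => ~~ nth false (enc t) j && p j)).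
  have /allP/(_ _ iF)/andP[_ /allP/(_ (val i))] := ridge_checkP.
  by rewrite mem_iota ltn_ord nth_enc setU11 -e /= => /(_ isT)/negPf ->.
move=> j; rewrite mem_iota => lj.
by rewrite (nth_enc _ (Ordinal lj)) (nth_enc t (Ordinal lj)) inE.
Qed.

Lemma punctured_reflecting : boundary_reflecting K12 (dec 12 punctured).
Proof.
(* The link of the vertex 12 is a sphere. Removing from it the triangle f0, which spans the
   tetrahedron f1 together with 12, leaves a nonevasive disc. *)
pose v : 'I_12 := inord 11; pose f0 := bits [:: 0; 2; 3]%N.
pose f1 := bits [:: 0; 2; 3; 11]%N.
pose F' := [seq f <- facets | nth false f 11 && (f != f1)].
have vE : val v = 11%N by rewrite /= inordK.
have eW : [set: 'I_12] :\ v = dec 12 punctured.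
  apply/setP => i; rewrite !inE andbT -[i == v]/(val i == val v) vE.
  by case: i => [[|[|[|[|[|[|[|[|[|[|[|[|i]]]]]]]]]]]]].
have [||//|h1 h2] := @removes_facetP 12 [seq f <- facets | nth false f 11] punctured f0 F';
  try by [].
rewrite -eW in h1 h2 *.
have ef1 : v |: dec 12 f0 = dec 12 f1.
  apply/setP => i; rewrite !inE -[i == v]/(val i == val v) vE.
  by case: i => [[|[|[|[|[|[|[|[|[|[|[|[|i]]]]]]]]]]]]].
have eF : [seq f <- K12 | v \in (f : {set 'I_12})] =
    map (dec 12) [seq f <- facets | nth false f 11] by rewrite filter_dec vE.
apply: (@boundary_reflecting_sphere _ _ _ (dec 12 f0) fundamental (map (dec 12) F')).
- move=> s; rewrite ffunE; case: (boolP (enc s \in facets)) => // sF _.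
  by rewrite /cx subsetT; apply/hasP; exists s => //; rewrite -(encK s); apply: map_f.
- exact: fundamental_cycle.
- by rewrite ef1 ffunE decK.
- by rewrite inE vE.
- by rewrite eF.
- by rewrite eF.
by rewrite eW; apply: (@nonevasive_acyclic 12 12).
Qed.

Definition opposite (i : 'I_12) : 'I_12 := inord ((i + 6) %% 12).

(** The empty W is a true exception: the empty simplex is the boundary of any vertex of the whole
    complex, but of nothing in an empty vertex set. *)
Lemma K12_reflecting (W : {set 'I_12}) : W != set0 ->
  (forall i, i \in W -> opposite i \notin W) \/ (forall i, i \notin W -> opposite i \in W) ->
  boundary_reflecting K12 W.
Proof.
move=> W0 hW; rewrite -(encK W).
set b := enc W; have sb : size b = 12 by rewrite size_enc.
have hO (i : nat) : (i < 6)%N -> nth false b i = (inord i \in W) /\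
    nth false b (i + 6) = (opposite (inord i) \in W).
  move=> li; have li' : (i < 12)%N by apply: ltn_trans li _.
  have lj : (i + 6 < 12)%N by rewrite -[12%N]/(6 + 6)%N ltn_add2r.
  split; first by rewrite -[in LHS](inordK li') nth_enc.
  have -> : (i + 6)%N = opposite (inord i) by rewrite /opposite !inordK ?modn_small.
  by rewrite nth_enc.
have hb : partial_transversal b || covering b.
  case: hW => h; apply/orP; [left|right]; apply/allP => i; rewrite mem_iota => li.
    have [-> ->] := hO i li; case: (boolP (inord i \in W)) => // /h.
    by move=> ->.
  by have [-> ->] := hO i li; case: (boolP (inord i \in W)) => // /h ->.
set l := walk 12 facets triangle circle_walk ++ walk 12 facets punctured plane_walk.
have [|bl] := boolP (b \in l).
  rewrite mem_cat => /orP[] bl.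
    exact: walk_reflecting bl triangle_reflecting.
  exact: walk_reflecting bl punctured_reflecting.
have := all_butP walks_cover walks_size sb bl; rewrite /reflecting_check hb.
case/or4P.
- by [].
- move=> /eqP e; case/negP: W0; apply/eqP/setP => i; rewrite -nth_enc -/b e inE.
  by rewrite nth_nseq if_same.
- move=> /eqP e; rewrite (_ : dec 12 b = setT); first exact: boundary_reflectingT.
  by apply/setP => i; rewrite !inE e nth_nseq ltn_ord.
by move=> /nonevasive_acyclic/boundary_reflecting_acyclic.
Qed.

(** * The orbits under the group *)

#[local] Opaque K12.
Local Close Scope ring_scope.

(** The generators are modelled by functions on natural numbers, and these by tables, so that their
    action on bit vectors can be evaluated. *)
Definition swap (a b x : nat) := if x == a then b else if x == b then a else x.

Definition cyc_fun (c : seq nat) (x : nat) :=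
  foldl (fun y k => swap ((head 0 c).-1 %% 12) (k.-1 %% 12) y) x (behead c).

Lemma val_tperm (a b x : 'I_12) : val (tperm a b x) = swap a b x.
Proof.
rewrite /swap; case: tpermP => [->|->|/eqP xa /eqP xb].
- by rewrite eqxx.
- by case: ifP => [/eqP/val_inj->|_]; rewrite ?eqxx.
- by rewrite -[val x == a]/(x == a) (negPf xa) -[val x == b]/(x == b) (negPf xb).
Qed.

Lemma val_cyc c x : val (cyc c x) = cyc_fun c x.
Proof.
rewrite /cyc /cyc_fun; elim: (behead c) x => [|k l IH] x; first by rewrite big_nil perm1.
by rewrite big_cons permM IH /= val_tperm.
Qed.

Definition fun_T x := cyc_fun [:: 2; 4; 6; 8; 10; 12] (cyc_fun [:: 1; 3; 5; 7; 9; 11] x).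
Definition fun_R x := foldl (fun y c => cyc_fun c y) x
  [:: [:: 1; 10]; [:: 2; 5]; [:: 3; 12]; [:: 4; 7]; [:: 6; 9]; [:: 8; 11]].
Definition fun_S x := foldl (fun y c => cyc_fun c y) x
  [:: [:: 1; 11]; [:: 2; 10]; [:: 3; 9]; [:: 4; 8]; [:: 5; 7]].

Definition table_T : seq nat := Eval compute in map fun_T (iota 0 12).
Definition table_R : seq nat := Eval compute in map fun_R (iota 0 12).
Definition table_S : seq nat := Eval compute in map fun_S (iota 0 12).

Lemma nth_table (f : nat -> nat) (x : 'I_12) : nth 0 (map f (iota 0 12)) x = f x.
Proof. by rewrite (nth_map 0) ?size_iota // nth_iota. Qed.

Lemma val_permT x : val (permT x) = nth 0 table_T x.
Proof. by rewrite -[table_T]/(map fun_T (iota 0 12)) nth_table /permT !permM !val_cyc. Qed.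
Lemma val_permR x : val (permR x) = nth 0 table_R x.
Proof. by rewrite -[table_R]/(map fun_R (iota 0 12)) nth_table /permR !permM !val_cyc. Qed.
Lemma val_permS x : val (permS x) = nth 0 table_S x.
Proof. by rewrite -[table_S]/(map fun_S (iota 0 12)) nth_table /permS !permM !val_cyc. Qed.

Definition image_bits (g : nat -> nat) (b : bitseq) : bitseq :=
  [seq has (fun i => nth false b i && (g i == j)) (iota 0 12) | j <- iota 0 12].

Lemma setact_dec (p : {perm 'I_12}) (g : nat -> nat) b : (forall x, val (p x) = g x) ->
  ('P^*)%act (dec 12 b) p = dec 12 (image_bits g b).
Proof.
move=> pg; apply/setP => j; rewrite inE (nth_map 0) ?size_iota // nth_iota //.
apply/imsetP/hasP => [[i ib ->]|[i]].
  exists (val i); first by rewrite mem_iota ltn_ord.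
  by rewrite inE in ib; rewrite ib /= -pg.
rewrite mem_iota => li /andP[bi /eqP gi]; exists (Ordinal li); first by rewrite inE.
by apply: val_inj; rewrite /= pg.
Qed.

Definition base_facets : seq bitseq :=
  map (fun l => bits (map predn l)) [:: [:: 1; 2; 3; 5]; [:: 1; 2; 5; 10]; [:: 1; 2; 10; 11]].

Definition grow (l : seq bitseq) :=
  undup (l ++ map (image_bits (nth 0 table_T)) l ++
         map (image_bits (nth 0 table_R)) l ++ map (image_bits (nth 0 table_S)) l).

(** Stability under the three generators puts the orbits inside [facets]; conversely, four rounds of
    the generators reach every facet from the three given ones. The group itself is never
    enumerated. *)
Lemma facets_stable : all (fun g => all (fun f => image_bits g f \in facets) facets)
  [:: nth 0 table_T; nth 0 table_R; nth 0 table_S].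
Proof. by vm_compute. Qed.

Lemma facets_generated : all (fun f => f \in iter 4 grow base_facets) facets &&
  all (fun f => f \in facets) base_facets.
Proof. by vm_compute. Qed.

Lemma dec_bits l : all (fun k => k < 12) l ->
  dec 12 (bits l) = [set:: map (fun k => inZp k : 'I_12) l].
Proof.
move=> /allP hl; apply/setP => i; rewrite !inE (nth_map 0) ?size_iota // nth_iota //.
apply/idP/mapP => [il|[k kl ->]]; last by rewrite /= modn_small ?hl.
by exists (val i) => //; apply: val_inj; rewrite /= modn_small.
Qed.

Lemma vset_bits l : all (fun k => k.-1 < 12) l -> vset l = dec 12 (bits (map predn l)).
Proof.
by move=> hl; rewrite dec_bits ?all_map // -map_comp.
Qed.

Lemma perm_in_G12 (p : {perm 'I_12}) : p \in [set permT; permR; permS] -> p \in G12.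
Proof. exact: mem_gen. Qed.

Lemma tetrahedra_facets t : (t \in tetrahedra) = (t \in K12).
Proof.
pose S : {set {set 'I_12}} := [set f in K12].
have act_facets (p : {perm 'I_12}) (g : nat -> nat) : (forall x, val (p x) = g x) ->
    all (fun f => image_bits g f \in facets) facets -> p \in 'N(S | 'P^*)%g.
  move=> pg /allP h; rewrite !inE /=; apply/subsetP => t'; rewrite !in_set => tK.
  have /mapP[f fF ->] : t' \in map (dec 12) facets := tK.
  by rewrite (setact_dec _ pg); apply/map_f/h.
have /and4P[hT hR hS _] := facets_stable.
have GS : G12 \subset 'N(S | 'P^*)%g.
  rewrite gen_subG; apply/subsetP => p; rewrite !inE -orbA => /or3P[] /eqP ->.
  - by have := act_facets _ _ val_permT hT; rewrite !inE.
  - by have := act_facets _ _ val_permR hR; rewrite !inE.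
  - by have := act_facets _ _ val_permS hS; rewrite !inE.
have /andP[/allP gen /allP base] := facets_generated.
have baseS b : b \in base_facets -> dec 12 b \in S.
  by move=> /base bF; rewrite in_set; exact: (map_f (dec 12) bF).
have e1 : vset [:: 1; 2; 3; 5] = dec 12 (nth [::] base_facets 0) by apply: vset_bits.
have e2 : vset [:: 1; 2; 5; 10] = dec 12 (nth [::] base_facets 1) by apply: vset_bits.
have e3 : vset [:: 1; 2; 10; 11] = dec 12 (nth [::] base_facets 2) by apply: vset_bits.
have mem_base i : i < 3 -> nth [::] base_facets i \in base_facets by move=> ?; apply: mem_nth.
apply/idP/idP => [|tK].
  rewrite /tetrahedra e1 e2 e3 !in_setU -orbA.
  have sub i : i < 3 -> t \in orbit 'P^* G12 (dec 12 (nth [::] base_facets i)) -> t \in K12.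
    move=> i3; have := acts_sub_orbit (dec 12 (nth [::] base_facets i)) GS.
    by rewrite baseS ?mem_base // => /subsetP h /h; rewrite in_set.
  by case/or3P; [exact: (sub 0)|exact: (sub 1)|exact: (sub 2)].
have mem_tet i : i < 3 -> dec 12 (nth [::] base_facets i) \in tetrahedra.
  rewrite /tetrahedra e1 e2 e3 !in_setU => i3.
  by case: i i3 => [|[|[|//]]] _; rewrite orbit_refl ?orbT.
have stab (p : {perm 'I_12}) s : p \in G12 -> s \in tetrahedra -> ('P^*)%act s p \in tetrahedra.
  move=> pG.
  have orb x : s \in orbit 'P^* G12 x -> ('P^*)%act s p \in orbit 'P^* G12 x.
    by case/orbitP=> g gG <-; rewrite -actM; exact: mem_orbit (groupM gG pG).
  rewrite /tetrahedra !in_setU => /orP[/orP[]|] /orb ->; rewrite ?orbT //.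
have grow_tet k b : b \in iter k grow base_facets -> dec 12 b \in tetrahedra.
  elim: k b => [|k IH] b /=.
    by move=> /(nthP [::])[i i3 <-]; apply: mem_tet.
  rewrite mem_undup !mem_cat => /or4P[/IH //|||] /mapP[c /IH ct ->].
  - by rewrite -(setact_dec _ val_permT); apply: stab ct; rewrite perm_in_G12 // !inE eqxx.
  - by rewrite -(setact_dec _ val_permR); apply: stab ct; rewrite perm_in_G12 // !inE eqxx orbT.
  - by rewrite -(setact_dec _ val_permS); apply: stab ct; rewrite perm_in_G12 // !inE eqxx orbT.
have /mapP[f /gen fg ->] : t \in map (dec 12) facets := tK.
exact: grow_tet fg.
Qed.

Lemma in_P12 s : (s \in P12) = (s != set0) && cx K12 [set: 'I_12] s.
Proof.
rewrite inE /cx subsetT; congr (_ && _).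
by apply/existsP/hasP => [[t /andP[tT st]]|[t tK st]]; exists t;
  rewrite -?tetrahedra_facets // tetrahedra_facets tK.
Qed.

(** * Edges, antipodal pairs and missing edges *)

Lemma edge_check : all (fun a => all (fun b => (a != b) ==>
   (has (fun f => nth false f a && nth false f b) facets == (b != (a + 6) %% 12)))
   (iota 0 12)) (iota 0 12).
Proof. by vm_compute. Qed.

Lemma val_opposite a : val (opposite a) = (a + 6) %% 12.
Proof. by rewrite /opposite /= inordK ?ltn_mod. Qed.

Lemma edge_P12 (a b : 'I_12) : a != b -> ([set a; b] \in P12) = (b != opposite a).
Proof.
move=> ab; rewrite in_P12 /cx subsetT -card_gt0 cards2 ab /=.
have /allP/(_ (val a))/[!mem_iota]/(_ (ltn_ord a))/allP/(_ (val b)) := edge_check.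
rewrite mem_iota ltn_ord => /(_ isT)/implyP/(_ ab)/eqP.
rewrite -[b == opposite a]/(val b == val (opposite a)) val_opposite => <-.
rewrite has_map; apply: eq_has => f /=.
by rewrite subUset !sub1set !inE.
Qed.

Lemma opposite_neq (a : 'I_12) : (a == opposite a) = false.
Proof.
rewrite -[a == _]/(val a == val (opposite a)) val_opposite.
by case: a => [[|[|[|[|[|[|[|[|[|[|[|[|a]]]]]]]]]]]]].
Qed.

Lemma no_opposite s a : s \in P12 -> a \in s -> opposite a \notin s.
Proof.
move=> sP as1; apply/negP => os.
have ne : a != opposite a by rewrite opposite_neq.
have := edge_P12 ne; rewrite eqxx in_P12 => /negbT/negP[].
rewrite -card_gt0 cards2 ne /=; move: sP; rewrite in_P12 => /andP[_].
move=> /andP[_ /hasP[f fK sf]]; rewrite /cx subsetT; apply/hasP; exists f => //.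
by apply: subset_trans sf; rewrite subUset !sub1set as1 os.
Qed.

Lemma card_P12 s : s \in P12 -> #|s| <= 4.
Proof.
rewrite in_P12 => /andP[_ /andP[_ /hasP[_ /mapP[f fF ->]]]] /subset_leq_card sf.
apply: leq_trans sf _.
have /allP/(_ f fF) : all (fun f => count (nth false f) (iota 0 12) <= 4) facets by [].
suff -> : #|dec 12 f| = count (nth false f) (iota 0 12) by [].
rewrite -sum1_card -sum1_count -val_enum_ord big_map big_enum_cond.
by apply: eq_bigl => i; rewrite inE.
Qed.

Lemma vset_pair a b : a < 12 -> b < 12 ->
  vset [:: a.+1; b.+1] = [set inZp a; inZp b].
Proof. by move=> la lb; apply/setP => i; rewrite !inE. Qed.

Lemma opposite_inZp a : a < 6 -> opposite (inZp a) = inZp (a + 6).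
Proof.
by case: a => [|[|[|[|[|[|//]]]]]] _; apply: val_inj; rewrite val_opposite.
Qed.

Lemma oppositeK : involutive opposite.
Proof.
move=> i; apply: val_inj; rewrite !val_opposite.
by case: i => [[|[|[|[|[|[|[|[|[|[|[|[|i]]]]]]]]]]]]].
Qed.

Lemma missing_pair (e : {set 'I_12}) : #|e| = 2 -> e \notin P12 ->
  exists2 a : nat, a < 6 & e = [set inZp a; inZp (a + 6)].
Proof.
move=> /eqP/cards2P[a [b [ab ->]]]; rewrite edge_P12 // negbK => /eqP ->.
have [la|le] := ltnP a 6.
  exists a => //; rewrite -opposite_inZp //; have -> // : inZp a = a :> 'I_12.
  by apply: val_inj; rewrite /= modn_small.
exists (val (opposite a)).
  rewrite val_opposite; case: a {ab} le => [[|[|[|[|[|[|[|[|[|[|[|[|a]]]]]]]]]]]]] //.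
have oE : inZp (val (opposite a)) = opposite a by apply: val_inj; rewrite /= modn_small.
have l6 : val (opposite a) < 6.
  rewrite val_opposite; case: a {ab oE} le => [[|[|[|[|[|[|[|[|[|[|[|[|a]]]]]]]]]]]]] //.
by rewrite -opposite_inZp // oE oppositeK setUC.
Qed.

Lemma pair_missing a : a < 6 -> #|[set inZp a; inZp (a + 6) : 'I_12]| = 2 /\
  [set inZp a; inZp (a + 6)] \notin P12.
Proof.
move=> la; have ne : inZp a != inZp (a + 6) :> 'I_12.
  by case: a la => [|[|[|[|[|[|//]]]]]].
by rewrite cards2 ne edge_P12 // negbK opposite_inZp.
Qed.


From mathcomp Require Import finmap all_classical all_reals all_analysis zify.
From mathcomp Require Import -(notations) monalg.

Import Order.TTheory GRing.Theory Num.Theory.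
Import numFieldNormedType.Exports.

Local Open Scope classical_set_scope.
Local Open Scope ring_scope.

(** * Singular chains modulo 2 *)

Local Notation chain2 R := (chain R 'F_2).

Section LinearExtension.
Variables (K : choiceType).
Implicit Types (c : malg K 'F_2).

Definition single (k : K) : malg K 'F_2 := mkmalgU k 1.

Definition extend (V : lmodType 'F_2) (g : K -> V) c : V :=
  \sum_(k <- msupp c) mcoeff k c *: g k.

Lemma extendE (V : lmodType 'F_2) (g : K -> V) c (d : {fset K}) :
  (msupp c `<=` d)%fset -> extend g c = \sum_(k <- d) mcoeff k c *: g k.
Proof.
move=> cd; rewrite /extend (big_fset_incl _ cd) // => k _ kc.
by rewrite mcoeff_outdom ?scale0r.
Qed.

Lemma extendD (V : lmodType 'F_2) (g : K -> V) c d :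
  extend g (c + d) = extend g c + extend g d.
Proof.
rewrite (@extendE _ _ (c + d) (msupp c `|` msupp d)%fset) ?msuppD_le //.
rewrite (@extendE _ _ c (msupp c `|` msupp d)%fset) ?fsubsetUl //.
rewrite (@extendE _ _ d (msupp c `|` msupp d)%fset) ?fsubsetUr //.
by rewrite -big_split; apply: eq_bigr => k _; rewrite mcoeffD scalerDl.
Qed.

Lemma extend_single (V : lmodType 'F_2) (g : K -> V) k : extend g (single k) = g k.
Proof. by rewrite /extend msuppU oner_eq0 big_seq_fset1 mcoeffUU scale1r. Qed.

Lemma mcoeff_in c k : k \in msupp c -> mcoeff k c = 1.
Proof.
rewrite -mcoeff_neq0; move: (mcoeff k c) => [[|[|]]] // i _; exact/val_inj.
Qed.

Lemma extend_sum (V : lmodType 'F_2) (g : K -> V) c :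
  extend g c = \sum_(k <- msupp c) g k.
Proof. by apply: eq_big_seq => k /mcoeff_in ->; rewrite scale1r. Qed.

Lemma sum_single c : c = \sum_(k <- msupp c) single k.
Proof.
rewrite {1}[c]monalgE; apply: eq_big_seq => k kc.
by rewrite /single mcoeff_in.
Qed.

Lemma extend0 (V : lmodType 'F_2) (g : K -> V) : extend g 0 = 0.
Proof. by apply: (addrI (extend g 0)); rewrite -extendD !addr0. Qed.

Lemma additive_sum (V W : lmodType 'F_2) (h : V -> W) I (s : seq I) (f : I -> V) :
  {morph h : x y / x + y} -> h (\sum_(i <- s) f i) = \sum_(i <- s) h (f i).
Proof.
move=> hD; have h0 : h 0 = 0 by apply: (addrI (h 0)); rewrite -hD !addr0.
by elim: s => [|i s IH]; rewrite ?big_nil // !big_cons hD IH.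
Qed.

Lemma extend_additive (V W : lmodType 'F_2) (g : K -> V) (h : V -> W) c :
  {morph h : x y / x + y} -> h (extend g c) = extend (h \o g) c.
Proof. by move=> hD; rewrite !extend_sum additive_sum. Qed.

Lemma eq_in_extend (V : lmodType 'F_2) (g1 g2 : K -> V) c :
  {in msupp c, g1 =1 g2} -> extend g1 c = extend g2 c.
Proof. by move=> e; rewrite !extend_sum; exact: eq_big_seq. Qed.

Lemma extend_addf (V : lmodType 'F_2) (g1 g2 : K -> V) c :
  extend (fun k => g1 k + g2 k) c = extend g1 c + extend g2 c.
Proof. by rewrite !extend_sum big_split. Qed.

Lemma extend_id c : extend single c = c.
Proof. by rewrite extend_sum -sum_single. Qed.

Definition supported (P : set K) c := forall k, k \in msupp c -> P k.

Lemma supported0 P : supported P 0.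
Proof. by move=> k; rewrite msupp0 inE. Qed.

Lemma supportedD P c d : supported P c -> supported P d -> supported P (c + d).
Proof.
move=> cP dP k /(fsubsetP (msuppD_le c d)); rewrite in_fsetU.
by case/orP; [exact: cP|exact: dP].
Qed.

Lemma supported_single (P : set K) k : P k -> supported P (single k).
Proof. by move=> Pk j; rewrite msuppU oner_eq0 in_fset1 => /eqP ->. Qed.

Lemma supported_sub (P Q : set K) c : P `<=` Q -> supported P c -> supported Q c.
Proof. by move=> PQ cP k /cP /PQ. Qed.

Lemma supported_sum P I (s : seq I) (f : I -> malg K 'F_2) :
  (forall i, supported P (f i)) -> supported P (\sum_(i <- s) f i).
Proof.
move=> h; elim: s => [|i s IH]; first by rewrite big_nil; exact: supported0.
by rewrite big_cons; exact: supportedD.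
Qed.

End LinearExtension.

Lemma supported_extend (K L : choiceType) (P : set K) (Q : set L)
    (g : K -> malg L 'F_2) c :
  supported P c -> (forall k, P k -> supported Q (g k)) -> supported Q (extend g c).
Proof.
move=> cP gQ; rewrite extend_sum big_seq; apply: (big_ind (supported Q)).
- exact: supported0.
- exact: supportedD.
- by move=> k /cP /gQ.
Qed.

Section SumOverF2.
Variables (R : realType).

Lemma signF2 i (x : 'F_2) : (-1) ^+ i * x = x.
Proof.
have -> : (-1 : 'F_2) = 1 by apply/eqP.
by rewrite expr1n mul1r.
Qed.

Definition face_sum k (X : topologicalType) (s : singular_simplex R k.+1 X) :
    chain2 R k X :=
  \sum_(i < k.+2) single (s \o coface i : singular_simplex R k X).

Lemma boundaryE k (X : topologicalType) (c : chain2 R k.+1 X) :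
  boundary c = extend (@face_sum k X) c.
Proof.
rewrite extend_sum /boundary; apply: eq_big_seq => s sc.
by apply: eq_bigr => i _; rewrite signF2 mcoeff_in.
Qed.

Lemma chain_mapE k (X Y : topologicalType) (g : continuousType X Y) (c : chain2 R k X) :
  chain_map g c =
  extend (fun s : singular_simplex R k X => single (g \o s : singular_simplex R k Y)) c.
Proof. by rewrite extend_sum /chain_map; apply: eq_big_seq => s sc; rewrite mcoeff_in. Qed.

Lemma boundaryD k (X : topologicalType) : {morph @boundary R 'F_2 k X : c d / c + d}.
Proof. by move=> c d; rewrite !boundaryE extendD. Qed.

Lemma chain_mapD k (X Y : topologicalType) (g : continuousType X Y) :
  {morph @chain_map R 'F_2 k X Y g : c d / c + d}.
Proof. by move=> c d; rewrite !chain_mapE extendD. Qed.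

Lemma chain_map_single k (X Y : topologicalType) (g : continuousType X Y)
    (s : singular_simplex R k X) :
  chain_map g (single s) = single (g \o s : singular_simplex R k Y).
Proof. by rewrite chain_mapE extend_single. Qed.

Lemma boundary_single k (X : topologicalType) (s : singular_simplex R k.+1 X) :
  boundary (single s) = face_sum s.
Proof. by rewrite boundaryE extend_single. Qed.

Lemma boundary_chain_map k (X Y : topologicalType) (g : continuousType X Y)
    (c : chain2 R k.+1 X) : boundary (chain_map g c) = chain_map g (boundary c).
Proof.
rewrite !chain_mapE (extend_additive _ _ (@boundaryD _ _)) [in RHS]boundaryE.
rewrite -chain_mapE (extend_additive _ _ (@chain_mapD _ _ _ _)).
apply: eq_in_extend => s _ /=; rewrite boundary_single /face_sum.
rewrite (additive_sum _ _ (@chain_mapD _ _ _ _)); apply: eq_bigr => i _.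
by rewrite chain_map_single; congr single; apply/continuousEP.
Qed.

Lemma chain_map_comp k (X Y Z : topologicalType) (g : continuousType X Y)
    (h : continuousType Y Z) (c : chain2 R k X) :
  chain_map h (chain_map g c) = chain_map (h \o g : continuousType X Z) c.
Proof.
rewrite [chain_map g c]chain_mapE (extend_additive _ _ (@chain_mapD _ _ _ _)) [RHS]chain_mapE.
apply: eq_in_extend => s _ /=; rewrite chain_map_single.
by congr single; apply/continuousEP.
Qed.

Definition vrow n (i : 'I_n) : 'rV[R]_n := delta_mx 0 i.

Lemma coface_rowE n (i : 'I_n.+1) (x : 'rV[R]_n) :
  coface_row i x = \sum_j x 0 j *: vrow (lift i j).
Proof.
apply/rowP => m; rewrite mxE summxE; case: (unliftP i m) => [j ->|->].
  rewrite (bigD1 j) //= big1 => [|j' jj']; rewrite !mxE eqxx.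
    by rewrite eqxx mulr1 addr0.
  by rewrite (inj_eq lift_inj) eq_sym (negPf jj') mulr0.
by rewrite big1 // => j _; rewrite !mxE (negPf (neq_lift _ _)) andbF mulr0.
Qed.

Lemma sum_coface_row n (i : 'I_n.+1) (x : 'rV[R]_n) (V : lmodType R) (a : 'I_n.+1 -> V) :
  \sum_j coface_row i x 0 j *: a j = \sum_j x 0 j *: a (lift i j).
Proof.
rewrite (bigD1_ord i) //= mxE unlift_none scale0r add0r.
by apply: eq_bigr => j _; rewrite mxE liftK.
Qed.

(** The same two vertices are omitted in the two possible orders; i' is the index of j once
    [lift j i] is gone. *)
Lemma lift_swap n (j : 'I_n.+2) (i : 'I_n.+1) :
  exists i' : 'I_n.+1, lift (lift j i) i' = j /\
    forall m, lift j (lift i m) = lift (lift j i) (lift i' m).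
Proof.
have [i' e] : exists i', j = lift (lift j i) i'.
  case: (unliftP (lift j i) j) => [i' ei|ei]; first by exists i'.
  by case/eqP: (neq_lift j i).
exists i'; split=> // m; apply: val_inj.
have /(congr1 val) := e; rewrite /= bumpC => e'; congr (bump _ (bump _ m)).
rewrite -(bumpK (bump j i) i') -e' /unbump /bump.
case: (leqP j i) => ji; last by rewrite -[(false + i)%N]/(val i) ji.
by rewrite -[(true + i)%N]/(i.+1) ltnNge (leqW ji).
Qed.

End SumOverF2.

Section BoundaryMaps.
Variable (R : realType).

Lemma boundary_boundary k (X : topologicalType) (c : chain2 R k.+2 X) :
  boundary (boundary c) = 0.
Proof.
rewrite [boundary c]boundaryE (extend_additive _ _ (@boundaryD _ _ _)).
rewrite extend_sum big1 // => s _ /=.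
rewrite /face_sum (additive_sum _ _ (@boundaryD _ _ _)).
(* Indexing the iterated faces by the ordered pair of omitted vertices makes the double sum
   symmetric; the diagonal receives the default 0. *)
pose G (j j' : 'I_k.+3) : chain2 R k X :=
  if unlift j j' is Some i
  then single ((s \o coface j) \o coface i : singular_simplex R k X) else 0.
transitivity (\sum_j \sum_(j' | j != j') G j j').
  apply: eq_bigr => j _; rewrite boundary_single.
  rewrite [RHS](_ : _ = \sum_j' G j j'); last first.
    rewrite [RHS](bigD1 j) //= /G unlift_none add0r.
    by apply: eq_bigl => j'; rewrite eq_sym.
  rewrite (bigD1_ord j) //= {1}/G unlift_none add0r.
  by apply: eq_bigr => i _; rewrite /G liftK.
apply: sum_symmetric => [i j|i|j j'].
- by rewrite eq_sym.
- by rewrite eqxx.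
case: (unliftP j j') => [i ->|->]; last by rewrite eqxx.
move=> _; have [i' [e sw]] := lift_swap j i.
have e' : unlift (lift j i) j = Some i' by rewrite -[X in unlift _ X]e liftK.
rewrite /G liftK e'; congr single; apply/continuousEP => y /=.
congr (s _); apply: val_inj; rewrite /= !coface_rowE.
rewrite !sum_coface_row; apply: eq_bigr => m _.
by rewrite sw.
Qed.

(** * Singular simplices described by their coordinates *)

Section Lifting.
Variables (n : nat) (X : topologicalType) (e : X -> 'rV[R]_n).

(** The value 0 for a map that does not lift makes this total, so that operators on chains can be
    defined before liftability is known. *)
Definition of_map k (g : simplex R k.+1 -> 'rV[R]_n) : chain2 R k X :=
  if pselect (exists s : singular_simplex R k X, forall y, e (s y) = g y) is left h
  then single (projT1 (cid h)) else 0.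

Definition liftable k (g : simplex R k.+1 -> 'rV[R]_n) :=
  exists s : singular_simplex R k X, forall y, e (s y) = g y.

Hypothesis e_inj : injective e.

Lemma of_mapE k (g : simplex R k.+1 -> 'rV[R]_n) (s : singular_simplex R k X) :
  (forall y, e (s y) = g y) -> of_map g = single s.
Proof.
move=> h; rewrite /of_map; case: pselect => [h'|[]]; last by exists s.
congr single; apply/continuousEP => y; apply: e_inj.
by rewrite h; case: (cid h') => /= s' ->.
Qed.

Lemma supported_of_map k (g : simplex R k.+1 -> 'rV[R]_n) :
  supported (fun s : singular_simplex R k X => forall y, e (s y) = g y) (of_map g).
Proof.
rewrite /of_map; case: pselect => [h|_]; last exact: supported0.
by apply: supported_single; case: (cid h).
Qed.

Lemma boundary_of_map k (g : simplex R k.+2 -> 'rV[R]_n) : liftable g ->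
  boundary (of_map g) = \sum_(i < k.+2) of_map (g \o coface i).
Proof.
move=> [s sg]; rewrite (of_mapE sg) boundary_single; apply: eq_bigr => i _.
by rewrite (@of_mapE _ _ (s \o coface i : singular_simplex R k X)) // => y; rewrite /= sg.
Qed.

Lemma eq_of_map k (g h : simplex R k.+1 -> 'rV[R]_n) : g =1 h -> of_map g = of_map h.
Proof. by move=> /funext ->. Qed.

End Lifting.

Lemma embedding_liftable n (X : topologicalType) (e : X -> 'rV[R]_n) k
    (g : simplex R k.+1 -> 'rV[R]_n) :
  embedding e -> continuous g -> (forall y, range e (g y)) -> liftable e g.
Proof.
move=> [e_inj e_open] gc ge.
have ex y : exists x, e x = g y by have [x _ <-] := ge y; exists x.
pose h y := projT1 (cid (ex y)).
have hE y : e (h y) = g y by rewrite /h; case: (cid (ex y)).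
have hc : continuous h.
  apply/continuousP => U /e_open[V oV <-].
  have -> : h @^-1` (e @^-1` V) = g @^-1` V.
    by apply/seteqP; split=> y /=; rewrite hE.
  by move/continuousP: gc; apply.
by exists (mkcts hc).
Qed.

End BoundaryMaps.

(** * Subdivision of lists of points *)

Section ListChains.
Variable V : choiceType.
Implicit Types (p : V) (l : seq V) (c : malg (seq V) 'F_2).

(** A list stands for the affine simplex with these corners, possibly degenerate. Subdivision is
    carried out on such formal simplices, which become singular simplices only afterwards. *)
Definition lcons p c := extend (fun l => single (p :: l)) c.

(* The empty list is kept as a simplex of dimension -1. *)
Fixpoint lbdl l : malg (seq V) 'F_2 :=
  if l is p :: l' then single l' + lcons p (lbdl l') else 0.

Definition lbd c := extend lbdl c.

Lemma lconsD p : {morph lcons p : c d / c + d}.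
Proof. exact: extendD. Qed.

Lemma lbdD : {morph lbd : c d / c + d}.
Proof. exact: extendD. Qed.

Lemma lbdl0 : lbdl [::] = 0. Proof. by []. Qed.

Lemma lbd_single l : lbd (single l) = lbdl l.
Proof. exact: extend_single. Qed.

Lemma lbd0 : lbd 0 = 0.
Proof. exact: extend0. Qed.

Lemma lcons0 p : lcons p 0 = 0.
Proof. exact: extend0. Qed.

Lemma lcons_single p l : lcons p (single l) = single (p :: l).
Proof. exact: extend_single. Qed.

Lemma lconsE p c : lcons p c = extend (fun l => single (p :: l)) c.
Proof. exact: erefl. Qed.

Lemma lbd_cons p c : lbd (lcons p c) = c + lcons p (lbd c).
Proof.
transitivity (extend (fun l => single l + lcons p (lbdl l)) c).
  rewrite {1}/lcons (extend_additive _ _ lbdD); apply: eq_in_extend => l _ /=.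
  by rewrite /lbd extend_single.
by rewrite extend_addf extend_id /lbd (extend_additive _ _ (@lconsD p)).
Qed.

Lemma lbd_lbdl l : lbd (lbdl l) = 0.
Proof.
elim: l => [|p l IH] /=; first exact: lbd0.
by rewrite lbdD lbd_cons IH lcons0 addr0 lbd_single addF2.
Qed.

Lemma lbdlE l : lbdl l = \sum_(i < size l) single (take i l ++ drop i.+1 l).
Proof.
elim: l => [|p l IH] /=; first by rewrite big_ord0.
rewrite big_ord_recl /= drop0 IH (additive_sum _ _ (@lconsD p)).
by congr (_ + _); apply: eq_bigr => i _; rewrite /lcons extend_single.
Qed.

Definition inlist (P : set V) n l := size l = n /\ forall x, x \in l -> P x.

Lemma supported_lbdl l : supported (fun l' => size l = (size l').+1 /\ {subset l' <= l})
  (lbdl l).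
Proof.
rewrite lbdlE; apply: supported_sum => i; apply: supported_single; split.
  by rewrite size_cat size_take size_drop ltn_ord -addSn subnKC.
move=> x; rewrite mem_cat => /orP[/mem_take//|/mem_drop//].
Qed.

Lemma supported_lcons (P : set V) n p c : P p ->
  supported (inlist P n) c -> supported (inlist P n.+1) (lcons p c).
Proof.
move=> Pp cP; apply: supported_extend cP _ => l [ln lP]; apply: supported_single.
split; first by rewrite /= ln.
by move=> x; rewrite inE => /predU1P[->//|/lP].
Qed.

End ListChains.

#[local] Opaque extend lbdl lcons.

Section Subdivision.
Variables (R : realType) (m : nat).
Implicit Types (l : seq 'rV[R]_m) (c : malg (seq 'rV[R]_m) 'F_2).

Definition bary l : 'rV[R]_m := (size l)%:R^-1 *: \sum_(x <- l) x.

(** The subdivided boundary is coned from the barycentre. The fuel k is the length of l, because the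
    faces of a list are not structurally smaller. *)
Fixpoint sdl_rec k l : malg (seq 'rV[R]_m) 'F_2 :=
  if k is k'.+1 then lcons (bary l) (extend (sdl_rec k') (lbdl l)) else single l.
Definition sdl l := sdl_rec (size l) l.

(** With T this operator, coning [l + T (boundary of l)] from the barycentre solves the homotopy
    equation between the identity and [sdl] by induction on the length. *)
Fixpoint tdl_rec k l : malg (seq 'rV[R]_m) 'F_2 :=
  if k is k'.+1 then lcons (bary l) (single l + extend (tdl_rec k') (lbdl l)) else 0.
Definition tdl l := tdl_rec (size l) l.

Definition sd c := extend sdl c.
Definition td c := extend tdl c.

Lemma sdD : {morph sd : c d / c + d}. Proof. exact: extendD. Qed.
Lemma tdD : {morph td : c d / c + d}. Proof. exact: extendD. Qed.
Lemma sd_single l : sd (single l) = sdl l. Proof. exact: extend_single. Qed.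
Lemma td_single l : td (single l) = tdl l. Proof. exact: extend_single. Qed.
Lemma sd0 : sd 0 = 0. Proof. exact: extend0. Qed.
Lemma td0 : td 0 = 0. Proof. exact: extend0. Qed.

Lemma sdl_recS k l : sdl_rec k.+1 l = lcons (bary l) (extend (sdl_rec k) (lbdl l)).
Proof. exact: erefl. Qed.

Lemma tdl_recS k l :
  tdl_rec k.+1 l = lcons (bary l) (single l + extend (tdl_rec k) (lbdl l)).
Proof. exact: erefl. Qed.

Lemma sdl0 : sdl [::] = single [::]. Proof. by []. Qed.
Lemma tdl0 : tdl [::] = 0. Proof. by []. Qed.

Lemma sdlE l : l != [::] -> sdl l = lcons (bary l) (sd (lbdl l)).
Proof.
move=> l0; have e : size l = (size l).-1.+1 by case: l l0.
rewrite /sdl e sdl_recS; apply: (congr1 (lcons (bary l))).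
apply: eq_in_extend => l' /supported_lbdl[e' _].
by rewrite /sdl e'.
Qed.

Lemma tdlE l : l != [::] -> tdl l = lcons (bary l) (single l + td (lbdl l)).
Proof.
move=> l0; have e : size l = (size l).-1.+1 by case: l l0.
rewrite /tdl e tdl_recS; apply: (congr1 (fun c => lcons (bary l) (single l + c))).
apply: eq_in_extend => l' /supported_lbdl[e' _].
by rewrite /tdl e'.
Qed.

#[local] Opaque sdl tdl.

Lemma sdE c : sd c = extend sdl c. Proof. by []. Qed.
Lemma tdE c : td c = extend tdl c. Proof. by []. Qed.
Lemma lbdE c : lbd c = extend (@lbdl _) c. Proof. by []. Qed.

#[local] Opaque sd td lbd.

Lemma lbd_sdl l : lbd (sdl l) = sd (lbdl l).
Proof.
have [n] := ubnP (size l); elim: n l => [|n IH] l ln; first by exfalso; rewrite ltn0 in ln.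
have [->|l0] := eqVneq l [::]; first by rewrite sdl0 lbd_single lbdl0 sd0.
rewrite (sdlE l0) lbd_cons; set L := lbdl l.
suff -> : lbd (sd L) = 0 by rewrite lcons0 addr0.
transitivity (sd (lbd L)); last by rewrite lbd_lbdl sd0.
rewrite sdE (extend_additive _ _ (@lbdD _)).
rewrite lbdE (extend_additive _ _ sdD).
by apply: eq_in_extend => l' /supported_lbdl[e _]; apply: IH; rewrite -ltnS -e.
Qed.

Lemma lbd_sd c : lbd (sd c) = sd (lbd c).
Proof.
rewrite sdE (extend_additive _ _ (@lbdD _)).
rewrite lbdE (extend_additive _ _ sdD).
by apply: eq_in_extend => l _; exact: lbd_sdl.
Qed.

Lemma td_homotopy c :
  {in msupp c, forall l, lbd (tdl l) + td (lbdl l) = single l + sdl l} ->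
  lbd (td c) + td (lbd c) = c + sd c.
Proof.
move=> h; rewrite tdE (extend_additive _ _ (@lbdD _)).
rewrite lbdE (extend_additive _ _ tdD).
rewrite -extend_addf (eq_in_extend h) extend_addf.
by rewrite [extend (fun l => _) c]extend_id.
Qed.

Lemma lbd_tdl l : lbd (tdl l) + td (lbdl l) = single l + sdl l.
Proof.
have [n] := ubnP (size l); elim: n l => [|n IH] l ln; first by exfalso; rewrite ltn0 in ln.
have [->|l0] := eqVneq l [::]; first by rewrite tdl0 sdl0 lbd0 lbdl0 td0 !addF2.
rewrite (sdlE l0) (tdlE l0) lbd_cons; set L := lbdl l.
suff -> : lbd (single l + td L) = sd L.
  by rewrite addrAC (addKF2 (single l) (td L)).
have : lbd (td L) + td (lbd L) = L + sd L.
  by apply: td_homotopy => l' /supported_lbdl[e _]; apply: IH; rewrite -ltnS -e.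
rewrite lbd_lbdl td0 addr0 => e.
by rewrite lbdD lbd_single e addrA (addF2 L) add0r.
Qed.

Lemma lbd_td c : lbd (td c) + td (lbd c) = c + sd c.
Proof. by apply: td_homotopy => l _; exact: lbd_tdl. Qed.

(** The homotopies between consecutive subdivisions are added up; their boundaries telescope. *)
Fixpoint tdn N c := if N is N'.+1 then tdn N' c + td (iter N' sd c) else 0.

Lemma lbd_iter_sd N c : lbd (iter N sd c) = iter N sd (lbd c).
Proof. by elim: N => [|N IH]; [exact: erefl|rewrite !iterS lbd_sd IH]. Qed.

Lemma lbd_tdn N c : lbd (tdn N c) + tdn N (lbd c) = c + iter N sd c.
Proof.
elim: N => [|N IH] /=; first by rewrite lbd0 addr0 addF2.
rewrite lbdD [LHS]addrACA. rewrite [X in X + _]IH.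
rewrite -(lbd_iter_sd N c) (lbd_td (iter N sd c)) addrA (addKF2 c (iter N sd c)).
exact: erefl.
Qed.

Lemma iter_sdD N : {morph iter N sd : c d / c + d}.
Proof.
elim: N => [|N IH] c d; first exact: erefl.
by rewrite !iterS IH sdD.
Qed.

Lemma tdnD N : {morph tdn N : c d / c + d}.
Proof.
elim: N => [|N IH] c d /=; first by rewrite addr0.
by rewrite IH iter_sdD tdD addrACA.
Qed.

Lemma iter_sd_nil N : iter N sd (single [::]) = single [::].
Proof. by elim: N => [|N IH]; [exact: erefl|rewrite iterS IH sd_single sdl0]. Qed.

Lemma tdn_nil N : tdn N (single [::]) = 0.
Proof.
elim: N => [|N IH]; first exact: erefl.
by rewrite [tdn _ _]/= IH iter_sd_nil td_single tdl0 addr0.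
Qed.

Definition bary_closed (P : set 'rV[R]_m) :=
  forall l, l != [::] -> (forall x, x \in l -> P x) -> P (bary l).

Lemma supported_sdl (P : set 'rV[R]_m) l : bary_closed P -> (forall x, x \in l -> P x) ->
  supported (inlist P (size l)) (sdl l).
Proof.
move=> Pb; have [n] := ubnP (size l); elim: n l => // n IH l ln lP.
have [->|l0] := eqVneq l [::]; first by rewrite sdl0; exact: supported_single.
rewrite (sdlE l0); have [m' em] : exists m', size l = m'.+1.
  by case: l l0 {ln lP} => // p l; exists (size l).
rewrite em; apply: supported_lcons; first exact: Pb.
apply: supported_extend (@supported_lbdl _ _) _ => l' [e l'l].
have -> : m' = size l' by apply: succn_inj; rewrite -em e.
by apply: IH; [rewrite -ltnS -e|move=> x /l'l/lP].
Qed.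

Lemma supported_sd (P : set 'rV[R]_m) n c : bary_closed P ->
  supported (inlist P n) c -> supported (inlist P n) (sd c).
Proof.
by move=> Pb cP; apply: supported_extend cP _ => l [<- lP]; exact: supported_sdl.
Qed.

Lemma supported_iter_sd (P : set 'rV[R]_m) n N c : bary_closed P ->
  supported (inlist P n) c -> supported (inlist P n) (iter N sd c).
Proof. by move=> Pb cP; elim: N => [|N IH]; [exact: cP|rewrite iterS; exact: supported_sd]. Qed.

Lemma supported_tdl (P : set 'rV[R]_m) l : bary_closed P -> (forall x, x \in l -> P x) ->
  supported (inlist P (size l).+1) (tdl l).
Proof.
move=> Pb; have [n] := ubnP (size l); elim: n l => // n IH l ln lP.
have [->|l0] := eqVneq l [::]; first by rewrite tdl0; exact: supported0.
rewrite (tdlE l0); apply: supported_lcons; first exact: Pb.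
apply: supportedD; first exact: supported_single.
apply: supported_extend (@supported_lbdl _ _) _ => l' [e l'l].
by rewrite e; apply: IH; [rewrite -ltnS -e|move=> x /l'l/lP].
Qed.

Lemma supported_tdn (P : set 'rV[R]_m) n N c : bary_closed P ->
  supported (inlist P n) c -> supported (inlist P n.+1) (tdn N c).
Proof.
move=> Pb cP; elim: N => [|N IH] /=; first exact: supported0.
apply: supportedD; first exact: IH.
rewrite tdE; apply: (supported_extend (supported_iter_sd (N := N) Pb cP)).
by move=> l [<- lP]; exact: supported_tdl.
Qed.

End Subdivision.
Arguments sd {R m} c.
Arguments td {R m} c.
Arguments tdn {R m} N c.

Section Naturality.
Variables (R : realType) (m m' : nat) (f : 'rV[R]_m -> 'rV[R]_m').
Hypothesis f_bary : forall l, l != [::] -> bary (map f l) = f (bary l).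

Definition lmap (c : malg (seq 'rV[R]_m) 'F_2) : malg (seq 'rV[R]_m') 'F_2 :=
  extend (fun l => single (map f l)) c.

Lemma lmapD : {morph lmap : c d / c + d}. Proof. exact: extendD. Qed.
Lemma lmap_single l : lmap (single l) = single (map f l). Proof. exact: extend_single. Qed.
Lemma lmap0 : lmap 0 = 0. Proof. exact: extend0. Qed.
Lemma lmapE c : lmap c = extend (fun l => single (map f l)) c. Proof. by []. Qed.

#[local] Opaque lmap.

Lemma lmap_lcons p c : lmap (lcons p c) = lcons (f p) (lmap c).
Proof.
rewrite (lconsE p c) (extend_additive _ _ lmapD) (lmapE c) (extend_additive _ _ (@lconsD _ (f p))).
by apply: eq_in_extend => l _ /=; rewrite lmap_single lcons_single.
Qed.

Lemma lmap_lbdl l : lmap (lbdl l) = lbdl (map f l).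
Proof.
rewrite !lbdlE (additive_sum _ _ lmapD) size_map; apply: eq_bigr => i _.
by rewrite lmap_single map_cat map_take map_drop.
Qed.

Lemma lmap_sdl l : lmap (sdl l) = sdl (map f l).
Proof.
have [n] := ubnP (size l); elim: n l => [|n IH] l ln; first by exfalso; rewrite ltn0 in ln.
have [->|l0] := eqVneq l [::]; first by rewrite [map _ _]/= !sdl0 lmap_single.
have fl0 : map f l != [::] by case: l l0 {ln}.
rewrite (sdlE l0) (sdlE fl0) lmap_lcons (f_bary l0) -lmap_lbdl; congr lcons.
rewrite sdE (extend_additive _ _ lmapD) lmapE (extend_additive _ _ (@sdD _ _)).
apply: eq_in_extend => l' /supported_lbdl[e _] /=.
by rewrite sd_single IH // -ltnS -e.
Qed.

Lemma lmap_tdl l : lmap (tdl l) = tdl (map f l).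
Proof.
have [n] := ubnP (size l); elim: n l => [|n IH] l ln; first by exfalso; rewrite ltn0 in ln.
have [->|l0] := eqVneq l [::]; first by rewrite [map _ _]/= !tdl0 lmap0.
have fl0 : map f l != [::] by case: l l0 {ln}.
rewrite (tdlE l0) (tdlE fl0) lmap_lcons (f_bary l0) -lmap_lbdl lmapD lmap_single.
apply: (congr1 (fun c => lcons (f (bary l)) (_ + c))).
rewrite tdE (extend_additive _ _ lmapD) lmapE (extend_additive _ _ (@tdD _ _)).
apply: eq_in_extend => l' /supported_lbdl[e _] /=.
by rewrite td_single IH // -ltnS -e.
Qed.

Lemma lmap_sd c : lmap (sd c) = sd (lmap c).
Proof.
rewrite sdE (extend_additive _ _ lmapD) lmapE (extend_additive _ _ (@sdD _ _)).
by apply: eq_in_extend => l _ /=; rewrite sd_single lmap_sdl.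
Qed.

Lemma lmap_td c : lmap (td c) = td (lmap c).
Proof.
rewrite tdE (extend_additive _ _ lmapD) lmapE (extend_additive _ _ (@tdD _ _)).
by apply: eq_in_extend => l _ /=; rewrite td_single lmap_tdl.
Qed.

Lemma lmap_iter_sd N c : lmap (iter N sd c) = iter N sd (lmap c).
Proof. by elim: N => [|N IH]; [exact: erefl|rewrite !iterS lmap_sd IH]. Qed.

Lemma lmap_tdn N c : lmap (tdn N c) = tdn N (lmap c).
Proof.
elim: N => [|N IH]; first exact: lmap0.
by rewrite [tdn _ _]/= lmapD IH lmap_td lmap_iter_sd.
Qed.

End Naturality.

(** * Affine simplices *)

Section Realization.
Variables (R : realType) (n : nat).

Definition affl k (l : seq 'rV[R]_n) (y : simplex R k.+1) : 'rV[R]_n :=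
  \sum_i set_val y 0 i *: nth 0 l i.

Lemma affl_coface k (l : seq 'rV[R]_n) (i : 'I_k.+2) : size l = k.+2 ->
  @affl k.+1 l \o coface i =1 @affl k (take i l ++ drop i.+1 l).
Proof.
move=> ls y; rewrite /affl /= sum_coface_row; apply: eq_bigr => j _; congr (_ *: _).
rewrite nth_cat size_take ls ltn_ord /= /bump; case: ltnP => ji; first by rewrite nth_take.
by rewrite nth_drop addSn subnKC.
Qed.

Lemma continuous_affl k (l : seq 'rV[R]_n) : continuous (@affl k l).
Proof.
have gc : continuous (fun x : 'rV[R]_k.+1 => \sum_i x 0 i *: nth 0 l i).
  apply: continuous_big => [|i _]; first exact: add_continuous.
  move=> x; apply: (@continuousZr_tmp _ _ _ (fun x : 'rV[R]_k.+1 => x 0 i)).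
  exact: coord_continuous.
move=> y; apply: (@continuous_comp _ _ _ set_val
  (fun x : 'rV[R]_k.+1 => \sum_i x 0 i *: nth 0 l i)).
  exact: initial_continuous.
exact: gc.
Qed.

Variables (X : topologicalType) (e : X -> 'rV[R]_n).
Hypothesis e_inj : injective e.

Definition affine1 k (l : seq 'rV[R]_n) : chain2 R k X := of_map e (@affl k l).
Definition affine k c := extend (@affine1 k) c.

Lemma affineD k : {morph @affine k : c d / c + d}. Proof. exact: extendD. Qed.
Lemma affine_single k l : affine k (single l) = affine1 k l. Proof. exact: extend_single. Qed.
Lemma affineE k c : affine k c = extend (@affine1 k) c. Proof. by []. Qed.

#[local] Opaque affine.

Lemma boundary_affine1 k (l : seq 'rV[R]_n) : size l = k.+2 -> liftable e (@affl k.+1 l) ->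
  boundary (affine1 k.+1 l) = affine k (lbdl l).
Proof.
move=> ls hl; rewrite /affine1 (boundary_of_map e_inj hl) lbdlE (additive_sum _ _ (@affineD k)).
rewrite ls; apply: eq_bigr => i _; rewrite affine_single /affine1.
by apply: eq_of_map; exact: affl_coface.
Qed.

Lemma boundary_affine k c :
  supported (fun l => size l = k.+2 /\ liftable e (@affl k.+1 l)) c ->
  boundary (affine k.+1 c) = affine k (lbd c).
Proof.
move=> h; rewrite affineE (extend_additive _ _ (@boundaryD _ _ _)) lbdE.
rewrite (extend_additive _ _ (@affineD k)); apply: eq_in_extend => l /h[ls hl] /=.
exact: boundary_affine1.
Qed.

End Realization.

Lemma chain_map_affine1 (R : realType) n n' (X X' : topologicalType) (e : X -> 'rV[R]_n)
   (e' : X' -> 'rV[R]_n') (g : continuousType X X') (f : {linear 'rV[R]_n -> 'rV[R]_n'}) k l :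
  injective e -> injective e' ->
  (forall x, e' (g x) = f (e x)) -> size l = k.+1 -> liftable e (@affl _ _ k l) ->
  chain_map g (affine1 e k l) = affine1 e' k (map f l).
Proof.
move=> e_inj e'_inj eg ls [s hs]; rewrite /affine1 (of_mapE e_inj hs) chain_map_single.
rewrite (@of_mapE _ _ _ _ e'_inj _ _ (g \o s : singular_simplex R k X')) // => y /=.
rewrite eg hs /affl linear_sum; apply: eq_bigr => i _.
by rewrite linearZ /= (nth_map 0) // ls.
Qed.

(** * Barycentric subdivision *)

Section StandardSimplex.
Variable (R : realType).

Lemma set_val_inj (T : Type) (A : set T) : injective (set_val : A -> T).
Proof. by move=> x y; rewrite !set_valE => /val_inj. Qed.

Lemma set_val_embedding n (A : set 'rV[R]_n) : embedding (set_val : A -> 'rV[R]_n).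
Proof.
split; first exact: set_val_inj.
by move=> U; split=> [[V oV <-]|[V oV <-]]; exists V.
Qed.

Lemma range_set_val (T : Type) (A : set T) : range (set_val : A -> T) = A.
Proof.
apply/seteqP; split=> [_ [x _ <-]|x Ax]; first exact: set_mem (valP x).
by exists (exist _ x (mem_set Ax)).
Qed.

Lemma coface_row_is_linear n (i : 'I_n.+1) : linear (@coface_row R n i).
Proof.
move=> a x y; apply/rowP => j; rewrite !mxE; case: unlift => [j'|]; rewrite ?mxE //.
by rewrite mulr0 addr0.
Qed.

HB.instance Definition _ n (i : 'I_n.+1) :=
  GRing.isLinear.Build R 'rV[R]_n 'rV[R]_n.+1 _ (@coface_row R n i) (coface_row_is_linear i).

Lemma linear_bary m m' (f : {linear 'rV[R]_m -> 'rV[R]_m'}) (l : seq 'rV[R]_m) :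
  l != [::] -> bary (map f l) = f (bary l).
Proof. by move=> _; rewrite /bary size_map big_map linearZ_LR [f _]linear_sum. Qed.

Lemma simplex_affl n k (l : seq 'rV[R]_n) (y : simplex R k.+1) :
  size l = k.+1 -> (forall x, x \in l -> simplex R n x) -> simplex R n (affl l y).
Proof.
move=> ls lP; have [y0 y1] := set_mem (valP y).
have lP' (i : 'I_k.+1) : simplex R n (nth 0 l i) by apply/lP/mem_nth; rewrite ls.
split=> [j|].
  rewrite summxE sumr_ge0 // => i _; rewrite !mxE mulr_ge0 //.
  by have [] := lP' i.
transitivity (\sum_i set_val y 0 i * \sum_j nth 0 l i 0 j).
  under eq_bigr => j _ do rewrite summxE.
  rewrite exchange_big; apply: eq_bigr => i _ /=; rewrite mulr_sumr.
  by apply: eq_bigr => j _; rewrite mxE.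
under eq_bigr => i _ do rewrite (lP' i).2 mulr1.
exact: y1.
Qed.

Lemma liftable_affl n k (l : seq 'rV[R]_n) : inlist (simplex R n) k.+1 l ->
  liftable (set_val : simplex R n -> _) (@affl R n k l).
Proof.
move=> [ls lP]; apply: embedding_liftable (@continuous_affl _ _ _ _) _.
  exact: set_val_embedding.
by move=> y; rewrite range_set_val; exact: simplex_affl.
Qed.

Lemma simplex_bary n : bary_closed (simplex R n).
Proof.
move=> l l0 lP; have s0 : (0 < size l)%N by case: l l0 {lP}.
have s1 : (size l)%:R != 0 :> R by rewrite pnatr_eq0 -lt0n.
split=> [j|].
  rewrite mxE mulr_ge0 ?invr_ge0 ?ler0n // summxE big_seq sumr_ge0 // => x /lP.
  by case.
under eq_bigr => j _ do rewrite mxE summxE.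
rewrite -mulr_sumr exchange_big big_seq.
rewrite (eq_bigr (fun=> 1)) => [|x /lP[]//].
by rewrite -big_seq big_const_seq count_predT iter_addr_0 mulVf.
Qed.

Definition vertices k : seq 'rV[R]_k := [seq vrow R i | i <- enum 'I_k].

Lemma size_vertices k : size (vertices k) = k.
Proof. by rewrite size_map size_enum_ord. Qed.

Lemma nth_vertices k (i : 'I_k) : nth 0 (vertices k) i = vrow R i.
Proof. by rewrite (nth_map i) ?size_enum_ord // nth_ord_enum. Qed.

Lemma simplex_vrow n (i : 'I_n) : simplex R n (vrow R i).
Proof.
split=> [j|]; first by rewrite mxE; case: (_ && _); rewrite ?ler01.
by rewrite (bigD1 i) //= big1 => [|j ji]; rewrite !mxE eqxx ?eqxx ?addr0 // (negPf ji).
Qed.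

Lemma inlist_vertices k : inlist (simplex R k) k (vertices k).
Proof. by split; [exact: size_vertices|move=> x /mapP[i _ ->]; exact: simplex_vrow]. Qed.

Lemma supported_vertices k : supported (inlist (simplex R k) k) (single (vertices k)).
Proof. by apply: supported_single; exact: inlist_vertices. Qed.

Lemma sum_vrow n (x : 'rV[R]_n) : \sum_j x 0 j *: vrow R j = x.
Proof. exact/esym/row_sum_delta. Qed.

Lemma coface_vrow k (i : 'I_k.+1) (j : 'I_k) : coface_row i (vrow R j) = vrow R (lift i j).
Proof.
rewrite coface_rowE (bigD1 j) //= big1 => [|j' jj']; rewrite !mxE eqxx ?eqxx ?scale1r ?addr0 //.
by rewrite (negPf jj') scale0r.
Qed.

Lemma lbdl_vertices k :
  lbdl (vertices k.+1) = \sum_(i < k.+1) single (map (coface_row i) (vertices k)).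
Proof.
rewrite lbdlE size_vertices; apply: eq_bigr => i _; congr single.
apply: (@eq_from_nth _ 0).
  rewrite size_cat size_take size_drop !size_vertices size_map size_vertices.
  by rewrite ltn_ord subSS (subnKC (leq_ord i)).
move=> j; rewrite size_cat size_take size_drop size_vertices ltn_ord subSS.
rewrite (subnKC (leq_ord i)) => lj; rewrite (nth_map 0) ?size_vertices //.
rewrite (nth_vertices (Ordinal lj)) coface_vrow -nth_vertices /= /bump.
rewrite nth_cat size_take size_vertices ltn_ord; case: ltnP => ji; first by rewrite nth_take.
by rewrite nth_drop addSn subnKC.
Qed.

Local Notation saffine := (affine (set_val : simplex R _ -> _)).

Lemma affine_vertices k :
  saffine k (single (vertices k.+1)) = single (@idfun (simplex R k.+1) : singular_simplex R k _).
Proof.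
rewrite affine_single; apply: of_mapE; first exact: set_val_inj.
move=> y /=; rewrite /affl -[LHS]sum_vrow; apply: eq_bigr => i _.
by rewrite nth_vertices.
Qed.

Lemma boundary_saffine n k (c : malg (seq 'rV[R]_n) 'F_2) :
  supported (inlist (simplex R n) k.+2) c ->
  boundary (saffine k.+1 c) = saffine k (lbd c).
Proof.
move=> h; apply: boundary_affine; first exact: set_val_inj.
by apply: supported_sub h => l hl; split; [case: hl|exact: liftable_affl].
Qed.

Lemma chain_map_coface n k (i : 'I_n.+1) (c : malg (seq 'rV[R]_n) 'F_2) :
  supported (inlist (simplex R n) k.+1) c ->
  chain_map (coface i : continuousType _ _) (saffine k c) = saffine k (lmap (coface_row i) c).
Proof.
move=> h; rewrite affineE lmapE.
rewrite (extend_additive _ _ (@chain_mapD _ _ _ _ _)) (extend_additive _ _ (@affineD _ _ _ _ _)).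
apply: eq_in_extend => l /h hl /=; rewrite affine_single.
apply: chain_map_affine1.
- exact: set_val_inj.
- exact: set_val_inj.
- by [].
- by case: hl.
- exact: liftable_affl.
Qed.

Section Natural.
Variables (X : topologicalType) (N : nat).

(** Only the standard simplex is subdivided, and the result is pushed forward by s. Naturality in X
    is then immediate, and compatibility with faces reduces to naturality under the coface maps. *)
Definition sub1 k (s : singular_simplex R k X) : chain2 R k X :=
  chain_map s (saffine k (iter N sd (single (vertices k.+1)))).

Definition hom1 k (s : singular_simplex R k X) : chain2 R k.+1 X :=
  chain_map s (saffine k.+1 (tdn N (single (vertices k.+1)))).

Definition subdivide k (c : chain2 R k X) : chain2 R k X := extend (@sub1 k) c.
Definition sub_homotopy k (c : chain2 R k X) : chain2 R k.+1 X := extend (@hom1 k) c.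

Lemma subdivideD k : {morph @subdivide k : c d / c + d}. Proof. exact: extendD. Qed.
Lemma sub_homotopyD k : {morph @sub_homotopy k : c d / c + d}. Proof. exact: extendD. Qed.

(** Used with F equal to [iter N sd] and to [tdn N]: any additive operation that commutes with
    cofaces can be computed face by face. *)
Lemma face_sum_natural k (F : forall j, malg (seq 'rV[R]_j) 'F_2 -> malg (seq 'rV[R]_j) 'F_2) j
   (s : singular_simplex R k.+1 X) :
  (forall i, {morph F i : c d / c + d}) ->
  (forall i (l : 'I_i.+1) c, lmap (coface_row l) (F i c) = F i.+1 (lmap (coface_row l) c)) ->
  supported (inlist (simplex R k.+1) j.+1) (F _ (single (vertices k.+1))) ->
  chain_map s (saffine j (F _ (lbdl (vertices k.+2)))) =
  \sum_(i < k.+2) chain_map (s \o coface i : singular_simplex R k X)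
     (saffine j (F _ (single (vertices k.+1)))).
Proof.
move=> FD Fn Fs; rewrite lbdl_vertices (additive_sum _ _ (FD _)).
rewrite (additive_sum _ _ (@affineD _ _ _ _ _)) (additive_sum _ _ (@chain_mapD _ _ _ _ _)).
apply: eq_bigr => i _; rewrite -lmap_single -Fn -chain_map_coface //.
by rewrite chain_map_comp.
Qed.

Lemma boundary_subdivide k (c : chain2 R k.+1 X) :
  boundary (subdivide c) = subdivide (boundary c).
Proof.
rewrite [in RHS]boundaryE (extend_additive _ _ (@subdivideD _)).
rewrite (extend_additive _ _ (@boundaryD _ _ _)); apply: eq_in_extend => s _ /=.
rewrite /sub1 boundary_chain_map boundary_saffine; last first.
  exact/supported_iter_sd/supported_vertices/simplex_bary.
rewrite lbd_iter_sd lbd_single (additive_sum _ _ (@subdivideD _)).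
rewrite (face_sum_natural (F := fun j c => iter N sd c)).
- by apply: eq_bigr => i _; rewrite /subdivide extend_single.
- by move=> i; exact: iter_sdD.
- by move=> i l c'; apply: lmap_iter_sd => l' /linear_bary ->.
- exact/supported_iter_sd/supported_vertices/simplex_bary.
Qed.

Lemma cycles_subdivide k (z : chain2 R k X) : cycles z -> cycles (subdivide z).
Proof.
case: k z => [|k] z; first exact: id.
by rewrite /cycles /= boundary_subdivide => ->; rewrite /subdivide extend0.
Qed.

Lemma sub_homotopy_cycle k (z : chain2 R k X) : cycles z ->
  boundary (sub_homotopy z) = z + subdivide z.
Proof.
suff H (s : singular_simplex R k X) : boundary (hom1 s) = single s + sub1 s +
    chain_map s (saffine k (tdn N (lbdl (vertices k.+1)))).
  move=> cz; rewrite (extend_additive _ _ (@boundaryD _ _ _)).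
  rewrite (eq_in_extend (g2 := fun s => single s + sub1 s +
    chain_map s (saffine k (tdn N (lbdl (vertices k.+1)))))); last by move=> s _; exact: H.
  rewrite extend_addf extend_addf extend_id -[RHS]addr0; congr (_ + _).
  (* In degree 0 the formal boundary of a point is the empty list, where [tdn] vanishes; so no cycle
     condition is required. *)
  case: k z cz {H} => [|k] z cz.
    rewrite extend_sum big1 // => s _; rewrite lbdl_vertices big_ord1.
    rewrite (size0nil (size_vertices 0)) [map _ _]/= tdn_nil.
    by rewrite affineE extend0 chain_mapE extend0.
  transitivity (sub_homotopy (boundary z)); last by rewrite cz /sub_homotopy extend0.
  rewrite boundaryE (extend_additive _ _ (@sub_homotopyD _)).
  apply: eq_in_extend => s _ /=; rewrite (face_sum_natural (F := fun j c => tdn N c)).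
  - rewrite (additive_sum _ _ (@sub_homotopyD _)).
    by apply: eq_bigr => i _; rewrite /sub_homotopy extend_single.
  - by move=> i; exact: tdnD.
  - by move=> i l c'; apply: lmap_tdn => l' /linear_bary ->.
  - exact/supported_tdn/supported_vertices/simplex_bary.
rewrite /hom1 boundary_chain_map boundary_saffine; last first.
  exact/supported_tdn/supported_vertices/simplex_bary.
have -> : lbd (tdn N (single (vertices k.+1))) =
    single (vertices k.+1) + iter N sd (single (vertices k.+1)) + tdn N (lbdl (vertices k.+1)).
  by rewrite -lbd_tdn lbd_single addKF2.
have es : (s \o @idfun (simplex R k.+1) : singular_simplex R k X) = s.
  by apply/continuousEP.
rewrite affineD affineD chain_mapD chain_mapD affine_vertices chain_map_single es.
exact: erefl.
Qed.

Lemma chain_map_subdivide (Y : topologicalType) (g : continuousType X Y) k (c : chain2 R k X) :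
  chain_map g (subdivide c) = extend (fun s => chain_map g (sub1 s)) c.
Proof. by rewrite (extend_additive _ _ (@chain_mapD _ _ _ _ _)). Qed.

End Natural.

Lemma subdivide_natural (X Y : topologicalType) (g : continuousType X Y) N k (c : chain2 R k X) :
  chain_map g (subdivide N c) = subdivide N (chain_map g c).
Proof.
rewrite chain_map_subdivide chain_mapE (extend_additive _ _ (@subdivideD _ _ _)).
apply: eq_in_extend => s _ /=; rewrite /subdivide extend_single.
by rewrite /sub1 chain_map_comp.
Qed.

End StandardSimplex.

(** * Fine subdivisions *)

#[local] Opaque subdivide.

Section Compactness.
Variable (R : realType).

Lemma simplex_norm n (x : 'rV[R]_n) : simplex R n x -> `|x| <= 1.
Proof.
move=> [x0 x1]; rewrite [leLHS]mx_normrE; apply: bigmax_le => // -[i j] _ /=.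
rewrite ord1 ger0_norm // -x1 (bigD1 j) //= lerDl sumr_ge0 //.
Qed.

Lemma closed_simplex n : closed (simplex R n).
Proof.
have -> : simplex R n =
    (\bigcap_(i in [set: 'I_n]) (fun x : 'rV[R]_n => x 0 i) @^-1` [set r | 0 <= r]) `&`
    (fun x : 'rV[R]_n => \sum_i x 0 i) @^-1` [set r | r = 1].
  apply/seteqP; split=> x [x0 x1]; split=> //= i.
    by move=> _; exact: x0.
  exact: x0.
apply: closedI.
  apply: closed_bigI => i _; apply: preimage_closed; last exact: closed_ge.
  by move=> x _; exact: coord_continuous.
apply: preimage_closed; last exact: closed_eq.
move=> x _; apply: continuous_big => [|i _]; first exact: add_continuous.
exact: coord_continuous.
Qed.

Lemma compact_simplex n : compact [set: simplex R n].
Proof.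
have cS : compact (simplex R n).
  apply: bounded_closed_compact; last exact: closed_simplex.
  by exists 1; split=> // M M1 x /simplex_norm/le_trans; apply; exact: ltW.
move=> F PF _.
have [|x [Sx cx]] := cS (set_val @ F).
  by apply: (@filterS _ F _ setT) filterT => y _; exact: set_mem (valP y).
exists (exist _ x (mem_set Sx)); split=> // A B FA /= [_ [[V oV <-] /= Vx VB]].
have [|_ [[y Ay <-] Vy]] := cx (set_val @` A) V _ (open_nbhs_nbhs (conj oV Vx)).
  by apply: (@filterS _ F _ A) FA => y Ay; exists y.
by exists y; split=> //; exact: VB.
Qed.

(** Compactness is used in its near-covering form, with eta tending to 0 from the right as the
    parameter; halving both r and eps leaves room for the triangle inequality. *)
Lemma uniformly_continuous n k (g : simplex R k -> 'rV[R]_n) (eps : R) :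
  continuous g -> 0 < eps -> exists2 eta : R, 0 < eta &
    forall y y', `|set_val y - set_val y'| < eta -> `|g y - g y'| < eps.
Proof.
move=> gc eps0.
have /near_covering_withinP :=
  (@compact_near_coveringP _ [set: simplex R k]).1 (@compact_simplex k).
move=> /(_ _ (0 : R)^'+ (fun eta y => forall y' : simplex R k,
   `|set_val y - set_val y'| < eta -> `|g y - g y'| < eps)) [].
  move=> y0 _.
  have /nbhs_ballP[r /= r0 hr] : \forall y \near y0, `|g y0 - g y| < eps / 2.
    by move/cvgrPdist_lt: (gc y0); apply; rewrite divr_gt0.
  exists (ball y0 (r / 2), [set eta | eta < r / 2]).
    split; first by apply: nbhsx_ballx; rewrite divr_gt0.
    by apply: nbhs_right_lt; rewrite divr_gt0.
  move=> [y eta] [/= yr er] _ y' yy'.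
  have hr' x : `|set_val y0 - set_val x| < r -> `|g y0 - g x| < eps / 2.
    by move=> xr; apply: hr; rewrite /ball /= /initial_ball -ball_normE.
  have yr' : `|set_val y0 - set_val y| < r / 2.
    by move: yr; rewrite /ball /= /initial_ball -ball_normE.
  have h1 : `|g y - g y0| < eps / 2.
    rewrite distrC; apply: hr'; apply: lt_le_trans yr' _.
    by rewrite ler_pdivrMr // ler_peMr ?ler1n // ltW.
  have h2 : `|g y0 - g y'| < eps / 2.
    apply: hr'; rewrite [r]splitr.
    have -> : set_val y0 - set_val y' = (set_val y0 - set_val y) + (set_val y - set_val y').
      by rewrite addrA subrK.
    by apply: le_lt_trans (ler_normD _ _) _; apply: ltrD => //; exact: lt_trans er.
  have -> : g y - g y' = (g y - g y0) + (g y0 - g y') by rewrite addrA subrK.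
  by rewrite [eps]splitr; apply: le_lt_trans (ler_normD _ _) _; exact: ltrD.
move=> eta /= eta0 heta; exists (eta / 2); first by rewrite divr_gt0.
move=> y y' yy'; apply: (heta (eta / 2)) yy' => //=.
  rewrite sub0r normrN gtr0_norm ?divr_gt0 //.
  by rewrite ltr_pdivrMr // ltr_pMr // ltr1n.
by rewrite divr_gt0.
Qed.

End Compactness.

(** * Shrinking of the mesh under barycentric subdivision *)

Section Mesh.
Variables (R : realType) (m : nat).
Implicit Types (l : seq 'rV[R]_m) (d : R).

Definition mesh d l := forall x y, x \in l -> y \in l -> `|x - y| <= d.

Lemma sum_const_seq (V : lmodType R) (T : Type) (l : seq T) (p : V) :
  \sum_(x <- l) p = (size l)%:R *: p.
Proof. by rewrite big_const_seq count_predT iter_addr_0 scaler_nat. Qed.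

Lemma bary_ball l (p : 'rV[R]_m) d : l != [::] -> (forall x, x \in l -> `|x - p| <= d) ->
  `|bary l - p| <= d.
Proof.
move=> l0 lp; have s0 : (0 < (size l)%:R :> R) by rewrite ltr0n; case: l l0 {lp}.
have -> : bary l - p = (size l)%:R^-1 *: \sum_(x <- l) (x - p).
  rewrite sumrB scalerBr sum_const_seq scalerA.
  by rewrite mulVf ?gt_eqF // scale1r.
rewrite normrZ ger0_norm ?invr_ge0 ?ler0n // ler_pdivrMl //.
apply: le_trans (ler_norm_sum _ _ _) _.
rewrite big_seq; apply: le_trans (ler_sum _ _) _ => [x|]; first exact: lp.
by rewrite -big_seq (sum_const_seq (V := R^o)).
Qed.

(** The difference of x and the barycentre is the sum of the differences to the other [size l - 1]
    entries, divided by [size l]. The bound M gives all faces of a simplex the same contraction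
    factor. *)
Lemma mesh_bary l M d x : (size l <= M)%N -> 0 <= d -> mesh d l -> x \in l ->
  `|x - bary l| <= (1 - M%:R^-1) * d.
Proof.
move=> lM d0 md xl; have s0 : (0 < size l)%N by case: l xl {lM md}.
have s0R : (0 < (size l)%:R :> R) by rewrite ltr0n.
have h : `|x - bary l| <= (1 - (size l)%:R^-1) * d.
  have -> : x - bary l = (size l)%:R^-1 *: \sum_(y <- rem x l) (x - y).
    rewrite [LHS](_ : _ = (size l)%:R^-1 *: \sum_(y <- l) (x - y)); last first.
      rewrite sumrB scalerBr sum_const_seq scalerA.
      by rewrite mulVf ?gt_eqF // scale1r.
    by rewrite (big_rem x) //= subrr add0r.
  rewrite normrZ ger0_norm ?invr_ge0 ?ler0n // ler_pdivrMl // mulrA mulrBr mulr1.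
  rewrite mulfV ?gt_eqF //.
  apply: le_trans (ler_norm_sum _ _ _) _.
  rewrite big_seq; apply: le_trans (ler_sum _ (G := fun=> d) _) _ => [y /mem_rem yl|].
    exact: md.
  rewrite -big_seq (sum_const_seq (V := R^o)) size_rem // -subn1 natrB //.
apply: le_trans h _; rewrite ler_wpM2r // lerB // lef_pV2 ?posrE ?ltr0n //.
  by rewrite ler_nat.
exact: leq_trans lM.
Qed.

Lemma bary_closed_ball (p : 'rV[R]_m) d : bary_closed [set x | `|x - p| <= d].
Proof. by move=> l l0 lP; exact: bary_ball. Qed.

Lemma supported_mesh_sdl M d l : (size l <= M)%N -> 0 <= d -> mesh d l ->
  supported (mesh ((1 - M%:R^-1) * d)) (sdl l).
Proof.
move=> + d0; have [n] := ubnP (size l); elim: n l => [|n IH] l ln lM md.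
  by exfalso; rewrite ltn0 in ln.
have [->|l0] := eqVneq l [::]; first by rewrite sdl0; apply: supported_single.
rewrite (sdlE l0) lconsE.
set q := _ * d; have q0 : 0 <= q.
  apply: mulr_ge0 d0; rewrite subr_ge0 invf_le1 ?ler1n ?ltr0n.
    by apply: leq_trans lM; case: l l0 {ln md}.
  by apply: leq_trans lM; case: l l0 {ln md}.
(* The mesh of the subdivided faces is bounded by induction. Their distance to the new corner
   [bary l] needs a separate bound, which holds since balls are convex. *)
apply: (@supported_extend _ _ [set l' | mesh q l' /\ forall x, x \in l' -> `|x - bary l| <= q]).
  rewrite sdE; apply: supported_extend (@supported_lbdl _ _) _ => l' [e l'l] l'' hl''.
  have h1 : supported (mesh q) (sdl l').
    apply: IH; [by rewrite -ltnS -e|by apply: leq_trans lM; rewrite e|].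
    by move=> x y /l'l xl /l'l; exact: md.
  have h2 : supported (inlist [set x | `|x - bary l| <= q] (size l')) (sdl l').
    apply: supported_sdl; first exact: bary_closed_ball.
    by move=> x /l'l xl; exact: mesh_bary.
  by split; [exact: (h1 _ hl'')|case: (h2 _ hl'')].
move=> l' [ml' bl']; apply: supported_single => x y; rewrite !inE.
case/predU1P=> [->|xl']; case/predU1P=> [->|yl'].
- by rewrite subrr normr0.
- by rewrite distrC; exact: bl'.
- exact: bl'.
- exact: ml'.
Qed.

Lemma supported_mesh_iter_sd M d N (c : malg (seq 'rV[R]_m) 'F_2) : (0 < M)%N -> 0 <= d ->
  supported [set l | size l = M /\ mesh d l] c ->
  supported [set l | size l = M /\ mesh ((1 - M%:R^-1) ^+ N * d) l] (iter N sd c).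
Proof.
move=> M0 d0 hc; elim: N => [|N IH]; first by rewrite expr0 mul1r.
rewrite iterS sdE; apply: supported_extend IH _ => l [ls ml] l' hl'; split.
  have h : supported (inlist setT (size l)) (sdl l) by apply: supported_sdl.
  by rewrite -ls; case: (h _ hl').
have h : supported (mesh ((1 - M%:R^-1) * ((1 - M%:R^-1) ^+ N * d))) (sdl l).
  apply: supported_mesh_sdl => //; first by rewrite ls.
  by rewrite mulr_ge0 // exprn_ge0 // subr_ge0 invf_le1 ?ler1n ?ltr0n.
by rewrite exprS -mulrA; exact: (h _ hl').
Qed.

Lemma affl_ball k l (y : simplex R k.+1) (p : 'rV[R]_m) d : size l = k.+1 ->
  (forall x, x \in l -> `|x - p| <= d) -> `|affl l y - p| <= d.
Proof.
move=> ls lp; have [y0 y1] := set_mem (valP y).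
have -> : affl l y - p = \sum_i set_val y 0 i *: (nth 0 l i - p).
  under eq_bigr => i _ do rewrite scalerBr.
  by rewrite sumrB -scaler_suml [X in X *: p]y1 scale1r.
apply: le_trans (ler_norm_sum _ _ _) _.
rewrite -[d]mul1r -y1 mulr_suml; apply: ler_sum => i _.
rewrite normrZ ger0_norm; last exact: y0.
by apply: ler_wpM2l; [exact: y0|apply/lp/mem_nth; rewrite ls].
Qed.

Lemma affl_mesh k l (y y' : simplex R k.+1) d : size l = k.+1 -> mesh d l ->
  `|affl l y - affl l y'| <= d.
Proof.
move=> ls ml; apply: affl_ball => // x xl; rewrite distrC; apply: affl_ball => // x' xl'.
exact: ml.
Qed.

End Mesh.

#[local] Transparent subdivide.

Lemma near_all_seq (I : eqType) (T : Type) (F : set_system T) (P : I -> T -> Prop) (s : seq I) :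
  Filter F -> (forall i, i \in s -> \forall x \near F, P i x) ->
  \forall x \near F, forall i, i \in s -> P i x.
Proof.
move=> FF; elim: s => [|i s IH] h; first by apply: (@filterS _ F _ setT) filterT.
have h1 := h i (mem_head _ _).
have h2 := IH (fun j js => h j (mem_behead (s := i :: s) js)).
apply: filterS (filterI h1 h2) => x [Pi Ps] j; rewrite inE => /predU1P[->//|].
exact: Ps.
Qed.

Section Fine.
Variables (R : realType) (n : nat) (X : topologicalType) (e : X -> 'rV[R]_n).

Definition fine_simplex (delta : R) k : set (singular_simplex R k X) :=
  [set s | forall y y', `|e (s y) - e (s y')| < delta].

Definition carried_simplex (Q : set 'rV[R]_n) k : set (singular_simplex R k X) :=
  [set s | forall y, Q (e (s y))].

Lemma supported_chain_map k (Y : topologicalType) (g : continuousType Y X)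
   (P : set (singular_simplex R k X)) (Q : set (singular_simplex R k Y)) (c : chain2 R k Y) :
  supported Q c -> (forall t, Q t -> P (g \o t : singular_simplex R k X)) ->
  supported P (chain_map g c).
Proof.
move=> h gP; rewrite chain_mapE; apply: supported_extend h _ => t /gP Pt.
exact: supported_single.
Qed.

Lemma carried_subdivide Q N k (c : chain2 R k X) :
  supported (@carried_simplex Q k) c -> supported (@carried_simplex Q k) (subdivide N c).
Proof.
move=> h; apply: supported_extend h _ => s sQ.
apply: (@supported_chain_map _ _ _ _ setT) => // t _ y.
exact: sQ.
Qed.

Lemma expr_small (q eta : R) : 0 <= q < 1 -> 0 < eta -> \forall N \near \oo, q ^+ N * 2 < eta.
Proof.
move=> /andP[q0 q1] eta0; have q1' : `|q| < 1 by rewrite ger0_norm.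
have e2 : 0 < eta / 2 by rewrite divr_gt0.
have h : \forall N \near \oo, `|0 - q ^+ N| < eta / 2.
  by move/cvgrPdist_lt: (cvg_expr q1'); apply.
near=> N; rewrite -ltr_pdivlMr // -[ltLHS]ger0_norm ?exprn_ge0 // -normrN -sub0r.
by near: N.
Unshelve. all: by end_near.
Qed.

Lemma fine_sub1 (delta : R) k (s : singular_simplex R k X) : continuous e -> 0 < delta ->
  \forall N \near \oo, supported (@fine_simplex delta k) (sub1 N s).
Proof.
move=> ec delta0; have gc : continuous (e \o s).
  by move=> y; apply: continuous_comp; [exact: cts_fun|exact: ec].
have [eta eta0 heta] := uniformly_continuous gc delta0.
have q01 : 0 <= 1 - (k.+1%:R : R)^-1 < 1.
  by rewrite subr_ge0 invf_le1 ?ltr0n // ler1n /= ltrBlDr ltrDl invr_gt0 ltr0n.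
apply: filterS (expr_small q01 eta0) => N hN.
(* Points of the standard simplex have norm at most 1, which makes 2 an initial mesh. *)
have hv : supported [set l | size l = k.+1 /\ mesh 2 l] (single (vertices R k.+1)).
  apply: supported_single; split; first exact: size_vertices.
  have [_ vP] := inlist_vertices R k.+1.
  move=> x y /vP/simplex_norm x1 /vP/simplex_norm y1.
  by apply: le_trans (ler_normB _ _) _; rewrite -[2]/(1 + 1); exact: lerD.
have := @supported_mesh_iter_sd R k.+1 k.+1 2 N _ isT (ler0n _ 2) hv.
set c := iter N sd _ => hc.
apply: (@supported_chain_map _ _ _ _
  [set t | forall y y', `|set_val (t y) - set_val (t y')| < eta]).
  rewrite affineE; apply: supported_extend hc _ => l [ls ml].
  apply: supported_sub (@supported_of_map _ _ _ _ _ _) => t tl y y'.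
  by rewrite !tl; apply: le_lt_trans (affl_mesh y y' ls ml) hN.
by move=> t ht y y'; exact: heta.
Qed.

Lemma fine_subdivide (delta : R) k (c : chain2 R k X) : continuous e -> 0 < delta ->
  \forall N \near \oo, supported (@fine_simplex delta k) (subdivide N c).
Proof.
move=> ec delta0.
have : \forall N \near \oo, forall s, s \in msupp c ->
    supported (@fine_simplex delta k) (sub1 N s).
  by apply: near_all_seq => s _; exact: fine_sub1.
apply: filterS => N h.
have hc : supported [set s | s \in msupp c] c by [].
exact: supported_extend hc h.
Qed.

End Fine.

(** * Cones *)

Section Cone.
Variables (R : realType) (n : nat).

Definition mkpt k (x : 'rV[R]_k) (h : simplex R k x) : simplex R k :=
  exist _ x (mem_set h).

Definition tail k (y : 'rV[R]_k.+2) : 'rV[R]_k.+1 :=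
  (1 - y 0 ord0)^-1 *: \row_j y 0 (lift ord0 j).

Lemma simplex_tail k (y : 'rV[R]_k.+2) : simplex R k.+2 y -> y 0 ord0 != 1 ->
  simplex R k.+1 (tail y).
Proof.
move=> [y0 y1] yn1.
have e : \sum_j y 0 (lift ord0 j) = 1 - y 0 ord0.
  by rewrite -y1 [in RHS]big_ord_recl addrC addKr.
have p : 0 <= 1 - y 0 ord0 by rewrite -e sumr_ge0.
split=> [j|]; first by rewrite !mxE mulr_ge0 ?invr_ge0.
under eq_bigr => j _ do rewrite !mxE.
by rewrite -mulr_sumr e mulVf // subr_eq0 eq_sym.
Qed.

(* At the apex y = (1, 0, ...) the tail is 0, which is outside the simplex. *)
Definition over_tail k (g : simplex R k.+1 -> 'rV[R]_n) (y : 'rV[R]_k.+2) : 'rV[R]_n :=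
  if pselect (simplex R k.+1 (tail y)) is left h then g (mkpt h) else 0.

Definition cone_fun (p : 'rV[R]_n) k (g : simplex R k.+1 -> 'rV[R]_n)
    (y : simplex R k.+2) : 'rV[R]_n :=
  set_val y 0 ord0 *: p + (1 - set_val y 0 ord0) *: over_tail g (set_val y).

Lemma over_tailE k (g : simplex R k.+1 -> 'rV[R]_n) (y : 'rV[R]_k.+2) (x : simplex R k.+1) :
  tail y = set_val x -> over_tail g y = g x.
Proof.
move=> e; rewrite /over_tail; case: pselect => [h|[]].
  by congr g; apply: val_inj.
by rewrite e; exact: set_mem (valP x).
Qed.

Lemma simplex_val k (y : simplex R k) : simplex R k (set_val y).
Proof. exact: set_mem (valP y). Qed.

Lemma coord_le1 k (y : simplex R k) i : set_val y 0 i <= 1.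
Proof.
have [y0 <-] := simplex_val y; rewrite (bigD1 i) //= lerDl sumr_ge0 //.
Qed.

Lemma cone_fun_apex p k (g : simplex R k.+1 -> 'rV[R]_n) (y : simplex R k.+2) :
  set_val y 0 ord0 = 1 -> cone_fun p g y = p.
Proof. by move=> y1; rewrite /cone_fun y1 subrr scale0r scale1r addr0. Qed.

Lemma cone_funE p k (g : simplex R k.+1 -> 'rV[R]_n) (y : simplex R k.+2) :
  exists x, cone_fun p g y = set_val y 0 ord0 *: p + (1 - set_val y 0 ord0) *: g x.
Proof.
have [y1|yn1] := eqVneq (set_val y 0 ord0) 1.
  exists (mkpt (simplex_vrow R (ord0 : 'I_k.+1))).
  by rewrite cone_fun_apex // y1 subrr scale0r scale1r addr0.
have h := simplex_tail (simplex_val y) yn1.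
exists (mkpt h); rewrite /cone_fun.
by rewrite (@over_tailE _ _ _ (mkpt h)).
Qed.

Lemma cone_fun_coface0 p k (g : simplex R k.+1 -> 'rV[R]_n) :
  cone_fun p g \o coface ord0 =1 g.
Proof.
move=> y /=; have y0 : coface_row ord0 (set_val y) 0 ord0 = 0 by rewrite mxE unlift_none.
rewrite /cone_fun /= y0 scale0r add0r subr0 scale1r; apply: over_tailE.
rewrite /tail y0 subr0 invr1 scale1r; apply/rowP => j.
by rewrite !mxE liftK.
Qed.

Lemma cone_fun_cofaceS p k (g : simplex R k.+2 -> 'rV[R]_n) (i : 'I_k.+2) :
  cone_fun p g \o coface (lift ord0 i) =1 cone_fun p (g \o coface i).
Proof.
move=> y /=.
have y0 : set_val (coface (lift ord0 i) y) 0 ord0 = set_val y 0 ord0.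
  have e : ord0 = lift (lift ord0 i) ord0 :> 'I_k.+3 by apply: val_inj.
  have e' : unlift (lift ord0 i) ord0 = Some ord0 by rewrite [X in unlift _ X]e liftK.
  by rewrite /= mxE e'.
have [y1|yn1] := eqVneq (set_val y 0 ord0) 1.
  by rewrite !cone_fun_apex // y0.
have h := simplex_tail (simplex_val y) yn1.
rewrite /cone_fun y0; congr (_ + _ *: _).
rewrite [RHS](@over_tailE _ _ _ (mkpt h)) //=.
apply: over_tailE; rewrite /tail y0; apply/rowP => j; rewrite !mxE.
case: (unliftP i j) => [m ->|->].
  have -> : lift ord0 (lift i m) = lift (lift ord0 i) (lift ord0 m).
    by apply: val_inj; rewrite /= /bump /= !add1n ltnS addnS.
  by rewrite !liftK !mxE.
by rewrite !unlift_none mulr0.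
Qed.

Lemma drop_continuous k :
  continuous (fun x : 'rV[R]_k.+2 => \row_j x 0 (lift ord0 j) : 'rV[R]_k.+1).
Proof.
move=> x U [P xP PU]; exists (fun p j => if unlift ord0 j is Some j' then P p j' else setT).
  move=> p j; case: unliftP => [j' ->|_]; last exact: filterT.
  by have := xP p j'; rewrite mxE ord1.
move=> y yP; apply: PU => p j; rewrite mxE.
by have := yP p (lift ord0 j); rewrite liftK ord1.
Qed.

(** The tail has no limit at the apex, so continuity there rests on the bound C: the factor
    [1 - y 0 ord0] tends to 0. Away from the apex the tail is continuous. *)
Lemma continuous_cone_fun p k (g : simplex R k.+1 -> 'rV[R]_n) (C : R) :
  (forall x, `|g x| <= C) -> continuous g -> continuous (cone_fun p g).
Proof.
move=> gC gc y; pose sv (z : simplex R k.+2) := set_val z.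
have FF : Filter (nbhs y) := nbhs_filter y.
have c0 : sv z 0 ord0 @[z --> y] --> sv y 0 ord0.
  apply: (@continuous_comp _ _ _ set_val (fun x : 'rV[R]_k.+2 => x 0 ord0)).
    exact: initial_continuous.
  exact: coord_continuous.
suff : cone_fun p g z @[z --> y] --> cone_fun p g y by [].
have [y1|yn1] := eqVneq (set_val y 0 ord0) 1.
  apply/(@cvgrPdist_lt _ _ _ _ FF) => eps eps0; rewrite cone_fun_apex //.
  have C0' : 0 <= C := le_trans (normr_ge0 _) (gC (mkpt (simplex_vrow R (ord0 : 'I_k.+1)))).
  have C0 : 0 < `|p| + C + 1 by rewrite ltr_wpDl ?addr_ge0.
  have h1 : \forall z \near y, `|1 - sv z 0 ord0| < eps / (`|p| + C + 1).
    have d0 : 0 < eps / (`|p| + C + 1) by rewrite divr_gt0.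
    have := (@cvgrPdist_lt _ _ _ _ FF _ _).1 c0 _ d0.
    by rewrite {1}/sv y1.
  near=> z; have [x ->] := cone_funE p g z.
  have -> : p - (sv z 0 ord0 *: p + (1 - sv z 0 ord0) *: g x) =
      (1 - sv z 0 ord0) *: (p - g x).
    by rewrite scalerBr [X in _ = X - _]scalerBl scale1r opprD addrA.
  rewrite normrZ; apply: (@le_lt_trans _ _ (`|1 - sv z 0 ord0| * (`|p| + C + 1))).
    apply: ler_wpM2l => //; apply: le_trans (ler_normB _ _) _.
    by apply: le_trans (lerD (lexx _) (gC x)) _; rewrite lerDl.
  by rewrite -ltr_pdivlMr //; near: z.
have c1 : (1 - sv z 0 ord0) @[z --> y] --> 1 - sv y 0 ord0.
  exact: (@cvgB _ _ _ _ FF _ _ _ _ (@cvg_cst _ (1 : R) _ _ FF) c0).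
suff cg : over_tail g (sv z) @[z --> y] --> over_tail g (sv y).
  exact: (@cvgD _ _ _ _ FF _ _ _ _ (@cvgZr_tmp _ _ _ _ FF _ _ p c0)
                                   (@cvgZ _ _ _ _ FF _ _ _ _ c1 cg)).
have h := simplex_tail (simplex_val y) yn1.
rewrite (@over_tailE _ _ _ (mkpt h)) //.
apply/(@cvgrPdist_lt _ _ _ _ FF) => eps eps0.
have /nbhs_ballP[r /= r0 hr] : \forall x \near mkpt h, `|g (mkpt h) - g x| < eps.
  by move/cvgrPdist_lt: (gc (mkpt h)); apply.
have ct : tail (sv z) @[z --> y] --> tail (sv y).
  apply: (@cvgZ _ _ _ _ FF).
    by apply: (@cvgV _ _ _ FF) c1; rewrite subr_eq0 eq_sym.
  apply: (@continuous_comp _ _ _ set_val (fun x : 'rV[R]_k.+2 => \row_j x 0 (lift ord0 j))).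
    exact: initial_continuous.
  exact: drop_continuous.
have h1 : \forall z \near y, `|tail (sv y) - tail (sv z)| < r.
  by exact: ((@cvgrPdist_lt _ _ _ _ FF _ _).1 ct _ r0).
have h2 : \forall z \near y, sv z 0 ord0 < 1.
  have y1 : 0 < 1 - sv y 0 ord0 by rewrite subr_gt0 lt_neqAle yn1 coord_le1.
  have : \forall z \near y, `|sv y 0 ord0 - sv z 0 ord0| < 1 - sv y 0 ord0.
    exact: ((@cvgrPdist_lt _ _ _ _ FF _ _).1 c0 _ y1).
  apply: filterS => z; rewrite distrC => /(le_lt_trans (ler_norm _)).
  by rewrite ltrBlDr subrK.
apply: (@filterS _ _ FF) (@filterI _ _ FF _ _ h1 h2) => z [zr z1].
have hz := simplex_tail (simplex_val z) (negbT (lt_eqF z1)).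
by rewrite (@over_tailE _ _ _ (mkpt hz)) //; apply: hr; rewrite /ball /= /initial_ball -ball_normE.
Unshelve. all: by end_near.
Qed.

End Cone.

#[local] Opaque subdivide sub_homotopy.

Section ConeOperator.
Variables (R : realType) (n : nat) (X : topologicalType) (e : X -> 'rV[R]_n).
Hypothesis e_inj : injective e.

Definition cone (p : 'rV[R]_n) k (c : chain2 R k X) : chain2 R k.+1 X :=
  extend (fun s : singular_simplex R k X => of_map e (cone_fun p (e \o s))) c.

Lemma coneD p k : {morph @cone p k : c d / c + d}. Proof. exact: extendD. Qed.
Lemma cone_single p k (s : singular_simplex R k X) :
  cone p (single s) = of_map e (cone_fun p (e \o s)).
Proof. exact: extend_single. Qed.
Lemma coneE p k (c : chain2 R k X) :
  cone p c = extend (fun s : singular_simplex R k X => of_map e (cone_fun p (e \o s))) c.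
Proof. exact: erefl. Qed.

#[local] Opaque cone.

Definition conable p k (s : singular_simplex R k X) := liftable e (cone_fun p (e \o s)).

Lemma boundary_cone p k (c : chain2 R k.+1 X) : supported (@conable p k.+1) c ->
  boundary (cone p c) = c + cone p (boundary c).
Proof.
move=> hc; rewrite coneE (extend_additive _ _ (@boundaryD _ _ _)).
rewrite [boundary c]boundaryE (extend_additive _ _ (@coneD _ _)).
rewrite -[X in X + _]extend_id -extend_addf; apply: eq_in_extend => s /hc hs /=.
rewrite (boundary_of_map e_inj hs) big_ord_recl; congr (_ + _).
  by apply: (of_mapE e_inj) => y; rewrite cone_fun_coface0.
rewrite (additive_sum _ _ (@coneD _ _)); apply: eq_bigr => i _.
rewrite cone_single; apply: eq_of_map => y.
exact: (cone_fun_cofaceS p (e \o s) i y).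
Qed.

(** Singular chains are not augmented, so each point of c leaves a copy of the apex behind. *)
Lemma boundary_cone0 p (c : chain2 R 0 X) : supported (@conable p 0) c ->
  boundary (cone p c) = c + extend (fun=> of_map e (fun=> p)) c.
Proof.
move=> hc; rewrite coneE (extend_additive _ _ (@boundaryD _ _ _)).
rewrite -[X in X + _]extend_id -extend_addf; apply: eq_in_extend => s /hc hs /=.
rewrite (boundary_of_map e_inj hs) big_ord_recl big_ord1; congr (_ + _).
  by apply: (of_mapE e_inj) => y; rewrite cone_fun_coface0.
apply: eq_of_map => y; apply: cone_fun_apex.
have [_ y1] := simplex_val (coface (lift ord0 ord0) y).
rewrite big_ord_recl big_ord1 in y1; rewrite -[RHS]y1 /= [X in _ = _ + X]mxE.
by rewrite unlift_none addr0.
Qed.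

End ConeOperator.

(** * Simplicial approximation *)

Section SimplicialApproximation.
Variables (R : realType) (n : nat).
Variables (F : seq {set 'I_n}) (W : {set 'I_n}).

Definition asimp k (u : 'I_k -> 'I_n) : fchain 'I_n :=
  if injectiveb u then [ffun s : {set 'I_n} => (s == [set u i | i in 'I_k]%SET)%:R] else 0.

Lemma injb_card k (f : 'I_k -> 'I_n) : injectiveb f = (#|[set f i | i in 'I_k]%SET| == k).
Proof.
apply/injectiveP/idP => [f_inj|]; first by rewrite card_imset // card_ord.
by rewrite -[X in _ == X]card_ord => /imset_injP inj x y; exact: inj.
Qed.

Lemma im_lift k (u : 'I_k.+1 -> 'I_n) (i : 'I_k.+1) : injective u ->
  [set u (lift i j) | j in 'I_k]%SET = ([set u j | j in 'I_k.+1] :\ u i)%SET.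
Proof.
move=> u_inj; apply/setP => x; rewrite !inE; apply/imsetP/andP.
  by move=> [j _ ->]; split; [rewrite (inj_eq u_inj) eq_sym neq_lift|exact: imset_f].
move=> [xi /imsetP[j _ ex]]; move: xi; rewrite ex (inj_eq u_inj).
by case: (unliftP i j) => [j' -> _|->]; [exists j'|rewrite eqxx].
Qed.

(** If u repeats a vertex at a and b, only the faces omitting a or b can be nondegenerate; these two
    have the same vertex set and cancel. *)
Lemma fbd_asimp k (u : 'I_k.+1 -> 'I_n) :
  fbd (asimp u) = \sum_(i < k.+1) asimp (u \o lift i).
Proof.
rewrite /asimp; case: (boolP (injectiveb u)) => [/injectiveP u_inj|].
  have li i : injectiveb (u \o lift i).
    by apply/injectiveP; apply: inj_comp u_inj lift_inj.
  under eq_bigr => i _ do rewrite li (im_lift i u_inj).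
  apply/ffunP => t; rewrite sum_ffunE ffunE.
  under eq_bigr => i _ do rewrite ffunE.
  under [RHS]eq_bigr => i _ do rewrite ffunE.
  set S := [set _ | _ in _]%SET.
  have [/existsP[x /andP[xt /eqP xS]]|] := boolP [exists x, (x \notin t) && (x |: t == S)%SET].
    have /imsetP[i0 _ xi] : x \in S by rewrite -xS setU11.
    rewrite (bigD1 x) //= xS eqxx big1 ?addr0 => [|x' /andP[x't xx']]; last first.
      case: eqP => // e; move: (setU11 x' t); rewrite e -xS !inE (negPf x't) orbF.
      by rewrite (negPf xx').
    rewrite (bigD1 i0) //= -xi -xS setU1K // eqxx big1 ?addr0 // => i ii0.
    case: eqP => // e; move: xt; rewrite e !inE eqxx /= andbT negbK xi (inj_eq u_inj).
    by rewrite eq_sym (negPf ii0).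
  rewrite negb_exists => /forallP h; rewrite big1 => [|x xt]; last first.
    by have := h x; rewrite xt /= => /negPf ->.
  rewrite big1 // => i _; case: eqP => // e; have := h (u i).
  by rewrite e finset.setD11 /= finset.setD1K ?eqxx // imset_f.
move=> /injectivePn[a [b ab uab]]; rewrite (_ : fbd 0 = 0); last first.
  by apply/ffunP => t; rewrite !ffunE big1 // => i _; rewrite ffunE.
apply/esym; have [a' ea] : exists a', lift b a' = a.
  by case: (unliftP b a) ab => [a' -> _|->]; [exists a'|rewrite eqxx].
have [b' eb] : exists b', lift a b' = b.
  by case: (unliftP a b) ab => [b' -> _|->]; [exists b'|rewrite eqxx].
rewrite (bigD1 a) //= (bigD1 b) //=; last by rewrite eq_sym.
rewrite big1 => [|i /andP[ia ib]]; last first.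
  case: injectiveP => // inj.
  case: (unliftP i a) ia => [ja ea'|->]; last by rewrite eqxx.
  case: (unliftP i b) ib => [jb eb'|->]; last by rewrite eqxx.
  move=> _ _; have /inj e : (u \o lift i) ja = (u \o lift i) jb by rewrite /= -ea' -eb'.
  by rewrite ea' eb' e eqxx in ab.
rewrite addr0.
have im_eq : [set (u \o lift a) i | i in 'I_k]%SET = [set (u \o lift b) i | i in 'I_k]%SET.
  have sub x y : x != y -> u x = u y ->
      [set (u \o lift x) i | i in 'I_k]%SET \subset [set (u \o lift y) i | i in 'I_k]%SET.
    move=> xy uxy; apply/fintype.subsetP => _ /imsetP[i _ ->] /=.
    case: (unliftP y (lift x i)) => [j ->|->]; first by apply/imsetP; exists j.
    case: (unliftP y x) xy => [j ex _|->]; last by rewrite eqxx.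
    by apply/imsetP; exists j => //=; rewrite -ex.
  by apply/eqP; rewrite finset.eqEsubset !sub // eq_sym.
by rewrite !injb_card im_eq; exact: addF2.
Qed.

End SimplicialApproximation.

#[local] Opaque fbd.

Lemma enum_setD1 (T : finType) (A : {set T}) x : enum (A :\ x)%SET = rem x (enum A).
Proof.
rewrite rem_filter ?enum_uniq // /enum_mem -filter_predI.
by apply: eq_filter => y /=; rewrite !inE.
Qed.

Lemma cx_sub (T : finType) (F : seq {set T}) (W : {set T}) (s t : {set T}) :
  s \subset t -> cx F W t -> cx F W s.
Proof.
move=> st /andP[tW /hasP[f fF tf]]; rewrite /cx (fintype.subset_trans st) //=.
by apply/hasP; exists f => //; exact: fintype.subset_trans tf.
Qed.

Lemma embedding_continuous (R : realType) n (X : topologicalType) (e : X -> 'rV[R]_n) :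
  embedding e -> continuous e.
Proof. by move=> [_ e_open]; apply/continuousP => V oV; apply/e_open; exists V. Qed.

Section Pieces.
Variables (R : realType) (n : nat).

Definition vpt k (i : 'I_k) : simplex R k := mkpt (simplex_vrow R i).

Lemma coface_vpt k (i : 'I_k.+1) (j : 'I_k) : coface i (vpt j) = vpt (lift i j).
Proof. by apply: val_inj; exact: coface_vrow. Qed.

Definition face_vertices (s : {set 'I_n}) : seq 'rV[R]_n := [seq vrow R i | i <- enum s].

Lemma supp_affl k (s : {set 'I_n}) (y : simplex R k.+1) : #|s| = k.+1 ->
  supp (affl (face_vertices s) y) \subset s.
Proof.
move=> sk; apply/fintype.subsetP => j; rewrite inE; apply: contraR => js.
rewrite summxE big1 // => i _; have lt : (i < size (enum s))%N by rewrite -cardE sk.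
rewrite !mxE (nth_map j) // mxE eqxx /=; case: eqVneq => [e|]; last by rewrite mulr0.
by move: js; rewrite e -mem_enum mem_nth.
Qed.

Variable v : 'rV[R]_n -> 'I_n.

Definition acell (Y : topologicalType) (e : Y -> 'rV[R]_n) k (s : singular_simplex R k Y) :
  fchain 'I_n := asimp (fun i => v (e (s (vpt i)))).

Definition approx (Y : topologicalType) (e : Y -> 'rV[R]_n) k (c : chain2 R k Y) :
  fchain 'I_n := extend (acell e (k := k)) c.

Lemma approxD (Y : topologicalType) (e : Y -> 'rV[R]_n) k :
  {morph @approx Y e k : c d / c + d}.
Proof. exact: extendD. Qed.

Lemma approx_single (Y : topologicalType) (e : Y -> 'rV[R]_n) k (s : singular_simplex R k Y) :
  approx e (single s) = acell e s.
Proof. exact: extend_single. Qed.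

Lemma fbd_acell (Y : topologicalType) (e : Y -> 'rV[R]_n) k (s : singular_simplex R k.+1 Y) :
  fbd (acell e s) = approx e (face_sum s).
Proof.
rewrite /acell fbd_asimp (additive_sum _ _ (@approxD _ _ _)); apply: eq_bigr => i _.
rewrite approx_single /acell; congr asimp; apply: funext => j /=.
by rewrite -coface_vpt.
Qed.

Lemma fbd_approx (Y : topologicalType) (e : Y -> 'rV[R]_n) k (c : chain2 R k.+1 Y) :
  fbd (approx e c) = approx e (boundary c).
Proof.
rewrite boundaryE (extend_additive _ _ (@approxD _ _ _)).
rewrite [approx e c](_ : _ = extend (acell e (k := k.+1)) c); last exact: erefl.
rewrite (extend_additive _ _ (@fbdD _)); apply: eq_in_extend => s _ /=.
exact: fbd_acell.
Qed.

Lemma approx_chain_map (Y Z : topologicalType) (e : Y -> 'rV[R]_n) (e' : Z -> 'rV[R]_n)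
    (g : continuousType Y Z) k (c : chain2 R k Y) : (forall y, e' (g y) = e y) ->
  approx e' (chain_map g c) = approx e c.
Proof.
move=> eg; rewrite chain_mapE (extend_additive _ _ (@approxD _ _ _)).
apply: eq_in_extend => s _ /=; rewrite approx_single /acell; congr asimp.
by apply: funext => i /=; rewrite eg.
Qed.

Lemma insupp_asimp (P : pred {set 'I_n}) k (u : 'I_k -> 'I_n) :
  P [set u i | i in 'I_k]%SET -> insupp P (asimp u).
Proof.
move=> Pu s; rewrite /asimp; case: ifP => _; last by rewrite ffunE eqxx.
by rewrite ffunE; case: (s =P _) => [->//|_]; rewrite eqxx.
Qed.

Lemma insupp_extend (P : pred {set 'I_n}) (K : choiceType) (Q : set K) (g : K -> fchain 'I_n)
    (c : malg K 'F_2) :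
  supported Q c -> (forall s, Q s -> insupp P (g s)) -> insupp P (extend g c).
Proof.
move=> cQ gP; rewrite extend_sum big_seq; apply: (big_ind (insupp P)).
- by move=> s; rewrite ffunE eqxx.
- exact: insuppD.
- by move=> s /cQ /gP.
Qed.

Variables (delta : R).

(* A fine simplex lies in the open stars of all the vertices chosen for its corners. *)
Lemma fine_supp (Y : topologicalType) (e : Y -> 'rV[R]_n) k (s : singular_simplex R k Y) :
  (forall x, range e x -> delta <= x 0 (v x)) ->
  fine_simplex e delta s -> forall i y, v (e (s (vpt i))) \in supp (e (s y)).
Proof.
move=> hv fs i y; rewrite inE; apply: contraTneq isT => e0.
set x := e (s (vpt i)) in e0 *; set z := e (s y) in e0.
have h : delta <= x 0 (v x) by apply: hv; exists (s (vpt i)).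
have h1 : `|(x - z) 0 (v x)| <= `|x - z|.
  rewrite [leRHS]mx_normrE.
  exact: (le_bigmax_cond _ (fun ij : 'I_1 * 'I_n => `|(x - z) ij.1 ij.2|) (j := (0, v x))).
have := le_lt_trans (ler_norm _) (le_lt_trans h1 (fs _ _)).
by rewrite !mxE e0 subr0 ltNge h.
Qed.

End Pieces.

(** * The homotopy from a fine cycle to its simplicial approximation *)

Section Approximation.
Variables (R : realType) (n : nat) (F : seq {set 'I_n}) (W : {set 'I_n}).
Variables (X : topologicalType) (e : X -> 'rV[R]_n) (Q Q' : set 'rV[R]_n).
Variables (v : 'rV[R]_n -> 'I_n) (delta : R).
Hypothesis e_emb : embedding e.
Hypothesis rangeE : range e =
  [set x | [/\ simplex R n x, cx F [set: 'I_n]%SET (supp x) & Q x]].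
Hypothesis Q_star : forall x u t, Q x -> u \in W -> 0 <= t <= 1 ->
  Q (t *: vrow R u + (1 - t) *: x).
Hypothesis Q_face : forall x, simplex R n x -> supp x \subset W -> Q x.
Hypothesis v_delta : forall x, range e x -> delta <= x 0 (v x).
Hypothesis v_W : forall x, range e x -> Q' x -> v x \in W.

Let e_inj : injective e := e_emb.1.

(** Simplicial chains are ungraded, so the components of other dimensions are dropped here. *)
Definition geom1 k (s : {set 'I_n}) : chain2 R k X :=
  if #|s| == k.+1 then affine1 e k (face_vertices R s) else 0.

Definition geom k (z : fchain 'I_n) : chain2 R k X := \sum_s z s *: geom1 k s.

Lemma geomD k : {morph geom k : z w / z + w}.
Proof.
by move=> z w; rewrite /geom -big_split; apply: eq_bigr => s _; rewrite ffunE scalerDl.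
Qed.

Lemma liftable_face k (s : {set 'I_n}) : cx F W s -> #|s| = k.+1 ->
  liftable e (@affl R n k (face_vertices R s)).
Proof.
move=> sF sk; apply: embedding_liftable e_emb (@continuous_affl _ _ _ _) _ => y.
rewrite rangeE; have ss := supp_affl y sk; have sx : simplex R n (affl (face_vertices R s) y).
  apply: simplex_affl; first by rewrite size_map -cardE.
  by move=> x /mapP[i _ ->]; exact: simplex_vrow.
have /andP[sW sF'] := sF; split=> //.
  by apply: (cx_sub ss); rewrite /cx finset.subsetT.
by apply: Q_face => //; exact: fintype.subset_trans sW.
Qed.

Lemma boundary_geom1 k (s : {set 'I_n}) : cx F W s ->
  boundary (geom1 k.+1 s) = \sum_(i in s) geom1 k (s :\ i)%SET.
Proof.
move=> sF; rewrite /geom1; case: eqP => [sk|sk]; last first.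
  rewrite boundaryE extend0 big1 // => i si; rewrite ifN //; apply/eqP => e1; case: sk.
  by rewrite (cardsD1 i) si e1.
rewrite (boundary_affine1 e_inj) ?size_map -?cardE //; last exact: liftable_face.
rewrite lbdlE size_map (additive_sum _ _ (@affineD _ _ _ _ _)) -[RHS]big_enum /=.
case ex : (enum s) => [|x0 l]; first by move: sk; rewrite cardE ex.
rewrite -ex (big_nth x0) big_mkord; apply: eq_bigr => i _.
rewrite affine_single; set x := nth x0 _ _.
have xs : x \in s by rewrite -mem_enum mem_nth.
rewrite ifT; last by rewrite -eqSS -sk (cardsD1 x s) xs.
congr affine1; rewrite /face_vertices enum_setD1 remE.
by rewrite index_uniq ?enum_uniq // map_cat map_take map_drop.
Qed.

Lemma boundary_geom k z : insupp (cx F W) z -> boundary (geom k.+1 z) = geom k (fbd z).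
Proof.
move=> zF; rewrite /geom fbd_adjoint (additive_sum _ _ (@boundaryD _ _ _)).
apply: eq_bigr => s _; have [->|zs] := eqVneq (z s) 0.
  by rewrite !scale0r boundaryE extend0.
have -> : z s = 1 by move: (z s) zs => [[|[|]]] // i _; exact/val_inj.
by rewrite !scale1r; exact/boundary_geom1/zF.
Qed.

Lemma geom_asimp k (u : 'I_k.+1 -> 'I_n) :
  geom k (asimp u) = if injectiveb u then geom1 k [set u i | i in 'I_k.+1]%SET else 0.
Proof.
rewrite /geom /asimp; case: ifP => _; last by rewrite big1 // => s _; rewrite ffunE scale0r.
rewrite (bigD1 [set u i | i in 'I_k.+1]%SET) //= ffunE eqxx scale1r big1 ?addr0 // => s su.
by rewrite ffunE (negPf su) scale0r.
Qed.

Definition simplicial k (s : singular_simplex R k X) : chain2 R k X := geom k (acell v e s).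

(** Two regions are in play: over Q' the chosen vertices lie in W, whereas the homotopy only has to
    stay in the region Q that cuts out X. In the application Q' is a closed half-space inside Q. *)
Definition good k (s : singular_simplex R k X) :=
  fine_simplex e delta s /\ carried_simplex e Q' s.

(** A carrier for the homotopy: it is stable under coning from the chosen vertices, and the carrier
    of a face is contained in that of the simplex. *)
Definition hull k (s : singular_simplex R k X) : set 'rV[R]_n :=
  [set x | range e x /\ exists y, supp x \subset supp (e (s y))].

Definition corner k (s : singular_simplex R k X) := v (e (s (vpt R ord0))).

(** The method of acyclic carriers. The simplex, its approximation and the homotopy of its faces add
    up to a cycle in the hull, and a cone from a chosen vertex fills it. The corners of the
    approximation may thus be sorted without regard to s. *)
Fixpoint homotopy k : singular_simplex R k X -> chain2 R k.+1 X :=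
  match k with
  | 0 => fun s => cone e (vrow R (corner s)) (single s + simplicial s)
  | k'.+1 => fun s => cone e (vrow R (corner s))
      (single s + simplicial s + extend (@homotopy k') (face_sum s))
  end.

Lemma good_face k (s : singular_simplex R k.+1 X) i : good s ->
  good (s \o coface i : singular_simplex R k X).
Proof. by move=> [h1 h2]; split=> [y y'|y]; [exact: h1|exact: h2]. Qed.

Lemma hull_face k (s : singular_simplex R k.+1 X) i x :
  hull (s \o coface i : singular_simplex R k X) x -> hull s x.
Proof. by move=> [rx [y hy]]; split=> //; exists (coface i y). Qed.

Lemma range_e x : range e (e x). Proof. by exists x. Qed.

Lemma corners_in k (s : singular_simplex R k X) i y : good s ->
  v (e (s (vpt R i))) \in supp (e (s y)).
Proof. by move=> [fs _]; exact: (fine_supp v_delta fs). Qed.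

Lemma corners_W k (s : singular_simplex R k X) i : good s -> v (e (s (vpt R i))) \in W.
Proof. by move=> [_ cs]; exact: v_W (range_e _) (cs _). Qed.

Lemma hull_cone k (s : singular_simplex R k X) x t : good s -> hull s x -> 0 <= t <= 1 ->
  hull s (t *: vrow R (corner s) + (1 - t) *: x).
Proof.
move=> gs [rx [y xy]] /andP[t0 t1]; set x' := _ + _.
(* By fineness the apex lies in the support of every point of s, so moving towards it does not leave
   the simplex that contains x. *)
have sx' : supp x' \subset supp (e (s y)).
  apply/fintype.subsetP => j; rewrite inE; apply: contraR => js.
  have jc : j != corner s.
    by apply: contraNneq js => ->; exact: corners_in.
  have xj : x 0 j = 0.
    by apply/eqP; apply: contraNT js => xj; apply: (fintype.subsetP xy); rewrite inE.
  by rewrite !mxE xj (negPf jc) !mulr0 addr0.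
split; last by exists y.
have [sx _ Qx] : [/\ simplex R n x, cx F [set: 'I_n]%SET (supp x) & Q x].
  by move: rx; rewrite rangeE.
have [_ Fy _] : [/\ simplex R n (e (s y)), cx F [set: 'I_n]%SET (supp (e (s y))) & Q (e (s y))].
  by have := range_e (s y); rewrite rangeE.
rewrite rangeE; split.
- have [x0 x1] := sx; have [c0 c1] := simplex_vrow R (corner s); split=> [j|].
    by rewrite !mxE addr_ge0 // mulr_ge0 ?subr_ge0 //; have := c0 j; rewrite mxE.
  under eq_bigr => j _ do rewrite mxE [X in X + _]mxE [X in _ + X]mxE.
  by rewrite big_split /= -!mulr_sumr x1 c1 !mulr1 addrC subrK.
- exact: cx_sub Fy.
- by apply: Q_star => //; [exact: corners_W|rewrite t0].
Qed.

Lemma cone_hull k (s : singular_simplex R k X) j (c : chain2 R j X) : good s ->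
  supported (carried_simplex e (hull s) (k := j)) c ->
  supported (conable e (vrow R (corner s)) (k := j)) c /\
  supported (carried_simplex e (hull s) (k := j.+1)) (cone e (vrow R (corner s)) c).
Proof.
move=> gs hc.
have hs (t : singular_simplex R j X) y : carried_simplex e (hull s) t ->
    hull s (cone_fun (vrow R (corner s)) (e \o t) y).
  move=> ht; have [x ->] := cone_funE (vrow R (corner s)) (e \o t) y.
  apply: hull_cone; [exact: gs|exact: ht|].
  by apply/andP; split; [have [y0 _] := simplex_val y; exact: y0|exact: coord_le1].
split=> [t /hc ht|].
  apply: embedding_liftable => // [|y]; last by have [] := hs t y ht.
  apply: (@continuous_cone_fun _ _ _ _ _ 1).
    move=> x; apply: simplex_norm; have := range_e (t x); rewrite rangeE.
    by case.
  move=> y; apply: continuous_comp; first exact: cts_fun.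
  exact: embedding_continuous.
rewrite coneE; apply: supported_extend hc _ => t ht.
apply: supported_sub (@supported_of_map _ _ _ _ _ _) => t' et' y.
by rewrite et'; exact: hs.
Qed.

Lemma simplicial_hull k (s : singular_simplex R k X) : good s ->
  supported (carried_simplex e (hull s) (k := k)) (simplicial s).
Proof.
move=> gs; rewrite /simplicial geom_asimp; case: ifP => [/injectiveP u_inj|_]; last first.
  exact: supported0.
rewrite /geom1; case: eqP => [uk|_]; last exact: supported0.
apply: supported_sub (@supported_of_map _ _ _ _ _ _) => t et y.
split; first exact: range_e.
exists (vpt R ord0); rewrite et; apply: fintype.subset_trans (supp_affl y uk) _.
by apply/fintype.subsetP => _ /imsetP[i _ ->]; exact: corners_in.
Qed.

Lemma cx_corners k (s : singular_simplex R k X) : good s ->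
  cx F W [set v (e (s (vpt R i))) | i in 'I_k.+1]%SET.
Proof.
move=> gs; have [_ /andP[_ sF] _] :
    [/\ simplex R n (e (s (vpt R ord0))), cx F [set: 'I_n]%SET (supp (e (s (vpt R ord0))))
      & Q (e (s (vpt R ord0)))].
  by have := range_e (s (vpt R ord0)); rewrite rangeE.
rewrite /cx; apply/andP; split.
  by apply/fintype.subsetP => _ /imsetP[i _ ->]; exact: corners_W.
have /hasP[f fF sf] := sF; apply/hasP; exists f => //.
apply: fintype.subset_trans sf; apply/fintype.subsetP => _ /imsetP[i _ ->].
exact: corners_in.
Qed.

Lemma boundary_simplicial k (s : singular_simplex R k.+1 X) : good s ->
  boundary (simplicial s) = \sum_(i < k.+2) simplicial (s \o coface i : singular_simplex R k X).
Proof.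
move=> gs; rewrite /simplicial boundary_geom; last exact/insupp_asimp/cx_corners.
rewrite fbd_acell /face_sum (additive_sum _ _ (@approxD _ _ _ _ _ _)).
rewrite (additive_sum _ _ (@geomD _)); apply: eq_bigr => i _.
by rewrite approx_single.
Qed.

Definition previous k : singular_simplex R k X -> chain2 R k X :=
  match k with
  | 0 => fun=> 0
  | k'.+1 => fun s => extend (@homotopy k') (face_sum s)
  end.

Lemma homotopyE k (s : singular_simplex R k X) : homotopy s =
  cone e (vrow R (corner s)) (single s + simplicial s + previous s).
Proof. by case: k s => [|k] s; [rewrite addr0|]; exact: erefl. Qed.

Lemma sum_previous k (s : singular_simplex R k.+1 X) :
  \sum_(i < k.+2) previous (s \o coface i : singular_simplex R k X) = 0.
Proof.
case: k s => [|k] s; first by rewrite big1.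
transitivity (extend (@homotopy k) (boundary (face_sum s))).
  rewrite [face_sum s]/face_sum (additive_sum _ _ (@boundaryD _ _ _)).
  rewrite (additive_sum _ _ (@extendD _ _ _)); apply: eq_bigr => i _.
  by rewrite boundary_single.
by rewrite -boundary_single boundary_boundary extend0.
Qed.

(** This starts the induction in degree 0: the apex left behind by the cone is the approximation
    itself, and the two cancel. *)
Lemma simplicial_point (s : singular_simplex R 0 X) : good s ->
  exists2 t : singular_simplex R 0 X, simplicial s = single t &
    of_map e (fun=> vrow R (corner s)) = single t.
Proof.
move=> gs; set u := fun i : 'I_1 => v (e (s (vpt R i))).
have uE : [set u i | i in 'I_1]%SET = [set corner s]%SET.
  apply/setP => x; rewrite finset.in_set1; apply/imsetP/eqP => [[i _ ->]|->].
    by rewrite /corner (ord1 i).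
  by exists ord0.
have [t ht] : liftable e (@affl R n 0 (face_vertices R [set corner s]%SET)).
  by apply: liftable_face; [rewrite -uE; exact: cx_corners|rewrite cards1].
exists t.
  rewrite /simplicial geom_asimp ifT; last by apply/injectiveP => i j _; rewrite !ord1.
  by rewrite uE /geom1 cards1 eqxx; exact: of_mapE.
apply: (of_mapE e_inj) => y; rewrite ht /affl big_ord1 /face_vertices enum_set1 /=.
have [_ y1] := simplex_val y; rewrite big_ord1 in y1.
by rewrite y1 scale1r.
Qed.

Lemma homotopyP k (s : singular_simplex R k X) : good s ->
  supported (carried_simplex e (hull s) (k := k.+1)) (homotopy s) /\
  boundary (homotopy s) = single s + simplicial s + previous s.
Proof.
elim: k s => [|k IH] s gs; rewrite homotopyE.
  have hs : supported (carried_simplex e (hull s) (k := 0)) (single s + simplicial s + previous s).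
    rewrite addr0; apply: supportedD; last exact: simplicial_hull.
    by apply: supported_single => y; split; [exact: range_e|exists y].
  have [cs cc] := cone_hull gs hs; split=> //.
  rewrite (boundary_cone0 e_inj cs) addr0 extendD extend_single.
  have [t -> ->] := simplicial_point gs.
  by rewrite extend_single addF2 addr0.
have hf : supported [set t | exists i, t = s \o coface i :> singular_simplex R k X] (face_sum s).
  by apply: supported_sum => i; apply: supported_single; exists i.
have hs : supported (carried_simplex e (hull s) (k := k.+1)) (single s + simplicial s + previous s).
  apply: supportedD.
    apply: supportedD; last exact: simplicial_hull.
    by apply: supported_single => y; split; [exact: range_e|exists y].
  apply: supported_extend hf _ => _ [i ->].
  have [h1 _] := IH _ (good_face i gs).
  by apply: supported_sub h1 => t ht y; apply: hull_face (ht y).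
have [cs cc] := cone_hull gs hs; split=> //.
rewrite (boundary_cone e_inj cs).
suff -> : boundary (single s + simplicial s + previous s) = 0.
  by rewrite coneE extend0 addr0.
rewrite boundaryD boundaryD boundary_single (boundary_simplicial gs).
have -> : boundary (previous s) = face_sum s +
    \sum_(i < k.+2) simplicial (s \o coface i : singular_simplex R k X).
  rewrite [previous s](_ : _ = extend (@homotopy k) (face_sum s)); last exact: erefl.
  rewrite (extend_additive _ _ (@boundaryD _ _ _)) /face_sum (additive_sum _ _ (@extendD _ _ _)).
  rewrite (eq_bigr (fun i : 'I_k.+2 => single (s \o coface i : singular_simplex R k X) +
    simplicial (s \o coface i : singular_simplex R k X) +
    previous (s \o coface i : singular_simplex R k X))); last first.
    by move=> i _; rewrite extend_single; exact: (IH _ (good_face i gs)).2.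
  by rewrite big_split big_split /= sum_previous addr0.
exact: addF2.
Qed.

Lemma boundary_homotopy k (z : chain2 R k X) : cycles z -> supported (@good k) z ->
  boundary (extend (@homotopy k) z) = z + geom k (approx v e z).
Proof.
move=> cz gz; rewrite (extend_additive _ _ (@boundaryD _ _ _)).
rewrite (eq_in_extend (g2 := fun s => single s + simplicial s + previous s)); last first.
  by move=> s /gz gs; have [_ e1] := homotopyP gs.
rewrite extend_addf extend_addf extend_id.
have -> : extend (@previous k) z = 0.
  case: k z cz {gz} => [|k] z cz; first by rewrite extend_sum big1.
  transitivity (extend (@homotopy k) (boundary z)); last by rewrite cz extend0.
  by rewrite boundaryE (extend_additive _ _ (@extendD _ _ _)).
rewrite addr0 [approx v e z](_ : _ = extend (acell v e (k := k)) z); last exact: erefl.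
by rewrite (extend_additive _ _ (@geomD _)).
Qed.

Lemma insupp_approx k (c : chain2 R k X) : supported (@good k) c ->
  insupp (cx F W) (approx v e c).
Proof.
move=> gc; apply: insupp_extend gc _ => s gs.
exact/insupp_asimp/cx_corners.
Qed.

End Approximation.

Lemma add3_boundary (R : realType) (X : topologicalType) k (z z' y : chain2 R k X)
    (a b c : chain2 R k.+1 X) :
  boundary a = z + z' -> boundary b = z' + y -> boundary c = y -> z = boundary (a + b + c).
Proof.
move=> ea eb ec; rewrite (boundaryD (a + b) c) (boundaryD a b) ea eb ec.
by rewrite -addrA (addKF2 z' y) (addKF2 z z').
Qed.

Theorem lift_boundary (R : realType) n (F : seq {set 'I_n}) (W : {set 'I_n})
    (M X : topologicalType) (eM : M -> 'rV[R]_n) (eX : X -> 'rV[R]_n)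
    (iota : continuousType X M) (Q Q' : set 'rV[R]_n) (v : 'rV[R]_n -> 'I_n) (delta : R)
    k (z : chain2 R k X) (w : chain2 R k.+1 M) :
  embedding eM -> embedding eX -> (forall x, eM (iota x) = eX x) ->
  range eM = [set x | simplex R n x /\ cx F [set: 'I_n]%SET (supp x)] ->
  range eX = [set x | [/\ simplex R n x, cx F [set: 'I_n]%SET (supp x) & Q x]] ->
  (forall x u t, Q x -> u \in W -> 0 <= t <= 1 -> Q (t *: vrow R u + (1 - t) *: x)) ->
  (forall x, simplex R n x -> supp x \subset W -> Q x) ->
  0 < delta ->
  (forall x, range eM x -> delta <= x 0 (v x)) ->
  (forall x, range eX x -> Q' x -> v x \in W) ->
  boundary_reflecting F W ->
  cycles z -> supported (carried_simplex eX Q' (k := k)) z ->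
  chain_map iota z = boundary w -> exists u, z = boundary u.
Proof.
move=> embM embX iotaE rM rX Qstar Qface delta0 vdelta vW reflF cz Qz zw.
have rXM x : range eX x -> range eM x by rewrite rX rM => -[].
(* One N serves the cycle and its filling, so subdivision preserves the relation between them. *)
have [N [fz fw]] := filter_ex (filterI (fine_subdivide z (embedding_continuous embX) delta0)
                                       (fine_subdivide w (embedding_continuous embM) delta0)).
set z' := subdivide N z in fz; set w' := subdivide N w in fw.
have cz' : cycles z' := cycles_subdivide N cz.
have zw' : chain_map iota z' = boundary w'.
  by rewrite /z' subdivide_natural zw boundary_subdivide.
have gz' : supported (good eX Q' delta (k := k)) z'.
  have hc : supported (carried_simplex eX Q' (k := k)) z' by apply: carried_subdivide.
  by move=> s sz'; split; [exact: fz|exact: hc].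
have gw' : supported (good eM setT delta (k := k.+1)) w'.
  by move=> s sw'; split=> //; exact: fw.
have vX x : range eX x -> delta <= x 0 (v x) by move=> /rXM; exact: vdelta.
have az' : approx v eX z' = fbd (approx v eM w').
  by rewrite fbd_approx -zw' (approx_chain_map v z' iotaE).
have rM' : range eM = [set x | [/\ simplex R n x, cx F [set: 'I_n]%SET (supp x) & setT x]].
  by rewrite rM; apply/seteqP; split=> x; [case|case].
have [||U hU eU] := reflF (approx v eM w').
- by rewrite -az'; exact: (insupp_approx rX vX vW gz').
(* The filling lives in the whole complex, where any vertex may be chosen. *)
- by apply: (insupp_approx (Q := setT) rM' vdelta _ gw') => x _ _; rewrite inE.
have e1 := boundary_homotopy embX rX Qstar Qface vX vW cz' gz'.
have e2 := boundary_geom embX rX Qface k hU.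
have e3 : boundary (sub_homotopy N z) = z + z' := sub_homotopy_cycle N cz.
exists (sub_homotopy N z + extend (homotopy eX v (k := k)) z' + geom eX k.+1 U).
rewrite eU -az' in e2.
exact: (add3_boundary e3 e1 e2).
Qed.

(** * The embedding *)

Section CrossPolytope.
Variable R : realType.

Definition pos (j : 'I_6) : 'I_12 := inZp j.
Definition neg (j : 'I_6) : 'I_12 := inZp (j + 6).

Definition phi (i : 'I_12) : 'rV[R]_6 :=
  if (i < 6)%N then unit_vec R (inord i) else - unit_vec R (inord (i - 6)).

Lemma phi_pos j : phi (pos j) = unit_vec R j.
Proof.
rewrite /phi /pos /= modn_small ?ltn_ord; last exact: leq_trans (ltn_ord j) _.
by rewrite inord_val.
Qed.

Lemma neg_val j : val (neg j) = (j + 6)%N.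
Proof. by rewrite /= modn_small // -[12%N]/(6 + 6)%N ltn_add2r. Qed.

Lemma phi_neg j : phi (neg j) = - unit_vec R j.
Proof.
by rewrite /phi -[nat_of_ord _]/(val _) neg_val ltnNge leq_addl /= addnK inord_val.
Qed.

Lemma opposite_pos j : opposite (pos j) = neg j.
Proof. exact: opposite_inZp. Qed.

Lemma opposite_neg j : opposite (neg j) = pos j.
Proof. by rewrite -opposite_pos oppositeK. Qed.

Lemma pos_or_neg i : exists j, i = pos j \/ i = neg j.
Proof.
have [li|le] := ltnP i 6.
  by exists (Ordinal li); left; apply: val_inj; rewrite /= modn_small.
have l6 : (i - 6 < 6)%N by rewrite ltn_subLR.
by exists (Ordinal l6); right; apply: val_inj; rewrite neg_val /= subnK.
Qed.

Lemma phi_opposite i : phi (opposite i) = - phi i.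
Proof.
have [j [->|->]] := pos_or_neg i; rewrite ?opposite_pos ?opposite_neg phi_pos phi_neg //.
by rewrite opprK.
Qed.

Lemma sum_pos_neg (V : nmodType) (G : 'I_12 -> V) :
  \sum_i G i = \sum_(j < 6) (G (pos j) + G (neg j)).
Proof.
rewrite big_split /=.
rewrite (@big_split_ord _ _ _ 6 6); congr (_ + _); apply: eq_bigr => j _; congr G.
  by apply: val_inj; rewrite /= modn_small //; exact: leq_trans (ltn_ord j) _.
by apply: val_inj; rewrite neg_val /= addnC.
Qed.

Definition lin (x : 'rV[R]_12) : 'rV[R]_6 := \sum_i x 0 i *: phi i.

Lemma linE x j : lin x 0 j = x 0 (pos j) - x 0 (neg j).
Proof.
rewrite /lin summxE sum_pos_neg (bigD1 j) //= big1 ?addr0 => [|j' jj'].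
  by rewrite !mxE phi_pos phi_neg !mxE !eqxx mulr1 mulrN mulr1.
by rewrite !mxE phi_pos phi_neg !mxE eqxx (eq_sym j) (negPf jj') oppr0 !mulr0 addr0.
Qed.

Lemma supp_opposite (x : 'rV[R]_12) i : supp x \in P12 -> x 0 i != 0 -> x 0 (opposite i) = 0.
Proof.
move=> sx xi; have := no_opposite sx (a := i); rewrite !inE => /(_ xi).
by rewrite negbK => /eqP.
Qed.

(* The coordinates of a point of P12 are the positive and negative parts of those of
   its image. *)
Definition unfold (y : 'rV[R]_6) : 'rV[R]_12 :=
  \row_i Num.max 0 (if (i < 6)%N then y 0 (inord i) else - y 0 (inord (i - 6))).

Lemma unfold_lin (x : 'rV[R]_12) : simplex R 12 x -> supp x \in P12 -> unfold (lin x) = x.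
Proof.
move=> [x0 x1] sx; apply/rowP => i; rewrite mxE.
have [j [->|->]] := pos_or_neg i.
  have -> : (pos j < 6)%N by rewrite /= modn_small //; exact: leq_trans (ltn_ord j) _.
  have -> : inord (pos j) = j.
    by rewrite /= modn_small ?inord_val //; exact: leq_trans (ltn_ord j) _.
  rewrite linE; have [e|n0] := eqVneq (x 0 (pos j)) 0.
    by rewrite e sub0r; apply/max_idPl; rewrite oppr_le0.
  have := supp_opposite sx n0; rewrite opposite_pos => ->.
  by rewrite subr0; apply/max_idPr.
have -> : (neg j < 6)%N = false by rewrite -[nat_of_ord _]/(val _) neg_val ltnNge leq_addl.
have -> : inord (neg j - 6) = j.
  by rewrite -[nat_of_ord (neg j)]/(val _) neg_val addnK inord_val.
rewrite linE opprB; have [e|n0] := eqVneq (x 0 (neg j)) 0.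
  by rewrite e sub0r; apply/max_idPl; rewrite oppr_le0.
have := supp_opposite sx n0; rewrite opposite_neg => ->.
by rewrite subr0; apply/max_idPr.
Qed.

Lemma continuous_row m (V : topologicalType) (f : V -> 'rV[R]_m) :
  (forall i, continuous (fun x => f x 0 i)) -> continuous f.
Proof.
move=> fc x U [P xP PU].
have : \forall z \near x, forall i, i \in enum 'I_m -> P 0 i (f z 0 i).
  apply: near_all_seq => i _; apply: (fc i x); exact: xP.
apply: filterS => z hz; apply: PU => p i; rewrite (ord1 p); apply: hz.
by rewrite mem_enum.
Qed.

Lemma continuous_lin : continuous lin.
Proof.
apply: continuous_row => j.
have -> : (fun x => lin x 0 j) = (fun x : 'rV[R]_12 => x 0 (pos j) - x 0 (neg j)).
  by apply: funext => x; rewrite linE.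
by move=> x; exact: (continuousB (@coord_continuous R 1 12 0 (pos j) x)
  (@coord_continuous R 1 12 0 (neg j) x)).
Qed.

Lemma continuous_unfold : continuous unfold.
Proof.
apply: continuous_row => i.
have -> : (fun y => unfold y 0 i) = (fun y : 'rV[R]_6 =>
   Num.max 0 (if (i < 6)%N then y 0 (inord i) else - y 0 (inord (i - 6)))).
  by apply: funext => y; rewrite mxE.
pose g (y : 'rV[R]_6) : R := if (i < 6)%N then y 0 (inord i) else - y 0 (inord (i - 6)).
have gc : continuous g.
  rewrite /g; case: (i < 6)%N => y; first exact: coord_continuous.
  exact: (continuousN (@coord_continuous R 1 6 0 (inord (i - 6)) y)).
by move=> y; exact: (continuous_max (@cst_continuous _ _ (0 : R) y) (gc y)).
Qed.

Local Notation M := (@realization R 12 P12).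

Lemma realizationP (x : M) : simplex R 12 (set_val x) /\ supp (set_val x) \in P12.
Proof. exact: set_mem (valP x). Qed.

Lemma linear_extensionE (x : M) : linear_extension phi x = lin (set_val x).
Proof. by []. Qed.

Lemma continuous_linear_extension : continuous (linear_extension (K := P12) phi).
Proof.
move=> x; apply: (@continuous_comp _ _ _ set_val lin); first exact: initial_continuous.
exact: continuous_lin.
Qed.

(** The map [unfold] is a continuous left inverse, which gives injectivity and the induced topology
    at once. *)
Lemma embedding_linear_extension : embedding (linear_extension (K := P12) phi).
Proof.
have uK (x : M) : unfold (linear_extension phi x) = set_val x.
  by have [h1 h2] := realizationP x; exact: unfold_lin.
split=> [x y xy|U].
  by apply: set_val_inj; rewrite -!uK xy.
split=> [[V oV <-]|[V oV <-]].
  exists (unfold @^-1` V); first by move/continuousP: continuous_unfold; apply.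
  by apply/seteqP; split=> x /=; rewrite uK.
by move/continuousP: continuous_linear_extension; apply.
Qed.

End CrossPolytope.

(** * Faces of the cross polytope *)

Section Convexity.
Variables (R : realType) (d : nat).
Implicit Types (A B : set 'rV[R]_d) (c x y : 'rV[R]_d) (t : R).

Definition segment_closed A := forall x y t, A x -> A y -> 0 <= t <= 1 ->
  A (t *: x + (1 - t) *: y).

Lemma convex_segment A : @convex_set R 'rV[R]_d A <-> segment_closed A.
Proof.
split=> [cA x y t Ax Ay /andP[t0 t1]|cA x y p /set_mem Ax /set_mem Ay].
  exact: (set_mem (cA x y (Itv01 t0 t1) (mem_set Ax) (mem_set Ay))).
apply/mem_set; have := cA x y p%:num Ax Ay; apply.
by rewrite ge0 le1.
Qed.

Lemma segment_closed_sum A n (x : 'rV[R]_n) (p : 'I_n -> 'rV[R]_d) :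
  segment_closed A -> simplex R n x -> (forall i, A (p i)) -> A (\sum_i x 0 i *: p i).
Proof.
move=> cA; elim: n x p => [|n IH] x p [x0 x1] Ap.
  by move: x1; rewrite big_ord0 => /eqP; rewrite eq_sym oner_eq0.
rewrite big_ord_recl; have [e|n1] := eqVneq (x 0 ord0) 1.
  have z : \sum_(i < n) x 0 (lift ord0 i) = 0.
    by move: x1; rewrite big_ord_recl e => h; apply: (addrI 1); rewrite addr0.
  rewrite big1 ?addr0 ?e ?scale1r // => i _.
  have /psumr_eq0P/(_ z i isT) -> := fun i (_ : true) => x0 (lift ord0 i).
  by rewrite scale0r.
have s0 : \sum_(i < n) x 0 (lift ord0 i) = 1 - x 0 ord0.
  by rewrite -x1 big_ord_recl addrC addKr.
have p0 : 1 - x 0 ord0 != 0 by rewrite subr_eq0 eq_sym.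
have p1 : 0 <= 1 - x 0 ord0 by rewrite -s0 sumr_ge0.
pose y : 'rV[R]_n := (1 - x 0 ord0)^-1 *: \row_i x 0 (lift ord0 i).
have -> : \sum_(i < n) x 0 (lift ord0 i) *: p (lift ord0 i) =
    (1 - x 0 ord0) *: \sum_(i < n) y 0 i *: p (lift ord0 i).
  rewrite scaler_sumr; apply: eq_bigr => i _.
  by rewrite !mxE scalerA mulrA mulfV // mul1r.
apply: cA => //.
  apply: IH => //; split=> [i|]; first by rewrite !mxE mulr_ge0 ?invr_ge0.
  under eq_bigr => i _ do rewrite !mxE.
  by rewrite -mulr_sumr s0 mulVf.
by rewrite x0 -subr_ge0.
Qed.

Lemma hull_sub A B : segment_closed B -> A `<=` B -> convex_hull A `<=` B.
Proof. by move=> cB AB; apply: smallest_sub => //; apply/convex_segment. Qed.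

Lemma sub_hull A : A `<=` convex_hull A.
Proof. exact: sub_gen_smallest. Qed.

Lemma segment_closed_hull A : segment_closed (convex_hull A).
Proof.
move=> x y t hx hy t01 B [cB AB]; apply: (convex_segment B).1 => //.
  by apply: hx; split.
by apply: hy; split.
Qed.

Lemma dotD c x y : dot c (x + y) = dot c x + dot c y :> R.
Proof.
by rewrite /dot -big_split; apply: eq_bigr => i _; rewrite mxE mulrDr.
Qed.

Lemma dotZ c t x : dot c (t *: x) = t * dot c x :> R.
Proof.
by rewrite /dot mulr_sumr; apply: eq_bigr => i _; rewrite mxE mulrCA.
Qed.

Lemma dot_sum c I (r : seq I) (P : pred I) (p : I -> 'rV[R]_d) :
  dot c (\sum_(i <- r | P i) p i) = \sum_(i <- r | P i) dot c (p i).
Proof.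
by apply: (big_morph (dot c) (dotD c)); rewrite /dot big1 // => i _; rewrite mxE mulr0.
Qed.

Lemma dotC c x : dot c x = dot x c :> R.
Proof. by apply: eq_bigr => i _; rewrite mulrC. Qed.

End Convexity.

Section Faces.
Variable R : realType.
Local Notation phi := (@phi R).
Local Notation lin := (@lin R).
Local Notation M := (@realization R 12 P12).

Lemma dot_phi i j : dot (phi i) (phi j) = (i == j)%:R - (i == opposite j)%:R.
Proof.
have u a b : dot (unit_vec R a) (unit_vec R b) = (a == b)%:R :> R.
  rewrite /dot (bigD1 a) //= big1 ?addr0 => [|c ca]; rewrite !mxE !eqxx ?mul1r //.
  by rewrite (negPf ca) mul0r.
have pn a b : (pos a == neg b) = false.
  by apply/eqP => /(congr1 val); rewrite neg_val /= modn_small => [|]; case: a => a la /=; lia.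
have pp a b : (pos a == pos b) = (a == b).
  apply/eqP/eqP => [/(congr1 val)/=|->//].
  by rewrite !modn_small => [/val_inj| |] //; case: a b => a la [b lb] /=; lia.
have nn a b : (neg a == neg b) = (a == b).
  by apply/eqP/eqP => [/(congr1 val)|->//]; rewrite !neg_val => /addIn/val_inj.
have uN a b : dot (- a) b = - dot a b :> R by rewrite -scaleN1r dotC dotZ dotC mulN1r.
have uN' a b : dot a (- b) = - dot a b :> R by rewrite -scaleN1r dotZ mulN1r.
have [a [->|->]] := pos_or_neg i; have [b [->|->]] := pos_or_neg j;
  rewrite ?opposite_pos ?opposite_neg ?phi_pos ?phi_neg ?uN ?uN' ?u ?opprK
    ?pp ?nn ?pn ?(eq_sym (neg _) (pos _)) ?pn ?subr0 ?sub0r //.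
Qed.

Lemma phi_inj : injective phi.
Proof.
move=> i j e; have : dot (phi i) (phi i) = dot (phi i) (phi j) by rewrite e.
rewrite !dot_phi eqxx opposite_neq subr0; case: eqVneq => // _; case: eqVneq => _ /eqP.
  by rewrite sub0r -subr_eq0 opprK -mulr2n mulrn_eq0 oner_eq0.
by rewrite subr0 oner_eq0.
Qed.

Lemma cross_verticesE : cross_vertices R 6 = range phi.
Proof.
apply/seteqP; split=> [x [j [->|->]]|_ [i _ <-]].
- by exists (pos j) => //; exact: phi_pos.
- by exists (neg j) => //; exact: phi_neg.
have [j [->|->]] := pos_or_neg i; exists j; rewrite ?phi_pos ?phi_neg; tauto.
Qed.

Lemma lin_vrow i : lin (vrow R i) = phi i.
Proof.
rewrite /lin (bigD1 i) //= big1 ?addr0 => [|j ji]; rewrite !mxE !eqxx ?scale1r //.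
by rewrite (negPf ji) scale0r.
Qed.

Lemma linD x y : lin (x + y) = lin x + lin y.
Proof. by rewrite /lin -big_split; apply: eq_bigr => i _; rewrite mxE scalerDl. Qed.

Lemma linZ t x : lin (t *: x) = t *: lin x.
Proof. by rewrite /lin scaler_sumr; apply: eq_bigr => i _; rewrite mxE scalerA. Qed.

Lemma segment_closed_simplex n : segment_closed (simplex R n).
Proof.
move=> x y t [x0 x1] [y0 y1] /andP[t0 t1]; split=> [i|].
  by rewrite !mxE addr_ge0 // mulr_ge0 ?subr_ge0.
under eq_bigr => i _ do rewrite mxE [X in X + _]mxE [X in _ + X]mxE.
by rewrite big_split /= -!mulr_sumr x1 y1 !mulr1 addrC subrK.
Qed.

Lemma cross_polytopeE : cross_polytope R 6 = lin @` simplex R 12.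
Proof.
apply/seteqP; split.
  apply: hull_sub => [_ _ t [x hx <-] [y hy <-] t01|].
    exists (t *: x + (1 - t) *: y); first exact: segment_closed_simplex.
    by rewrite linD !linZ.
  rewrite cross_verticesE => _ [i _ <-]; exists (vrow R i); last exact: lin_vrow.
  exact: simplex_vrow.
move=> _ [x hx <-]; apply: segment_closed_sum => //; first exact: segment_closed_hull.
by move=> i; apply: sub_hull; rewrite cross_verticesE; exists i.
Qed.

Lemma dot_lin c x : dot c (lin x) = \sum_i x 0 i * dot c (phi i).
Proof. by rewrite /lin dot_sum; apply: eq_bigr => i _; rewrite dotZ. Qed.

(** An outer normal of the face spanned by s. As a simplex contains no antipodal pair, it takes the
    value 1 on the vertices in s, and 0 or -1 on the others. *)
Definition normal (s : {set 'I_12}) : 'rV[R]_6 := \sum_(i in s) phi i.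

Lemma dot_normal s j :
  dot (normal s) (phi j) = (j \in s)%:R - (opposite j \in s)%:R.
Proof.
rewrite /normal dotC dot_sum.
have sum_eq k : \sum_(i in s) ((i == k)%:R : R) = (k \in s)%:R.
  have [ks|ks] := boolP (k \in s).
    rewrite (bigD1 k) //= eqxx big1 ?addr0 // => i /andP[_ ik].
    by rewrite (negPf ik).
  by rewrite big1 // => i si; case: eqP => // e; rewrite -e si in ks.
under eq_bigr => i _ do rewrite dotC dot_phi.
by rewrite sumrB !sum_eq.
Qed.

Lemma dot_normal_le1 s j : dot (normal s) (phi j) <= 1.
Proof.
rewrite dot_normal; apply: le_trans (_ : (j \in s)%:R <= 1).
  by rewrite gerBl ler0n.
by case: (j \in s).
Qed.

Lemma dot_normal_eq1 s j : s \in P12 -> (dot (normal s) (phi j) == 1) = (j \in s).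
Proof.
move=> sP; rewrite dot_normal; case: (boolP (j \in s)) => js.
  by rewrite (negPf (no_opposite sP js)) subr0 eqxx.
case: (opposite j \in s); last by rewrite subr0 eq_sym oner_eq0.
by rewrite sub0r -subr_eq0 -opprD oppr_eq0 -mulr2n mulrn_eq0 oner_eq0.
Qed.

Lemma supp_nonempty n (x : 'rV[R]_n) : simplex R n x -> supp x != finset.set0.
Proof.
move=> [_ x1]; apply/eqP => s0; move: x1 => /esym/eqP; rewrite big1 ?oner_eq0 // => i _.
by apply/eqP; move/finset.setP/(_ i): s0; rewrite !inE => /negbT; rewrite negbK.
Qed.

Lemma sub_P12 (s t : {set 'I_12}) : s != finset.set0 -> s \subset t -> t \in P12 -> s \in P12.
Proof.
by rewrite !in_P12 => -> st /andP[_ tK] /=; exact: cx_sub tK.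
Qed.

Lemma face_cell (s : {set 'I_12}) : s \in P12 ->
  linear_extension phi @` cell (K := P12) s =
  cross_polytope R 6 `&` [set x | dot (normal s) x = 1].
Proof.
move=> sP; apply/seteqP; split=> [_ [x xs <-]|].
  have [hx xP] := realizationP x; rewrite linear_extensionE; split.
    by rewrite cross_polytopeE; exists (set_val x).
  rewrite /= dot_lin -[RHS]hx.2; apply: eq_bigr => i _.
  have [->|xi] := eqVneq (set_val x 0 i) 0; first by rewrite mul0r.
  have si : i \in s by apply: (fintype.subsetP xs); rewrite inE.
  by move: si; rewrite -(dot_normal_eq1 _ sP) => /eqP ->; rewrite mulr1.
rewrite cross_polytopeE => _ [[x hx <-] /=]; rewrite dot_lin => e.
have sx : supp x \subset s.
  apply/fintype.subsetP => i; rewrite inE; apply: contraR => nis.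
  (* The slacks are nonnegative with weighted sum 0, so a vertex outside s, where the slack is
     positive, has weight 0. *)
  have z : \sum_i x 0 i * (1 - dot (normal s) (phi i)) = 0.
    under eq_bigr => j _ do rewrite mulrBr mulr1.
    by rewrite sumrB e hx.2 subrr.
  have p j : true -> 0 <= x 0 j * (1 - dot (normal s) (phi j)).
    by move=> _; rewrite mulr_ge0 ?subr_ge0 ?dot_normal_le1 //; exact: hx.1.
  have /eqP := psumr_eq0P p z (i := i) isT.
  by rewrite mulf_eq0 subr_eq0 (eq_sym 1) dot_normal_eq1 // (negPf nis) orbF.
have xP : supp x \in P12 by apply: sub_P12 sx sP; exact: supp_nonempty.
have hM : realization P12 x by split.
by exists (exist _ x (mem_set hM)).
Qed.

Lemma dim_cell (s : {set 'I_12}) : s \in P12 ->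
  dim_le (linear_extension phi @` cell (K := P12) s) 3.
Proof.
move=> sP; have /set0Pn[i0 i0s] : s != finset.set0 by move: sP; rewrite in_P12 => /andP[].
(* There are at most four vertices; if fewer, the default i0 yields zero rows. *)
pose B := \matrix_(k < 3) (phi (nth i0 (enum (s :\ i0)%SET) k) - phi i0).
exists (phi i0), <<B>>%MS; first by rewrite mxrank_gen; exact: rank_leq_row.
move=> _ [x xs <-]; rewrite genmxE linear_extensionE.
have [[x0 x1] _] := realizationP x.
have -> : lin (set_val x) - phi i0 = \sum_i set_val x 0 i *: (phi i - phi i0).
  under eq_bigr => i _ do rewrite scalerBr.
  by rewrite sumrB -scaler_suml [X in X *: phi i0]x1 scale1r.
apply: summx_sub => i _; have [->|xi] := eqVneq (set_val x 0 i) 0.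
  by rewrite scale0r sub0mx.
apply: scalemx_sub; have [->|ii0] := eqVneq i i0; first by rewrite subrr sub0mx.
have is0 : i \in enum (s :\ i0)%SET.
  by rewrite mem_enum !inE ii0; apply: (fintype.subsetP xs); rewrite inE.
have k3 : (index i (enum (s :\ i0)%SET) < 3)%N.
  have := card_P12 sP; rewrite (cardsD1 i0) i0s -[(true + _)%N]/(_.+1) ltnS cardE.
  by apply: leq_trans; rewrite index_mem.
have -> : phi i - phi i0 = row (Ordinal k3) B by rewrite rowK /= nth_index.
exact: row_sub.
Qed.

Lemma polyhedral_embedding_phi : polyhedral_embedding P12 (cross_vertices R 6)
  (skeleton 3 (boundary_complex (cross_polytope R 6))) phi.
Proof.
split; last 2 first.
- exact: embedding_linear_extension.
- move=> s sP; split; last exact: dim_cell.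
  have /set0Pn[i0 i0s] : s != finset.set0 by move: sP; rewrite in_P12 => /andP[].
  have vM (i : 'I_12) : cross_polytope R 6 (phi i).
    by rewrite cross_polytopeE; exists (vrow R i); [exact: simplex_vrow|exact: lin_vrow].
  split.
  + exists (phi i0); rewrite face_cell //; split => //=.
    by apply/eqP; rewrite dot_normal_eq1.
  (* The face is proper because the antipode of one of its vertices lies in the polytope but not in
     the face. *)
  + rewrite face_cell // => e; have := vM (opposite i0); rewrite -e => -[_ /= /eqP].
    by rewrite dot_normal_eq1 // (negPf (no_opposite sP i0s)).
  + exists (normal s), 1; last exact: face_cell.
    move=> x; rewrite cross_polytopeE => -[y [y0 y1] <-]; rewrite dot_lin -[leRHS]y1.
    by apply: ler_sum => i _; rewrite ler_piMr ?dot_normal_le1.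
split=> [i _|i j _ _|].
- by rewrite cross_verticesE; exists i.
- exact: phi_inj.
- by rewrite cross_verticesE.
Qed.

Lemma missing_edgesE : missing_edges P12 =
  [set vset [:: 1; 7]%N; vset [:: 2; 8]%N; vset [:: 3; 9]%N;
       vset [:: 4; 10]%N; vset [:: 5; 11]%N; vset [:: 6; 12]%N].
Proof.
apply/seteqP; split=> e.
  move=> [e2 eP]; have [a la ->] := missing_pair e2 eP.
  by case: a la => [|[|[|[|[|[|//]]]]]] _; rewrite -vset_pair //; rewrite /=; tauto.
have pm (a : nat) : (a < 6)%N -> missing_edges P12 (vset [:: a.+1; (a + 6).+1]%N).
  move=> la; rewrite vset_pair; first exact: pair_missing.
    exact: ltn_trans la _.
  by rewrite -[12%N]/(6 + 6)%N ltn_add2r.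
by move=> [[[[[->|->]|->]|->]|->]|->];
   [exact: (pm 0%N)|exact: (pm 1%N)|exact: (pm 2%N)
   |exact: (pm 3%N)|exact: (pm 4%N)|exact: (pm 5%N)].
Qed.

Lemma diagonal_pair (j : 'I_6) : phi @` [set` [set pos j; neg j]%SET] =
  [set unit_vec R j; - unit_vec R j].
Proof.
apply/seteqP; split=> [_ [i /= + <-]|x [->|->]].
- by rewrite !inE => /orP[] /eqP ->; rewrite ?phi_pos ?phi_neg; [left|right].
- by exists (pos j); rewrite ?phi_pos //= !inE eqxx.
- by exists (neg j); rewrite ?phi_neg //= !inE eqxx orbT.
Qed.

Lemma missing_pos_neg (e : {set 'I_12}) : missing_edges P12 e ->
  exists j : 'I_6, e = [set pos j; neg j]%SET.
Proof.
move=> [e2 eP]; have [a la ->] := missing_pair e2 eP.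
by exists (Ordinal la).
Qed.

Lemma missing_edges_bij : set_bij (missing_edges P12) (cross_diagonals R 6)
  (fun e : {set 'I_12} => convex_hull (phi @` [set` e])).
Proof.
split=> [e /missing_pos_neg[j ->]|e f|_ [j _ <-]].
- by rewrite diagonal_pair; exists j.
- rewrite !in_setE => /missing_pos_neg[i ->] /missing_pos_neg[j ->].
  rewrite !diagonal_pair => h; have [->//|ij] := eqVneq i j; exfalso.
  have : convex_hull [set unit_vec R i; - unit_vec R i] (unit_vec R i).
    by apply: sub_hull; left.
  (* The diagonal in direction j lies in the hyperplane where coordinate i vanishes, but the other
     one does not. *)
  rewrite h => hi; have : [set x : 'rV[R]_6 | x 0 i = 0] (unit_vec R i).
    apply: hull_sub hi => [x y t /= xi yi _|x].
      by rewrite !mxE xi yi !mulr0 addr0.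
    by move=> [->|->] /=; rewrite !mxE eqxx (negPf ij) ?oppr0.
  by move=> /=; rewrite mxE !eqxx => /eqP; rewrite oner_eq0.
- exists [set pos j; neg j]%SET; last by rewrite diagonal_pair.
  exact: pair_missing.
Qed.

End Faces.

(** * Tightness *)

Section Homology.
Variables (R : realType).

Lemma boundary0 k (X : topologicalType) : boundary (0 : chain2 R k.+1 X) = 0.
Proof. by rewrite boundaryE extend0. Qed.

Lemma cyclesD k (X : topologicalType) (z z' : chain2 R k X) :
  cycles z -> cycles z' -> cycles (z + z').
Proof. by case: k z z' => [//|k] z z' /= hz hz'; rewrite boundaryD hz hz' addr0. Qed.

(** Homology classes are literal cosets, so triviality of the kernel has to be turned into equality
    of sets: two classes with the same image differ by a boundary. *)
Lemma induced_map_inj k (X Y : topologicalType) (g : continuousType X Y) :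
  (forall (z : chain2 R k X) (w : chain2 R k.+1 Y), cycles z -> chain_map g z = boundary w ->
     exists u, z = boundary u) ->
  set_inj (@homology R 'F_2 k X) (induced_map g).
Proof.
move=> gP _ _ /set_mem[z1 c1 <-] /set_mem[z2 c2 <-] e.
have h1 : induced_map g (hclass z1) (chain_map g z1).
  by exists z1; exists 0; rewrite subrr boundary0.
move: h1; rewrite e => -[z [w wP] [w' w'P]].
rewrite oppF2 in wP; rewrite oppF2 in w'P.
have [u uP] : exists u, z1 + z2 = boundary u.
  apply: (gP _ (w' + chain_map g w)); first exact: cyclesD.
  by rewrite boundaryD boundary_chain_map -wP -w'P !chain_mapD addrA addKF2.
apply/seteqP; split=> y [t tP]; rewrite oppF2 in tP; exists (t + u);
  rewrite oppF2 boundaryD -uP -tP; [|rewrite (addrC z1)]; by rewrite addrA addKF2.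
Qed.

End Homology.

Section HeavyVertex.
Variables (R : realType) (n : nat).

(** The bound delta must not depend on x, since it fixes the fineness of the subdivision. If every
    vertex with value at least b had a tiny coordinate, the gap below b would pull the average under
    b. *)
Lemma heavy_vertex (a : 'I_n -> R) b : exists2 delta, 0 < delta &
  forall x, simplex R n x ->
    exists i, delta <= x 0 i /\ (b <= \sum_i x 0 i * a i -> b <= a i).
Proof.
(* The gap between b and the values below it, capped at 1 in case there are none. *)
pose eta := \big[Num.min/1]_(i | a i < b) (b - a i).
have eta0 : 0 < eta by apply: lt_bigmin => // i; rewrite subr_gt0.
have etaP i : a i < b -> eta <= b - a i by move=> ib; exact: bigmin_le_cond.
pose C := \sum_i `|a i - b|.
have CP i : a i - b <= C.
  apply: le_trans (ler_norm _) _; rewrite /C (bigD1 i) //= lerDl.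
  by apply: sumr_ge0 => j _; exact: normr_ge0.
have C0 : 0 <= C by apply: sumr_ge0 => i _; exact: normr_ge0.
have Ce0 : 0 < C + eta by rewrite ltr_wpDl.
(* Dividing by [n.+1] makes n terms of size [delta * (C + eta)] add up to strictly less than eta. *)
pose delta := eta / (n.+1%:R * (C + eta)).
have d0 : 0 < delta by rewrite divr_gt0 // mulr_gt0 // ltr0n.
have small : n%:R * (delta * (C + eta)) < eta.
  rewrite [ltRHS](_ : _ = n.+1%:R * (delta * (C + eta))).
    by rewrite ltr_pM2r ?ltr_nat // mulr_gt0.
  by rewrite mulrCA /delta divfK // mulf_neq0 ?pnatr_eq0 // gt_eqF.
have sum_le (f : 'I_n -> R) : (forall i, f i <= delta * (C + eta)) -> \sum_i f i < eta.
  move=> fP; apply: le_lt_trans small; rewrite mulr_natl -[X in _ *+ X]card_ord -sumr_const.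
  by apply: ler_sum => i _; exact: fP.
exists delta => // x [x0 x1]; apply: contrapT => /forallNP h.
have xs i : b <= a i \/ ~ (b <= \sum_i x 0 i * a i) -> x 0 i < delta.
  move=> hi; rewrite ltNge; apply/negP => dx; apply: (h i); split=> // bs.
  by case: hi.
have [bs|bs] := leP b (\sum_i x 0 i * a i).
  (* Vertices below b contribute at most 0 and the others are light; yet the sum equals the average
     minus b plus eta, which is at least eta. *)
  have : \sum_i x 0 i * (a i - b + eta) < eta.
    apply: sum_le => i; have [bi|ib] := leP b (a i).
      apply: (@le_trans _ _ (x 0 i * (C + eta))); first by rewrite ler_wpM2l // lerD2r.
      by rewrite ler_wpM2r ?(ltW Ce0) // ltW // xs //; left.
    apply: (@le_trans _ _ 0); last by rewrite mulr_ge0 // ltW.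
    by rewrite mulr_ge0_le0 // -lerBrDr sub0r lerNr opprB etaP.
  under eq_bigr => i _ do rewrite mulrDr mulrBr.
  rewrite big_split sumrB -!mulr_suml x1 !mul1r; apply/negP; rewrite -leNgt lerDr subr_ge0 //.
have : \sum_i x 0 i * (C + eta) < eta.
  apply: sum_le => i; rewrite ler_wpM2r ?(ltW Ce0) // ltW // xs //; right.
  by apply/negP; rewrite -ltNge.
by rewrite -mulr_suml x1 mul1r ltNge lerDr C0.
Qed.

End HeavyVertex.

Lemma embedding_subspace (R : realType) n (X : topologicalType) (e : X -> 'rV[R]_n) (A : set X) :
  embedding e -> embedding (e \o (set_val : A -> X)).
Proof.
move=> [e_inj e_open]; split=> [x y /e_inj/set_val_inj//|U].
split=> [[V oV <-]|[V oV <-]].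
  by have [W oW <-] := (e_open V).1 oV; exists W.
by exists (e @^-1` V) => //; apply/e_open; exists V.
Qed.

Section Tightness.
Variable R : realType.
Local Notation phi := (@phi R).
Local Notation lin := (@lin R).
Local Notation M := (@realization R 12 P12).
Local Notation f := (linear_extension (K := P12) phi).

Lemma dot_phi_opposite (c : 'rV[R]_6) i : dot c (phi (opposite i)) = - dot c (phi i).
Proof. by rewrite phi_opposite -scaleN1r dotZ mulN1r. Qed.

Lemma continuous_dot (c : 'rV[R]_6) : continuous (dot c).
Proof.
rewrite /dot; elim: (index_enum _) => [|i r IH] x.
  by under eq_fun do rewrite big_nil; exact: cst_continuous.
under eq_fun do rewrite big_cons.
exact: (continuousD (continuousM (@cst_continuous _ _ (c 0 i) x)
  (@coord_continuous R 1 6 0 i x)) (IH x)).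
Qed.

Lemma segment_closed_half_space (E : set 'rV[R]_6) : half_space E -> segment_closed E.
Proof.
move=> [c [b _ [->|->]]] x y t /= hx hy /andP[t0 t1]; rewrite dotD !dotZ.
  have -> : b = t * b + (1 - t) * b by rewrite -mulrDl addrC subrK mul1r.
  (* For t different from 0 the strict inequality comes from x alone; for t equal to 0 the point is
     y. *)
  have [->|tn0] := eqVneq t 0; first by rewrite !mul0r !add0r subr0 !mul1r.
  by apply: ltr_leD; [rewrite ltr_pM2l // lt_neqAle eq_sym tn0|rewrite ler_wpM2l ?subr_ge0 // ltW].
have -> : b = t * b + (1 - t) * b by rewrite -mulrDl addrC subrK mul1r.
by apply: lerD; rewrite ler_wpM2l ?subr_ge0.
Qed.

Section HalfSpace.
Variables (E : set 'rV[R]_6) (c : 'rV[R]_6) (b : R).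
Hypotheses (E_segment : segment_closed E) (E_ge : forall y, b <= dot c y -> E y).
Local Notation X := (f @^-1` E).
Let eX : X -> 'rV[R]_12 := set_val \o set_val.
Let upper : {set 'I_12} := [set i | b <= dot c (phi i)]%SET.
Let Q' := [set x | b <= dot c (lin x)].

Lemma range_realization : range (set_val : M -> 'rV[R]_12) =
  [set x | simplex R 12 x /\ cx K12 [set: 'I_12]%SET (supp x)].
Proof.
rewrite range_set_val; apply/seteqP; split=> x [hx h]; split=> //.
  by move: h; rewrite in_P12 => /andP[].
by rewrite in_P12 supp_nonempty.
Qed.

Lemma range_subspace : range eX =
  [set x | [/\ simplex R 12 x, cx K12 [set: 'I_12]%SET (supp x) & E (lin x)]].
Proof.
apply/seteqP; split=> [_ [x _ <-]|x [x1 x2 x3]].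
  have [h1 h2] : [set x | simplex R 12 x /\ cx K12 [set: 'I_12]%SET (supp x)] (eX x).
    by rewrite -range_realization; exists (set_val x).
  by split=> //; exact: set_mem (valP x).
have [y _ yx] : range (set_val : M -> 'rV[R]_12) x by rewrite range_realization.
have hy : X y by rewrite /= linear_extensionE yx.
by exists (exist _ y (mem_set hy)).
Qed.

Lemma upper_reflecting : upper != finset.set0 -> boundary_reflecting K12 upper.
Proof.
move=> u0; apply: K12_reflecting => //; have [b0|b0] := ltP 0 b; [left|right] => i;
  rewrite !inE dot_phi_opposite => h.
  by rewrite -ltNge; apply: (lt_trans _ b0); rewrite oppr_lt0; exact: lt_le_trans b0 h.
apply: (le_trans b0); rewrite oppr_ge0; rewrite -ltNge in h.
exact: ltW (lt_le_trans h b0).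
Qed.

Lemma carried_cycle k (z : chain2 R k X) (w : chain2 R k.+1 M) :
  cycles z -> supported (carried_simplex eX Q' (k := k)) z ->
  chain_map (@inclusion M X) z = boundary w -> exists u, z = boundary u.
Proof.
move=> zc zQ zw; have [delta d0 dP] := heavy_vertex (fun i => dot c (phi i)) b.
have range_simplex x : range (set_val : M -> 'rV[R]_12) x -> simplex R 12 x.
  by rewrite range_realization => -[].
have range_eX x : range eX x -> simplex R 12 x by rewrite range_subspace => -[].
have [u0|u0] := eqVneq upper finset.set0.
  (* With no vertex in the closed half-space, [heavy_vertex] leaves no point of Q', so the carried
     chain z is zero. *)
  exists 0; rewrite boundary0 [z]sum_single big_seq big1 // => s sz; exfalso.
  have hs := zQ s sz (vpt R ord0).
  have [i [_ hi]] := dP _ (range_eX _ (ex_intro2 _ _ (s (vpt R ord0)) I erefl)).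
  by move/finset.setP/(_ i): u0; rewrite !inE hi // -dot_lin.
have /boolp.choice[v vP] : forall x : 'rV[R]_12, exists i, simplex R 12 x ->
    delta <= x 0 i /\ (Q' x -> i \in upper).
  move=> x.
  have [xs|xs] := pselect (simplex R 12 x); last by exists ord0.
  have [i [di hi]] := dP _ xs; exists i => _; split=> //.
  by rewrite inE /Q' /= dot_lin.
apply: (@lift_boundary R 12 K12 upper M X set_val eX (@inclusion M X)
  [set x | E (lin x)] Q' v delta k z w) => //.
- by apply: embedding_subspace; exact: set_val_embedding.
- exact: range_realization.
- exact: range_subspace.
- move=> x u t /= Ex; rewrite inE => hu t01; rewrite linD !linZ lin_vrow.
  by apply: E_segment => //; exact: E_ge.
- move=> x [x0 x1] xs; apply: E_ge; rewrite dot_lin -[b]mul1r -x1 mulr_suml.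
  apply: ler_sum => i _; have [->|xi] := eqVneq (x 0 i) 0; first by rewrite !mul0r.
  have : i \in upper by apply: (fintype.subsetP xs); rewrite inE.
  by rewrite inE => hi; rewrite ler_wpM2l.
- by move=> x /range_simplex/vP[].
- by move=> x /range_eX/vP[_].
- exact: upper_reflecting.
Qed.

End HalfSpace.

Lemma tight_linear_extension : tight 'F_2 f.
Proof.
split=> [|E hE k]; first exact: embedding_linear_extension.
apply: induced_map_inj => z w zc zw.
have E_seg := segment_closed_half_space hE.
case: hE => c [b _ hE].
(* By compactness, a cycle of an open half-space is carried by a smaller closed one. *)
suff [b' E_ge zb] : exists2 b', forall y, b' <= dot c y -> E y & supported
    (carried_simplex (set_val \o set_val) [set x | b' <= dot c (lin x)] (k := k)) z.
  exact: (@carried_cycle E c b' E_seg E_ge k z w zc zb zw).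
case: hE => EE; last first.
  exists b => [y|s _ y]; first by rewrite EE.
  have EP x : E x -> b <= dot c x by rewrite EE.
  exact: EP (set_mem (valP (s y))).
have EP x : E x -> b < dot c x by rewrite EE.
pose g (s : singular_simplex R k (f @^-1` E)) y := dot c (f (set_val (s y))).
have gc s : continuous (g s).
  have fc : continuous (f \o set_val \o s).
    move=> y; apply: continuous_comp; first exact: cts_fun.
    apply: continuous_comp; first exact: initial_continuous.
    exact: continuous_linear_extension.
  move=> y; apply: (@continuous_comp _ _ _ (f \o set_val \o s) (dot c) y (fc y)).
  exact: continuous_dot.
have : \forall b' \near b^'+, forall s, s \in enum_fset (msupp z) -> forall y, b' <= g s y.
  apply: near_all_seq => s _.
  have ne : [set: simplex R k.+1] !=set0 by exists (vpt R ord0).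
  (* The height attains its minimum on the compact simplex, and that minimum exceeds b strictly; z
     has only finitely many simplices, so one level b' fits all. *)
  have [y _ ymin] := compact_EVT_min ne
    (@compact_simplex R k.+1) (continuous_subspaceT (gc s)).
  have by_ : b < g s y by exact: EP (set_mem (valP (s y))).
  have := nbhs_right_le by_; apply: filterS => b' b'y y'.
  by apply: le_trans b'y (ymin y' _); exact: mem_set.
move=> /(filterI (nbhs_right_gt b)) /filter_ex[b' [bb' b'z]].
exists b' => [y b'y|s sz y]; first by rewrite EE; exact: lt_le_trans bb' b'y.
exact: b'z s sz y.
Qed.

End Tightness.

Theorem theorem5p2 (R : realType) :
  exists phi : 'I_12 -> 'rV[R]_6,
    [/\ polyhedral_embedding P12 (cross_vertices R 6)
          (skeleton 3 (boundary_complex (cross_polytope R 6))) phi,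
        tight 'F_2 (linear_extension (K := P12) phi),
        missing_edges P12 =
          [set vset [:: 1; 7]%N; vset [:: 2; 8]%N; vset [:: 3; 9]%N;
               vset [:: 4; 10]%N; vset [:: 5; 11]%N; vset [:: 6; 12]%N] &
        set_bij (missing_edges P12) (cross_diagonals R 6)
          (fun e : {set 'I_12} => convex_hull (phi @` [set` e]))].
Proof.
exists (phi R); split.
- exact: polyhedral_embedding_phi.
- exact: tight_linear_extension.
- exact: missing_edgesE.
- exact: missing_edges_bij.
Qed.
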